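(* For every integer $n>1.2\cdot 10^5$, every $10^{-4}$-dense partial Latin square of order $n$ is completable.
   Context: A Latin square of order $n$ is an $n\times n$ array filled with symbols from $\{1,\dots,n\}$ such that no symbol is repeated in any row or column. A partial Latin square of order $n$ is an $n\times n$ array in which each cell is either blank or contains one symbol from $\{1,\dots,n\}$, such that no symbol is repeated in any row or column. It is completable if its blank cells can be filled so that the resulting array is a Latin square. A partial Latin square of order $n$ is $\epsilon$-dense if each row contains at most $\epsilon n$ filled (nonblank) cells, each column contains at most $\epsilon n$ filled cells, and each symbol occurs in at most $\epsilon n$ cells. *)

(* Defs.v *)
From HB Require Import structures.
From mathcomp Require Import all_boot all_order all_algebra.
Set Implicit Arguments.
Unset Strict Implicit.
Unset Printing Implicit Defensive.
Import Order.TTheory GRing.Theory Num.Theory.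
Local Open Scope ring_scope.

(* The symbols 1, ..., n are represented by the elements 0, ..., n - 1 of 'I_n;
   a blank cell is None. *)

Definition latin_square (n : nat) (L : 'M['I_n]_n) : Prop :=
  (forall i : 'I_n, injective (fun j : 'I_n => L i j)) /\
  (forall j : 'I_n, injective (fun i : 'I_n => L i j)).

Definition partial_latin_square (n : nat) (P : 'M[option 'I_n]_n) : Prop :=
  (forall (i j1 j2 s : 'I_n),
     P i j1 = Some s -> P i j2 = Some s -> j1 = j2) /\
  (forall (j i1 i2 s : 'I_n),
     P i1 j = Some s -> P i2 j = Some s -> i1 = i2).

Definition completable (n : nat) (P : 'M[option 'I_n]_n) : Prop :=
  exists L : 'M['I_n]_n,
    latin_square L /\ (forall i j s : 'I_n, P i j = Some s -> L i j = s).

Definition eps_dense (R : numDomainType) (eps : R) (n : nat)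
    (P : 'M[option 'I_n]_n) : Prop :=
  [/\ forall i : 'I_n, #|[set j : 'I_n | P i j != None]|%:R <= eps * n%:R,
      forall j : 'I_n, #|[set i : 'I_n | P i j != None]|%:R <= eps * n%:R
    & forall s : 'I_n,
        #|[set c : 'I_n * 'I_n | P c.1 c.2 == Some s]|%:R <= eps * n%:R].

(* Main.v *)
Require Import Defs.
From mathcomp Require Import all_boot all_order all_algebra all_fingroup.
From mathcomp Require Import zify.
Set Implicit Arguments.
Unset Strict Implicit.
Unset Printing Implicit Defensive.

(* A Latin square is viewed as a set of triples (row, column, symbol) in which
   every pair of labels on two axes occurs exactly once. One starts from the
   Cayley table of the dihedral group of order n, n even, or, n odd, from the
   prolongation along a near transversal of the one of order n - 1. For
   reflections s the identity (x s) s = x makes every triple of the table belong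
   to n / 2 intercalates, so after the exchange of a bounded number of
   intercalates per inserted triple many reference triples remain untouched.
   The rows and columns of the partial square P are first permuted at random: few
   triples of P then compete for the same triple of the table, and no line of the
   table is hit too often. The triples of P are inserted one after the other,
   each by exchanging at most 36 triples, none of which covers a pair of another
   triple of P unless it covers one of the inserted triple. A load function tells
   which lines have been used too much and have to be avoided. *)

(** * Partial Latin squares as sets of triples *)

(** The obstacle is quantitative. Let m be the largest number of triples of P on a line. P may
    contain about n * m triples, and at 36 exchanged triples per insertion the table would run out
    of intact intercalates. Relabelling makes all but O(m ^ 2) triples of P isolated: the three
    triples that cover the pairs of an isolated triple are reference triples and cover no pair of
    another triple of P. Such a triple is inserted at the price of 10 exchanged triples. Isolation
    survives every other insertion, so the isolated triples can wait until the end, when less room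
    is left.

    Parity (rotation or reflection) governs all choices: an intercalate of the table is obtained
    from two columns of opposite parity and any row. An inserted triple usually violates the
    additivity of parities, so the exchanges are arranged so that two violations cancel. In odd
    order the added label of each axis has no parity; triples of P through it need an insertion of
    their own. *)

Inductive axis := A0 | A1 | A2.

Definition nxt (a : axis) := match a with A0 => A1 | A1 => A2 | A2 => A0 end.

Section Triples.

Variable T : finType.
Implicit Types (t q : T * T * T) (L P G : {set T * T * T}).

Definition co (a : axis) t : T :=
  match a with A0 => t.1.1 | A1 => t.1.2 | A2 => t.2 end.

(* A set of triples is a partial Latin square when each [op a] is injective on
   it, a Latin square when each [op a] is bijective. *)
Definition op (a : axis) t : T * T := (co (nxt a) t, co (nxt (nxt a)) t).

Definition plat L :=
  forall a t t', t \in L -> t' \in L -> op a t = op a t' -> t = t'.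

Definition latin L := plat L /\ forall a u, exists2 t, t \in L & op a t = u.

Definition share2 q t :=
  [|| op A0 q == op A0 t, op A1 q == op A1 t | op A2 q == op A2 t].

Definition bad P t := [exists q in P, share2 q t].

Definition fresh P L t := (t \in L) && ~~ bad P t.

Lemma share2P q t : reflect (exists a, op a q = op a t) (share2 q t).
Proof.
apply: (iffP or3P) => [[/eqP e|/eqP e|/eqP e]|[[] ->]].
- by exists A0.
- by exists A1.
- by exists A2.
- by apply: Or31.
- by apply: Or32.
by apply: Or33.
Qed.

Lemma badP P t : reflect (exists q a, q \in P /\ op a q = op a t) (bad P t).
Proof.
apply: (iffP existsP) => [[q /andP[qP /share2P[a e]]]|[q [a [qP e]]]].
  by exists q, a.
by exists q; rewrite qP; apply/share2P; exists a.
Qed.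

Lemma badPn P t :
  reflect (forall q a, q \in P -> op a q <> op a t) (~~ bad P t).
Proof.
apply: (iffP idP) => [nb q a qP e|H].
  by case/negP: nb; apply/badP; exists q, a.
by apply/negP => /badP[q [a [qP /H]]]; exact.
Qed.

Lemma bad_self P t : t \in P -> bad P t.
Proof. by move=> tP; apply/badP; exists t, A0. Qed.

Lemma op_co a b t t' : a <> b -> op a t = op a t' -> co b t = co b t'.
Proof. by case: a; case: b => // _ []. Qed.

Definition switch L (r g c h x y : T) : {set T * T * T} :=
  [set t | (t \in [:: (r, c, y); (r, h, x); (g, c, x); (g, h, y)])
         || (t \in L) && (t \notin [:: (r, c, x); (r, h, y); (g, c, y); (g, h, x)])].

Lemma latin_switch L r g c h x y : latin L -> x != y ->
  (r, c, x) \in L -> (r, h, y) \in L -> (g, c, y) \in L -> (g, h, x) \in L ->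
  latin (switch L r g c h x y).
Proof.
move=> [pl ex] xy m1 m2 m3 m4.
have ch : c != h.
  by apply: contraNneq xy => e; have := pl A2 _ _ m1 m2; rewrite /op /= e => /(_ erefl) [] ->.
have rg : r != g.
  by apply: contraNneq xy => e; have := pl A2 _ _ m1 m3; rewrite /op /= e => /(_ erefl) [] ->.
(* On each axis, the pair of a new triple is already the pair of one of the four removed ones, so no
   remaining triple of L has it. *)
have key a t' t : t' \in [:: (r, c, y); (r, h, x); (g, c, x); (g, h, y)] ->
   t \in L -> op a t = op a t' -> t \in [:: (r, c, x); (r, h, y); (g, c, y); (g, h, x)].
  rewrite !inE; case: a => /or4P[] /eqP -> tL e.
  - by rewrite (pl A0 _ _ tL m3 e) eqxx ?orbT.
  - by rewrite (pl A0 _ _ tL m4 e) eqxx ?orbT.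
  - by rewrite (pl A0 _ _ tL m1 e) eqxx ?orbT.
  - by rewrite (pl A0 _ _ tL m2 e) eqxx ?orbT.
  - by rewrite (pl A1 _ _ tL m2 e) eqxx ?orbT.
  - by rewrite (pl A1 _ _ tL m1 e) eqxx ?orbT.
  - by rewrite (pl A1 _ _ tL m4 e) eqxx ?orbT.
  - by rewrite (pl A1 _ _ tL m3 e) eqxx ?orbT.
  - by rewrite (pl A2 _ _ tL m1 e) eqxx ?orbT.
  - by rewrite (pl A2 _ _ tL m2 e) eqxx ?orbT.
  - by rewrite (pl A2 _ _ tL m3 e) eqxx ?orbT.
  - by rewrite (pl A2 _ _ tL m4 e) eqxx ?orbT.
split=> [a t t'|a u].
  rewrite !in_set => /orP[t1|/andP[tL tn]] /orP[t1'|/andP[tL' tn']] e.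
  - move: t1 t1' e; rewrite !inE.
    case: a => /or4P[] /eqP-> /or4P[] /eqP-> //; rewrite /op /= => /eqP;
    rewrite xpair_eqE ?eqxx ?(eq_sym y) ?(eq_sym h) ?(eq_sym g)
      ?(negbTE xy) ?(negbTE ch) ?(negbTE rg) ?andbF //.
  - by move: (key a t t' t1 tL' (esym e)); rewrite (negbTE tn').
  - by move: (key a t' t t1' tL e); rewrite (negbTE tn).
  - exact: pl a _ _ tL tL' e.
have [t tL <-] := ex a u.
case: (boolP (t \in [:: (r, c, x); (r, h, y); (g, c, y); (g, h, x)])) => told; last first.
  by exists t => //; rewrite in_set told tL orbT.
have mem t' : t' \in [:: (r, c, y); (r, h, x); (g, c, x); (g, h, y)] -> t' \in switch L r g c h x y.
  by rewrite in_set => ->.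
move: told; rewrite !inE; case: a => /or4P[] /eqP ->.
- by exists (g, c, x) => //; apply: mem; rewrite !inE eqxx ?orbT.
- by exists (g, h, y) => //; apply: mem; rewrite !inE eqxx ?orbT.
- by exists (r, c, y) => //; apply: mem; rewrite !inE eqxx ?orbT.
- by exists (r, h, x) => //; apply: mem; rewrite !inE eqxx ?orbT.
- by exists (r, h, x) => //; apply: mem; rewrite !inE eqxx ?orbT.
- by exists (r, c, y) => //; apply: mem; rewrite !inE eqxx ?orbT.
- by exists (g, h, y) => //; apply: mem; rewrite !inE eqxx ?orbT.
- by exists (g, c, x) => //; apply: mem; rewrite !inE eqxx ?orbT.
- by exists (r, c, y) => //; apply: mem; rewrite !inE eqxx ?orbT.
- by exists (r, h, x) => //; apply: mem; rewrite !inE eqxx ?orbT.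
- by exists (g, c, x) => //; apply: mem; rewrite !inE eqxx ?orbT.
- by exists (g, h, y) => //; apply: mem; rewrite !inE eqxx ?orbT.
Qed.

End Triples.

(** * Exchange of one intercalate and of three linked intercalates *)

Section Exchange.

Variable T : finType.
Implicit Types (t q : T * T * T) (L P : {set T * T * T}).

Lemma plat_row L r c c' s : plat L -> (r, c, s) \in L -> (r, c', s) \in L -> c = c'.
Proof. by move=> pl m1 m2; case: (pl A1 _ _ m1 m2 erefl). Qed.
Lemma plat_col L r r' c s : plat L -> (r, c, s) \in L -> (r', c, s) \in L -> r = r'.
Proof. by move=> pl m1 m2; case: (pl A0 _ _ m1 m2 erefl). Qed.
Lemma plat_sym L r c s s' : plat L -> (r, c, s) \in L -> (r, c, s') \in L -> s = s'.
Proof. by move=> pl m1 m2; case: (pl A2 _ _ m1 m2 erefl). Qed.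

Lemma switch_old L r g c h x y t :
  t \in L -> t \notin switch L r g c h x y ->
  t \in [:: (r, c, x); (r, h, y); (g, c, y); (g, h, x)].
Proof. by rewrite /switch in_set negb_or negb_and negbK => -> /= /andP[]. Qed.

Lemma switch_new L r g c h x y t :
  t \in switch L r g c h x y -> t \notin L ->
  t \in [:: (r, c, y); (r, h, x); (g, c, x); (g, h, y)].
Proof. by rewrite /switch in_set => /orP[] // /andP[->]. Qed.

Lemma mem_switch_new L r g c h x y t :
  t \in [:: (r, c, y); (r, h, x); (g, c, x); (g, h, y)] -> t \in switch L r g c h x y.
Proof. by rewrite in_set => ->. Qed.

Lemma mem_switch_old L r g c h x y t : t \in L ->
  t \notin [:: (r, c, x); (r, h, y); (g, c, y); (g, h, x)] -> t \in switch L r g c h x y.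
Proof. by rewrite in_set => -> ->; rewrite orbT. Qed.

(* An exchange keeps the set of pairs of every axis, so four triples free of
   pairs of P are exchanged for four such triples. *)
Lemma switch_good P r g c h x y :
  ~~ bad P (r, c, x) -> ~~ bad P (r, h, y) -> ~~ bad P (g, c, y) -> ~~ bad P (g, h, x) ->
  [/\ ~~ bad P (r, c, y), ~~ bad P (r, h, x), ~~ bad P (g, c, x) & ~~ bad P (g, h, y)].
Proof.
move=> /badPn b1 /badPn b2 /badPn b3 /badPn b4.
split; apply/badPn => q [] qP.
- exact: b3 q A0 qP.
- exact: b2 q A1 qP.
- exact: b1 q A2 qP.
- exact: b4 q A0 qP.
- exact: b1 q A1 qP.
- exact: b2 q A2 qP.
- exact: b1 q A0 qP.
- exact: b4 q A1 qP.
- exact: b3 q A2 qP.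
- exact: b2 q A0 qP.
- exact: b3 q A1 qP.
- exact: b4 q A2 qP.
Qed.

Section DoubleFlip.

Variables (P L : {set T * T * T}) (r c x r2 c2 y y0 y1 h g h' g' : T).
Hypotheses (latL : latin L) (tL : (r, c, x) \in L) (tbad : bad P (r, c, x)).
Hypotheses (p1 : fresh P L (r2, c2, x)).
Hypotheses (f1 : fresh P L (r, c2, y0)) (f2 : fresh P L (r, h, y))
  (f3 : fresh P L (g, c2, y)) (f4 : fresh P L (g, h, y0)).
Hypotheses (e1 : fresh P L (r2, c, y1)) (e2 : fresh P L (r2, h', y))
  (e3 : fresh P L (g', c, y)) (e4 : fresh P L (g', h', y1)).
Hypotheses (yy0 : y != y0) (yy1 : y != y1) (yx : y != x).

(** The first exchange brings y to cell (r, c2), the second brings y to (r2, c). Rows r, r2 and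
    columns c, c2 then carry an intercalate on x and y, and the third exchange replaces x by y in
    cell (r, c). *)
Definition double_switch := switch (switch (switch L r g c2 h y0 y) r2 g' c h' y1 y) r r2 c c2 x y.

Let plL : plat L := latL.1.

Let neL t1 t2 : fresh P L t1 -> t1 = t2 -> bad P t2 -> False.
Proof. by move=> /andP[_ /negP n] <- /n. Qed.

Let r2r : r2 != r.
Proof.
apply/eqP => e; apply: (neL p1 _ tbad).
by rewrite e; congr (_, _, _); apply: plat_row plL _ tL; move: p1 => /andP[]; rewrite e.
Qed.
Let c2c : c2 != c.
Proof.
apply/eqP => e; apply: (neL p1 _ tbad).
by rewrite e; congr (_, _, _); apply: plat_col plL _ tL; move: p1 => /andP[]; rewrite e.
Qed.
Let gr : g != r.
Proof.
apply: contraNneq yy0 => e; move: f3 f1 => /andP[m _] /andP[m' _]; rewrite e in m.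
by rewrite (plat_sym plL m m').
Qed.
Let gr2 : g != r2.
Proof.
apply: contraNneq yx => e; move: f3 p1 => /andP[m _] /andP[m' _]; rewrite e in m.
by rewrite (plat_sym plL m m').
Qed.
Let hc : h != c.
Proof.
apply: contraNneq yx => e; move: f2 tL => /andP[m _] m'; rewrite e in m.
by rewrite (plat_sym plL m m').
Qed.
Let hc2 : h != c2.
Proof.
apply: contraNneq yy0 => e; move: f2 f1 => /andP[m _] /andP[m' _]; rewrite e in m.
by rewrite (plat_sym plL m m').
Qed.
Let g'r : g' != r.
Proof.
apply: contraNneq yx => e; move: e3 tL => /andP[m _] m'; rewrite e in m.
by rewrite (plat_sym plL m m').
Qed.
Let g'r2 : g' != r2.
Proof.
apply: contraNneq yy1 => e; move: e3 e1 => /andP[m _] /andP[m' _]; rewrite e in m.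
by rewrite (plat_sym plL m m').
Qed.
Let h'c : h' != c.
Proof.
apply: contraNneq yy1 => e; move: e2 e1 => /andP[m _] /andP[m' _]; rewrite e in m.
by rewrite (plat_sym plL m m').
Qed.
Let h'c2 : h' != c2.
Proof.
apply: contraNneq yx => e; move: e2 p1 => /andP[m _] /andP[m' _]; rewrite e in m.
by rewrite (plat_sym plL m m').
Qed.
Let hh' : h != h'.
Proof.
apply: contraNneq r2r => e; move: e2 f2 => /andP[m _] /andP[m' _]; rewrite e in m'.
by rewrite (plat_col plL m m').
Qed.

Let ne := (negbTE r2r, negbTE c2c, negbTE gr, negbTE gr2, negbTE hc, negbTE hc2,
  negbTE g'r, negbTE g'r2, negbTE h'c, negbTE h'c2, negbTE hh', negbTE yy0, negbTE yy1, negbTE yx).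
Let ne' := (eq_sym r r2, eq_sym c c2, eq_sym r g, eq_sym r2 g, eq_sym c h, eq_sym c2 h,
  eq_sym r g', eq_sym r2 g', eq_sym c h', eq_sym c2 h', eq_sym h' h, eq_sym y0 y, eq_sym y1 y,
  eq_sym x y).

Local Ltac dis := rewrite !inE !xpair_eqE ?ne' ?ne ?andbF ?andFb ?orbF.

Let L1 := switch L r g c2 h y0 y.
Let L2 := switch L1 r2 g' c h' y1 y.

Let lat1 : latin L1.
Proof.
apply: latin_switch => //; rewrite ?(eq_sym y0) //; by [case/andP: f1|case/andP: f2|case/andP: f3|case/andP: f4].
Qed.

Let m1 : (r2, c, y1) \in L1.
Proof. by apply: mem_switch_old; [case/andP: e1 | dis]. Qed.
Let m2 : (r2, h', y) \in L1.
Proof. by apply: mem_switch_old; [case/andP: e2 | dis]. Qed.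
Let m3 : (g', c, y) \in L1.
Proof. by apply: mem_switch_old; [case/andP: e3 | dis]. Qed.
Let m4 : (g', h', y1) \in L1.
Proof. by apply: mem_switch_old; [case/andP: e4 | dis]. Qed.

Let lat2 : latin L2.
Proof. by apply: latin_switch => //; rewrite eq_sym. Qed.

Let k1 : (r, c, x) \in L2.
Proof. by apply: mem_switch_old; [apply: mem_switch_old => //; dis | dis]. Qed.
Let k2 : (r, c2, y) \in L2.
Proof. by apply: mem_switch_old; [apply: mem_switch_new; rewrite !inE eqxx | dis]. Qed.
Let k3 : (r2, c, y) \in L2.
Proof. by apply: mem_switch_new; rewrite !inE eqxx. Qed.
Let k4 : (r2, c2, x) \in L2.
Proof. by apply: mem_switch_old; [apply: mem_switch_old; [case/andP: p1|dis] | dis]. Qed.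

Lemma latin_dflip : latin double_switch.
Proof. by apply: latin_switch => //; rewrite eq_sym. Qed.

(** Ten and not twelve triples: (r, c2, y) and (r2, c, y) are produced by the first two exchanges
    and consumed by the third, and they are not in L because their cells hold y0 and y1 there. *)
Lemma dflip_old t : t \in L -> t \notin double_switch ->
  t \in [:: (r, c, x); (r2, c2, x); (r, c2, y0); (r, h, y); (g, c2, y); (g, h, y0);
            (r2, c, y1); (r2, h', y); (g', c, y); (g', h', y1)].
Proof.
move=> tl tn.
case: (boolP (t \in L1)) => i1; last first.
  by move: (switch_old tl i1); rewrite !inE => /or4P[] ->; rewrite ?orbT.
case: (boolP (t \in L2)) => i2; last first.
  by move: (switch_old i1 i2); rewrite !inE => /or4P[] ->; rewrite ?orbT.
move: (switch_old i2 tn); rewrite !inE => /or4P[] e; rewrite ?e ?orbT //.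
  have /andP[m _] := f1; rewrite (eqP e) in tl.
  by move/eqP: (plat_sym plL m tl); rewrite ne' ne.
have /andP[m _] := e1; rewrite (eqP e) in tl.
by move/eqP: (plat_sym plL m tl); rewrite ne' ne.
Qed.

Lemma dflip_new t : t \in double_switch -> t \notin L ->
  t \in [:: (r, c, y); (r, c2, x); (r2, c, x); (r2, c2, y); (r, h, y0); (g, c2, y0); (g, h, y);
            (r2, h', y1); (g', c, y1); (g', h', y)].
Proof.
rewrite {1}/double_switch {1}/switch in_set => /orP[|/andP[i2 no]].
  by rewrite !inE => /or4P[] ->; rewrite ?orbT.
move=> tl; case: (boolP (t \in L1)) => i1; last first.
  move: (switch_new i2 i1); rewrite !inE => /or4P[] e; rewrite ?e ?orbT //.
  by move: no; rewrite (eqP e) !inE eqxx !orbT.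
move: (switch_new i1 tl); rewrite !inE => /or4P[] e; rewrite ?e ?orbT //.
by move: no; rewrite (eqP e) !inE eqxx ?orbT.
Qed.

Lemma mem_dflip : [/\ (r, c, y) \in double_switch, (r, c2, x) \in double_switch,
  (r2, c, x) \in double_switch & (r2, c2, y) \in double_switch].
Proof. by split; apply: mem_switch_new; rewrite !inE eqxx ?orbT. Qed.

Lemma dflip_old_bad t : t \in L -> t \notin double_switch -> bad P t -> t = (r, c, x).
Proof.
move=> tl tn b; move: (dflip_old tl tn); rewrite !inE => /orP[/eqP //|].
have n t' : fresh P L t' -> (t == t') = false.
  by move=> /andP[_ /negP fr]; apply/eqP => e; apply: fr; rewrite -e.
by rewrite !n.
Qed.

(** Each pair of a new triple was the pair of an exchanged triple, and all of these except (r, c, x)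
    are fresh. Hence only the three pairs of (r, c, x) can matter to P, and each of them has moved
    to a new triple of its own. *)
Lemma dflip_new_pair t q a : t \in double_switch -> t \notin L -> q \in P -> op a q = op a t ->
  match a with A0 => t = (r2, c, x) | A1 => t = (r, c2, x) | A2 => t = (r, c, y) end.
Proof.
move=> td tn qP; move: (dflip_new td tn).
have [_ b2 b3 b4] : [/\ ~~ bad P (r, c2, y), ~~ bad P (r, h, y0), ~~ bad P (g, c2, y0)
   & ~~ bad P (g, h, y)].
  by apply: switch_good; [case/andP: f1|case/andP: f2|case/andP: f3|case/andP: f4].
have [_ b6 b7 b8] : [/\ ~~ bad P (r2, c, y), ~~ bad P (r2, h', y1), ~~ bad P (g', c, y1)
   & ~~ bad P (g', h', y)].
  by apply: switch_good; [case/andP: e1|case/andP: e2|case/andP: e3|case/andP: e4].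
have nb t' : ~~ bad P t' -> op a q = op a t' -> False.
  by move=> /badPn n /n; exact.
have nf t' : fresh P L t' -> op a q = op a t' -> False.
  by move=> /andP[_ /badPn n] /n; exact.
rewrite !inE => /orP[/eqP->|/orP[/eqP->|/orP[/eqP->|/orP[/eqP->|H]]]]; last first.
- move=> e; exfalso; move: H; do ?[case/orP]; move/eqP=> e'; rewrite e' in e;
  by [apply: nb b2 e|apply: nb b3 e|apply: nb b4 e|apply: nb b6 e|apply: nb b7 e|apply: nb b8 e].
- case: a nf {nb} => nf // e; exfalso.
  + by apply: (nf (g, c2, y)).
  + by apply: (nf (r2, h', y)).
  + by apply: (nf (r2, c2, x)).
- case: a nf {nb} => nf // e; exfalso.
  + by apply: (nf (r2, c2, x)).
  + by apply: (nf (r2, c, y1)).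
- case: a nf {nb} => nf // e; exfalso.
  + by apply: (nf (r2, c2, x)).
  + by apply: (nf (r, c2, y0)).
- case: a nf {nb} => nf // e; exfalso.
  + by apply: (nf (g', c, y)).
  + by apply: (nf (r, h, y)).
Qed.

Lemma dflip_card : #|L :\: double_switch| <= 10.
Proof.
set l := [:: (r, c, x); (r2, c2, x); (r, c2, y0); (r, h, y); (g, c2, y); (g, h, y0);
            (r2, c, y1); (r2, h', y); (g', c, y); (g', h', y1)].
apply: (@leq_trans #|l|); last exact: card_size.
by apply: subset_leq_card; apply/subsetP => t /setDP[tl tn]; exact: dflip_old.
Qed.

(** The lines of r, c and x may already be exhausted, so the damage there has to be small; three is
    the weight that [load] gives to a pending triple. *)
Lemma dflip_line a : x != y0 -> x != y1 ->
  #|[set t in L :\: double_switch | co a t == co a (r, c, x)]| <= 3.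
Proof.
move=> xy0 xy1.
have sub (l : seq (T * T * T)) : size l <= 3 ->
   (forall t, t \in L -> t \notin double_switch -> co a t = co a (r, c, x) -> t \in l) ->
   #|[set t in L :\: double_switch | co a t == co a (r, c, x)]| <= 3.
  move=> sl H; apply: leq_trans sl; apply: leq_trans (card_size l).
  apply: subset_leq_card; apply/subsetP => t; rewrite inE => /andP[/setDP[tl tn] /eqP e].
  exact: H.
case: a sub => sub.
- apply: (sub [:: (r, c, x); (r, c2, y0); (r, h, y)]) => // t tl tn.
  move: (dflip_old tl tn); rewrite !inE /=.
  by do 9?[case/orP] => /eqP -> /= /eqP; rewrite ?ne ?eqxx ?orbT.
- apply: (sub [:: (r, c, x); (r2, c, y1); (g', c, y)]) => // t tl tn.
  move: (dflip_old tl tn); rewrite !inE /=.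
  by do 9?[case/orP] => /eqP -> /= /eqP; rewrite ?ne ?eqxx ?orbT.
- apply: (sub [:: (r, c, x); (r2, c2, x)]) => // t tl tn.
  move: (dflip_old tl tn); rewrite !inE /=.
  by do 9?[case/orP] => /eqP -> /= /eqP; rewrite ?ne ?(eq_sym y0) ?(eq_sym y1) ?(negbTE xy0) ?(negbTE xy1) ?eqxx ?orbT.
Qed.

End DoubleFlip.

End Exchange.

(** Union bound behind all choices: each member of [bs] collects the candidates spoilt by one
    requirement. *)
Lemma pick_avoiding (I : finType) (O : {set I}) (bs : seq {set I}) :
  sumn [seq #|(B : {set I})| | B <- bs] < #|O| ->
  exists2 x, x \in O & all (fun B : {set I} => x \notin B) bs.
Proof.
elim: bs O => [|B bs IH] O /=; first by rewrite card_gt0 => /set0Pn[x xO]; exists x.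
move=> lt; have [|x /setDP[xO xB] al] := IH (O :\: B); last by exists x => //=; rewrite xB.
have := cardsID B O; have := subset_leq_card (subsetIr O B); lia.
Qed.

(** * Reference frames and exchanges *)

Section Frames.

Variable T : finType.
Implicit Types (t q : T * T * T) (L P : {set T * T * T}).

(* The operations [eS], [eC], [eR] give the symbol, column and row completing a
   triple of the table on the labels of [core]; the set [ref] of reference triples
   also contains triples with exactly one label outside [core]. *)
Record frame := Frame {
  core : {set T};
  par : T -> bool;
  eS : T -> T -> T;
  eC : T -> T -> T;
  eR : T -> T -> T;
  ref : {set T * T * T} }.

Implicit Type F : frame.

(* [wfq] says that columns of opposite parity lie in a common intercalate with
   every row. *)
Record wf F (k kq : nat) : Prop := Wf {
  wfS : forall r c, r \in core F -> c \in core F -> eS F r c \in core F;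
  wfC : forall r s, r \in core F -> s \in core F -> eC F r s \in core F;
  wfR : forall c s, c \in core F -> s \in core F -> eR F c s \in core F;
  wfSC : forall r c s, r \in core F -> c \in core F -> s \in core F ->
    (eC F r s == c) = (eS F r c == s);
  wfSR : forall r c s, r \in core F -> c \in core F -> s \in core F ->
    (eR F c s == r) = (eS F r c == s);
  wfp : forall r c, r \in core F -> c \in core F ->
    par F (eS F r c) = par F r (+) par F c;
  wfq : forall r c h, r \in core F -> c \in core F -> h \in core F ->
    par F c != par F h -> eS F (eR F c (eS F r h)) h = eS F r c;
  wfk : forall b, #|[set v in core F | par F v == b]| = k;
  wfE : forall r c s, r \in core F -> c \in core F -> s \in core F ->
    ((r, c, s) \in ref F) = (eS F r c == s);
  wf1 : forall t a, t \in ref F -> co a t \notin core F ->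
    (co (nxt a) t \in core F) && (co (nxt (nxt a)) t \in core F);
  wfi : forall a t t', t \in ref F -> t' \in ref F -> co a t = co a t' ->
    co (nxt a) t \in core F -> co (nxt (nxt a)) t \in core F ->
    co (nxt a) t' \in core F -> co (nxt (nxt a)) t' \in core F ->
    co (nxt a) t = co (nxt a) t' \/ co (nxt (nxt a)) t = co (nxt (nxt a)) t' ->
    t = t';
  wfn : forall a x b1 b2, (x \in core F -> b1 (+) b2 = par F x) ->
    kq <= #|[set t in ref F | [&& co a t == x, co (nxt a) t \in core F,
              co (nxt (nxt a)) t \in core F, par F (co (nxt a) t) == b1 &
              par F (co (nxt (nxt a)) t) == b2]]|}.

(** Cyclic rotation of the axes, by which a construction made for symbols also serves rows and
    columns. *)
Definition turn t : T * T * T := (t.1.2, t.2, t.1.1).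
Definition unturn t : T * T * T := (t.2, t.1.1, t.1.2).
Definition turnS L := [set t | unturn t \in L].

Definition turnF F :=
  Frame (core F) (par F) (eR F) (fun c r => eS F r c) (fun s r => eC F r s) (turnS (ref F)).

Lemma unturnK : cancel unturn turn. Proof. by case=> [[]]. Qed.
Lemma turnK : cancel turn unturn. Proof. by case=> [[]]. Qed.
Lemma co_turn a t : co a (turn t) = co (nxt a) t. Proof. by case: a. Qed.
Lemma op_turn a t : op a (turn t) = op (nxt a) t. Proof. by rewrite /op !co_turn. Qed.
Lemma mem_turnS L t : (turn t \in turnS L) = (t \in L). Proof. by rewrite inE turnK. Qed.
Lemma nxt3 a : nxt (nxt (nxt a)) = a. Proof. by case: a. Qed.

Lemma turnS3 L : turnS (turnS (turnS L)) = L.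
Proof. by apply/setP => t; rewrite !inE; case: t => [[]]. Qed.

(** Only [wfq] has content. The intercalate with rows r, g, columns c, d and symbols s, h is the
    same set of triples after rotation, and additivity of parities makes s and h opposite exactly
    when c and d are. *)
Lemma wf_turn F k kq : wf F k kq -> wf (turnF F) k kq.
Proof.
case=> wS wC wR wSC wSR wp wq wk wE w1 wi wn.
have rp r c s : r \in core F -> c \in core F -> s \in core F -> eS F r c == s ->
    par F s = par F r (+) par F c.
  by move=> ri ci si /eqP <-; apply: wp.
split=> //=.
- by move=> *; exact: wS.
- by move=> *; exact: wC.
- by move=> r c s *; rewrite wSR.
- by move=> r c s *; rewrite wSC // wSR.
- move=> c s ci si; rewrite (rp (eR F c s) c s) ?wR // -?wSR ?wR //.
  by case: (par F (eR F c s)); case: (par F c).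
- move=> c s h ci si hi ne.
  set r := eR F c s; set g := eR F c h.
  have ri : r \in core F by apply: wR.
  have gi : g \in core F by apply: wR.
  have gs : eS F g c = h by apply/eqP; rewrite -wSR.
  set d := eC F g s.
  have di : d \in core F by apply: wC.
  have gd : eS F g d = s by apply/eqP; rewrite -wSC.
  have pcd : par F d != par F c.
    apply: contraNneq ne => e; move: (wp g d gi di) (wp g c gi ci).
    by rewrite gs gd e => -> ->.
  have := wq g d c gi di ci pcd; rewrite gs gd => q.
  apply/eqP; rewrite wSR //.
  have e0 : eS F (eR F d h) d = h by apply/eqP; rewrite -wSR // wR.
  have e1 : r = eR F d h.
    apply/eqP; rewrite wSR ?wR //; by rewrite q.
  by rewrite e1 e0.
- move=> c s r ci si ri; rewrite inE /unturn /= wE // -wSR //.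
- move=> t a; rewrite inE; set t' := unturn t => tr; rewrite -(unturnK t) -/t' !co_turn.
  by move=> n; exact: w1 tr n.
- move=> a t t'; rewrite !inE; move: (unturnK t) (unturnK t').
  move: (unturn t) (unturn t') => u u' <- <-.
  rewrite !co_turn => tr tr' e c1 c2 c3 c4 c5.
  by congr turn; apply: wi tr tr' e c1 c2 c3 c4 c5.
- move=> a x b1 b2 H; apply: leq_trans (wn (nxt a) x b1 b2 H) _.
  rewrite -(card_imset _ (can_inj turnK)); apply: subset_leq_card.
  apply/subsetP => _ /imsetP[t + ->]; rewrite !inE turnK !co_turn.
  by case/andP=> -> /and5P[-> -> -> -> ->].
Qed.

End Frames.

Lemma sel (I : finType) (O : {set I}) (p : pred I) x : x \in O ->
  (x \notin [set o in O | p o]) = ~~ p x.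
Proof. by move=> xO; rewrite inE xO. Qed.

Lemma ar1 V v u : V + (V + (V + (v + (v + (v + (v + u)))))) <= 3 * V + 4 * v + u.
Proof. lia. Qed.
Lemma ar2 V v : V + V + V + V + V + V + v + v + v + v + v <= 6 * V + v + v + v + v + v + 0.
Proof. lia. Qed.

Section Gadget.

Variable T : finType.
Implicit Types (t q : T * T * T) (L P : {set T * T * T}) (F : frame T) (A : axis -> {set T}).

(* Exchanges may only use the reference triples that are still present and
   share no pair with P. *)
Definition clean_bound F P L W :=
  forall a v, #|[set t in ref F | (co a t == v) && ~~ fresh P L t]| <= W.

Definition allowed F A w := forall a, A a \subset core F /\ #|core F :\: A a| <= w.

(** The triples [f o] run through distinct reference triples of one line, so one demand of freshness
    costs at most W candidates. Together with [line_count] this prices every demand made by the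
    gadgets. *)
Lemma curve_count F P L W (I : finType) (O : {set I}) (f : I -> T * T * T) a v :
  clean_bound F P L W -> {in O &, injective f} ->
  (forall o, o \in O -> f o \in ref F) -> (forall o, o \in O -> co a (f o) = v) ->
  #|[set o in O | ~~ fresh P L (f o)]| <= W.
Proof.
move=> cb fi fr fv; apply: leq_trans (cb a v).
rewrite -(card_in_imset (f := f)) => [|o o']; last first.
  by rewrite !inE => /andP[oO _] /andP[oO' _]; exact: fi.
apply: subset_leq_card; apply/subsetP => _ /imsetP[o + ->].
by rewrite !inE => /andP[oO ->]; rewrite fr // fv // eqxx.
Qed.

Lemma line_count F A w (I : finType) (O : {set I}) (f : I -> T) a :
  allowed F A w -> {in O &, injective f} -> (forall o, o \in O -> f o \in core F) ->
  #|[set o in O | f o \notin A a]| <= w.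
Proof.
move=> al fi fr; apply: leq_trans (al a).2.
rewrite -(card_in_imset (f := f)) => [|o o']; last first.
  by rewrite !inE => /andP[oO _] /andP[oO' _]; exact: fi.
apply: subset_leq_card; apply/subsetP => _ /imsetP[o + ->].
by rewrite !inE => /andP[oO ->]; rewrite fr.
Qed.

Lemma avoid_count (I : finType) (O : {set I}) (f : I -> T) (B : {set T}) :
  {in O &, injective f} -> #|[set o in O | f o \in B]| <= #|B|.
Proof.
move=> fi; rewrite -(card_in_imset (f := f)) => [|o o']; last first.
  by rewrite !inE => /andP[oO _] /andP[oO' _]; exact: fi.
by apply: subset_leq_card; apply/subsetP => _ /imsetP[o + ->]; rewrite inE => /andP[].
Qed.

(* The pairs of t that may be needed by P are now covered by three different
   triples, whose third labels [r2], [c2], [y] can be chosen. *)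
Record corner_exchange P A L L' (t : T * T * T) (r2 c2 y : T) : Prop := CornerExchange {
  xm_latin : latin L';
  xm_card : #|L :\: L'| <= 10;
  xm_line : forall t', (t' \in L) != (t' \in L') ->
    forall a, co a t' \in A a \/ co a t' = co a t;
  xm_old : forall t', t' \in L -> t' \notin L' -> bad P t' -> t' = t;
  xm_new : forall t' q a, t' \in L' -> t' \notin L -> q \in P -> op a q = op a t' ->
    match a with A0 => t' = (r2, t.1.2, t.2) | A1 => t' = (t.1.1, c2, t.2)
               | A2 => t' = (t.1.1, t.1.2, y) end;
  xm_cnt : forall a, #|[set t' in L :\: L' | co a t' == co a t]| <= 3;
  xm_mem2 : (t.1.1, t.1.2, y) \in L';
  xm_mem1 : (t.1.1, c2, t.2) \in L';
  xm_mem0 : (r2, t.1.2, t.2) \in L' }.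

Section Fixed.

Variables (F : frame T) (k kq : nat) (P : {set T * T * T}).
Hypothesis wfF : wf F k kq.

Lemma inj_eC r : r \in core F -> {in core F &, injective (eC F r)}.
Proof.
move=> ri s s' si si' e.
have ci := wfC wfF ri si.
have /eqP <- : eS F r (eC F r s) == s by rewrite -(wfSC wfF).
by apply/eqP; rewrite -(wfSC wfF) // e.
Qed.

Lemma inj_eR c : c \in core F -> {in core F &, injective (eR F c)}.
Proof.
move=> ci s s' si si' e.
have ri := wfR wfF ci si.
have /eqP <- : eS F (eR F c s) c == s by rewrite -(wfSR wfF).
by apply/eqP; rewrite -(wfSR wfF) // e.
Qed.

Lemma inj_eS r : r \in core F -> {in core F &, injective (eS F r)}.
Proof.
move=> ri c c' ci ci' e.
have si := wfS wfF ri ci.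
have /eqP <- : eC F r (eS F r c) == c by rewrite (wfSC wfF).
by apply/eqP; rewrite (wfSC wfF) // e.
Qed.

Lemma inj_eS' c : c \in core F -> {in core F &, injective (fun r => eS F r c)}.
Proof.
move=> ci r r' ri ri' e.
have si := wfS wfF ri ci.
have /eqP <- : eR F c (eS F r c) == r by rewrite (wfSR wfF).
by apply/eqP; rewrite (wfSR wfF) // e.
Qed.

Lemma eSC r s : r \in core F -> s \in core F -> eS F r (eC F r s) = s.
Proof. by move=> ri si; apply/eqP; rewrite -(wfSC wfF) // (wfC wfF). Qed.

Lemma eSR c s : c \in core F -> s \in core F -> eS F (eR F c s) c = s.
Proof. by move=> ri si; apply/eqP; rewrite -(wfSR wfF) // (wfR wfF). Qed.

Lemma par_eC r s : r \in core F -> s \in core F -> par F (eC F r s) = par F r (+) par F s.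
Proof.
move=> ri si; rewrite -{2}(eSC ri si) (wfp wfF) // ?(wfC wfF) //.
by rewrite addbA addbb.
Qed.

Lemma par_eR c s : c \in core F -> s \in core F -> par F (eR F c s) = par F c (+) par F s.
Proof.
move=> ri si; rewrite -{2}(eSR ri si) (wfp wfF) // ?(wfR wfF) //.
by rewrite addbC -addbA addbb addbF.
Qed.

Lemma mem_eS r c : r \in core F -> c \in core F -> (r, c, eS F r c) \in ref F.
Proof. by move=> ri ci; rewrite (wfE wfF) ?(wfS wfF). Qed.

Lemma mem_eC r s : r \in core F -> s \in core F -> (r, eC F r s, s) \in ref F.
Proof. by move=> ri si; rewrite -{2}(eSC ri si) mem_eS ?(wfC wfF). Qed.

Lemma mem_eR c s : c \in core F -> s \in core F -> (eR F c s, c, s) \in ref F.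
Proof. by move=> ri si; rewrite -{2}(eSR ri si) mem_eS ?(wfR wfF). Qed.

(** The intercalate through cell (r, c) with second symbol y: its other column is where y stands in
    row r, its other row is where y stands in column c. By parity that column is opposite to c, so
    [wfq] applies. *)
Lemma corner r c y : r \in core F -> c \in core F -> y \in core F ->
  par F y != par F r (+) par F c -> eS F (eR F c y) (eC F r y) = eS F r c.
Proof.
move=> ri ci yi ne; rewrite -{1}(eSC ri yi) (wfq wfF) ?(wfC wfF) //.
by rewrite par_eC //; apply: contraNneq ne => ->; rewrite addbA addbb.
Qed.

Lemma card_par b : #|[set y in core F | par F y != b]| = k.
Proof.
rewrite -(wfk wfF (~~ b)); apply: eq_card => y; rewrite !inE; congr (_ && _).
by case: (par F y); case: b.
Qed.

(** Replaces x in cell (r, c) by [double_switch]. First a reference triple (r2, c2, x) is chosen,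
    then y among the k symbols whose parity closes an intercalate at the corner (r, c2); the corner
    (r2, c) requires the same parity because [b1 (+) b2 = par F r (+) par F c]. The two parities
    stay parameters since a label x outside the core does not restrict them; [Cx] lets the caller
    exclude columns. *)
Lemma exchange_gadget L A W w r c x b1 b2 (Cx : {set T}) :
  latin L -> clean_bound F P L W -> allowed F A w ->
  r \in core F -> c \in core F -> (r, c, x) \in L -> bad P (r, c, x) ->
  b1 (+) b2 = par F r (+) par F c -> (x \in core F -> b1 (+) b2 = par F x) ->
  3 * W + 4 * w + #|Cx| < kq ->
  exists r2 c2, [/\ r2 \in A A0, c2 \in A A1, c2 \notin Cx, par F r2 = b1 & par F c2 = b2] /\
  exists Y : {set T}, [/\ Y \subset [set y in A A2 | (par F y != par F r (+) par F c2) && (y != x)],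
    k <= #|Y| + 6 * W + 5 * w + 1 &
    forall y, y \in Y -> exists L', corner_exchange P A L L' (r, c, x) r2 c2 y].
Proof.
move=> latL cb al ri ci tL tb bb bx lt.
pose R := [set t in ref F | [&& co A2 t == x, co (nxt A2) t \in core F,
              co (nxt (nxt A2)) t \in core F, par F (co (nxt A2) t) == b1 &
              par F (co (nxt (nxt A2)) t) == b2]].
have leR : kq <= #|R| := wfn wfF A2 bx.
have RP t : t \in R -> [/\ t \in ref F, t.2 = x, t.1.1 \in core F, t.1.2 \in core F &
    par F t.1.1 = b1 /\ par F t.1.2 = b2].
  by rewrite inE => /andP[? /and5P[/eqP ? ? ? /eqP ? /eqP ?]].
have Ri1 : {in R &, injective (fun t => t.1.1)}.
  move=> t t' tR tR' e; have [t1 t2 t3 t4 _] := RP _ tR; have [t1' t2' t3' t4' _] := RP _ tR'.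
  by apply: (wfi wfF (a := A2)) => //=; [rewrite t2 t2' | left].
have Ri2 : {in R &, injective (fun t => t.1.2)}.
  move=> t t' tR tR' e; have [t1 t2 t3 t4 _] := RP _ tR; have [t1' t2' t3' t4' _] := RP _ tR'.
  by apply: (wfi wfF (a := A2)) => //=; [rewrite t2 t2' | right].
(* Three demands of freshness, four allowed lines and the excluded columns:
   [3 * W + 4 * w + #|Cx|]. *)
have [|t tR] := @pick_avoiding _ R [::
   [set t in R | ~~ fresh P L t];
   [set t in R | ~~ fresh P L (r, t.1.2, eS F r t.1.2)];
   [set t in R | ~~ fresh P L (t.1.1, c, eS F t.1.1 c)];
   [set t in R | t.1.1 \notin A A0];
   [set t in R | t.1.2 \notin A A1];
   [set t in R | eS F r t.1.2 \notin A A2];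
   [set t in R | eS F t.1.1 c \notin A A2];
   [set t in R | t.1.2 \in Cx]].
  rewrite /=.
  have h1 : #|[set t in R | ~~ fresh P L t]| <= W.
    by apply: (curve_count (a := A2) (v := x) (f := id) cb) => // t /RP[].
  have h2 : #|[set t in R | ~~ fresh P L (r, t.1.2, eS F r t.1.2)]| <= W.
    apply: (curve_count (a := A0) (v := r) cb) => //.
      by move=> t t' tR tR' [] e _; exact: Ri2 e.
    by move=> t /RP[_ _ _ ? _]; exact: mem_eS.
  have h3 : #|[set t in R | ~~ fresh P L (t.1.1, c, eS F t.1.1 c)]| <= W.
    apply: (curve_count (a := A1) (v := c) cb) => //.
      by move=> t t' tR tR' [] e _; exact: Ri1 e.
    by move=> t /RP[_ _ ? _ _]; exact: mem_eS.
  have l1 : #|[set t in R | t.1.1 \notin A A0]| <= w.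
    by apply: (line_count _ al) => // t /RP[].
  have l2 : #|[set t in R | t.1.2 \notin A A1]| <= w.
    by apply: (line_count _ al) => // t /RP[].
  have l3 : #|[set t in R | eS F r t.1.2 \notin A A2]| <= w.
    apply: (line_count _ al) => // [t t' tR tR' e|t /RP[_ _ _ ? _]]; last by apply: (wfS wfF).
    have [_ _ _ i1 _] := RP _ tR; have [_ _ _ i2 _] := RP _ tR'.
    by apply: Ri2 => //; apply: inj_eS e.
  have l4 : #|[set t in R | eS F t.1.1 c \notin A A2]| <= w.
    apply: (line_count _ al) => // [t t' tR tR' e|t /RP[_ _ ? _ _]]; last by apply: (wfS wfF).
    have [_ _ i1 _ _] := RP _ tR; have [_ _ i2 _ _] := RP _ tR'.
    by apply: Ri1 => //; apply: inj_eS' e.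
  have l5 : #|[set t in R | t.1.2 \in Cx]| <= #|Cx| by apply: avoid_count.
  have := leq_add h1 (leq_add h2 (leq_add h3 (leq_add l1 (leq_add l2 (leq_add l3 (leq_add l4 l5)))))).
  rewrite addn0 => H0; apply: leq_trans leR; apply: leq_ltn_trans H0 _; apply: leq_ltn_trans lt; exact: ar1.
case: t tR => [[r2 c2] x'] tR; have [/= _ ex r2i c2i [pr2 pc2]] := RP _ tR; subst x'.
rewrite /= !(sel _ tR) !negbK.
move=> /andP[p1] /andP[f1] /andP[e1] /andP[Ar2] /andP[Ac2] /andP[Ay0] /andP[Ay1] /andP[nCx _].
exists r2, c2; split=> //.
set y0 := eS F r c2 in f1 Ay0; set y1 := eS F r2 c in e1 Ay1.
pose O := [set y in core F | par F y != par F r (+) par F c2].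
have OP y : y \in O -> y \in core F /\ par F y != par F r (+) par F c2.
  by rewrite inE => /andP.
have cO : #|O| = k by exact: card_par.
(* Six demands of freshness, five allowed lines and the symbol x itself: [6 * W + 5 * w + 1]. The
   line of [y1] and that of [y0] were secured by the choice of (r2, c2, x). *)
pose bs := [::
   [set y in O | ~~ fresh P L (r, eC F r y, y)];
   [set y in O | ~~ fresh P L (eR F c2 y, c2, y)];
   [set y in O | ~~ fresh P L (eR F c2 y, eC F r y, y0)];
   [set y in O | ~~ fresh P L (r2, eC F r2 y, y)];
   [set y in O | ~~ fresh P L (eR F c y, c, y)];
   [set y in O | ~~ fresh P L (eR F c y, eC F r2 y, y1)];
   [set y in O | y \notin A A2];
   [set y in O | eC F r y \notin A A1];
   [set y in O | eR F c2 y \notin A A0];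
   [set y in O | eC F r2 y \notin A A1];
   [set y in O | eR F c y \notin A A0];
   [set x]].
have cor2 y : y \in O -> eS F (eR F c y) (eC F r2 y) = y1.
  move=> /OP[yi yp]; apply: corner => //; apply: contraNneq yp => ->; apply/eqP.
  by move: bb; rewrite pr2 pc2; case: b1 {bx pr2 R leR RP Ri1 Ri2 tR}; case: b2 {pc2}; case: (par F r); case: (par F c).
have cor y : y \in O -> eS F (eR F c2 y) (eC F r y) = y0.
  by move=> /OP[yi yp]; exact: corner.
exists [set y in O | all (fun B : {set T} => y \notin B) bs]; split.
- apply/subsetP => y; rewrite inE => /andP[yO]; rewrite inE (OP y yO).2 andTb.
  by rewrite /= !(sel _ yO) !negbK in_set1; do 6!case/andP=> _; case/and5P=> -> _ _ _ /andP[_ /andP[->]].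
- pose B := \bigcup_(B <- bs) B.
  have sB : #|B| <= 6 * W + 5 * w + 1.
    have : #|B| <= sumn [seq #|(X : {set T})| | X <- bs].
      rewrite /B; elim: (bs) => [|X s IH]; first by rewrite big_nil cards0.
      by rewrite big_cons /=; apply: leq_trans (leq_card_setU _ _) _; rewrite leq_add2l.
    move/leq_trans; apply; rewrite /= cards1.
    have h1 : #|[set y in O | ~~ fresh P L (r, eC F r y, y)]| <= W.
      apply: (curve_count (a := A0) (v := r) cb) => // [y y' _ _ []|y /OP[yi _]] //.
      exact: mem_eC.
    have h2 : #|[set y in O | ~~ fresh P L (eR F c2 y, c2, y)]| <= W.
      apply: (curve_count (a := A1) (v := c2) cb) => // [y y' _ _ []|y /OP[yi _]] //.
      exact: mem_eR.
    have h3 : #|[set y in O | ~~ fresh P L (eR F c2 y, eC F r y, y0)]| <= W.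
      apply: (curve_count (a := A2) (v := y0) cb) => // [y y' /OP[yi _] /OP[yi' _] [_]|y yO].
        exact: inj_eC.
      by have [yi _] := OP y yO; rewrite -(cor y yO) mem_eS ?(wfR wfF) ?(wfC wfF).
    have h4 : #|[set y in O | ~~ fresh P L (r2, eC F r2 y, y)]| <= W.
      apply: (curve_count (a := A0) (v := r2) cb) => // [y y' _ _ []|y /OP[yi _]] //.
      exact: mem_eC.
    have h5 : #|[set y in O | ~~ fresh P L (eR F c y, c, y)]| <= W.
      apply: (curve_count (a := A1) (v := c) cb) => // [y y' _ _ []|y /OP[yi _]] //.
      exact: mem_eR.
    have h6 : #|[set y in O | ~~ fresh P L (eR F c y, eC F r2 y, y1)]| <= W.
      apply: (curve_count (a := A2) (v := y1) cb) => // [y y' /OP[yi _] /OP[yi' _] [_]|y yO].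
        exact: inj_eC.
      by have [yi _] := OP y yO; rewrite -(cor2 y yO) mem_eS ?(wfR wfF) ?(wfC wfF).
    have l1 : #|[set y in O | y \notin A A2]| <= w.
      by apply: (line_count (f := id) _ al) => // y /OP[].
    have l2 : #|[set y in O | eC F r y \notin A A1]| <= w.
      apply: (line_count _ al) => // [y y' /OP[yi _] /OP[yi' _]|y /OP[yi _]].
        exact: inj_eC.
      by apply: (wfC wfF).
    have l3 : #|[set y in O | eR F c2 y \notin A A0]| <= w.
      apply: (line_count _ al) => // [y y' /OP[yi _] /OP[yi' _]|y /OP[yi _]].
        exact: inj_eR.
      by apply: (wfR wfF).
    have l4 : #|[set y in O | eC F r2 y \notin A A1]| <= w.
      apply: (line_count _ al) => // [y y' /OP[yi _] /OP[yi' _]|y /OP[yi _]].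
        exact: inj_eC.
      by apply: (wfC wfF).
    have l5 : #|[set y in O | eR F c y \notin A A0]| <= w.
      apply: (line_count _ al) => // [y y' /OP[yi _] /OP[yi' _]|y /OP[yi _]].
        exact: inj_eR.
      by apply: (wfR wfF).
    have := leq_add h1 (leq_add h2 (leq_add h3 (leq_add h4 (leq_add h5 (leq_add h6 (leq_add l1 (leq_add l2 (leq_add l3 (leq_add l4 l5))))))))).
    rewrite !addnA addn0 => H; rewrite leq_add2r; apply: leq_trans H _; exact: ar2.
  have sub : O \subset [set y in O | all (fun B : {set T} => y \notin B) bs] :|: B.
    apply/subsetP => y yO; rewrite inE; case: (boolP (y \in B)); first by rewrite orbT.
    rewrite /B orbF => nB; rewrite inE yO /= -/bs.
    change (all (fun B : {set T} => y \notin B) bs).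
    apply/allP => X Xin; apply: contra nB => yX.
    by rewrite (big_rem X) //= inE yX.
  rewrite -cO; apply: leq_trans (subset_leq_card sub) _.
  by apply: leq_trans (leq_card_setU _ _) _; move: sB; rewrite -!addnA leq_add2l.
- move=> y; rewrite inE => /andP[yO]; have [yi yp] := OP y yO.
  rewrite /= !(sel _ yO) !negbK in_set1 => /andP[f2] /andP[f3] /andP[f4] /andP[e2] /andP[e3] /andP[e4].
  move=> /andP[Ay] /andP[Ah] /andP[Ag] /andP[Ah'] /andP[Ag'] /andP[yx _].
  have yy0 : y != y0 by apply: contraNneq yp => ->; rewrite (wfp wfF).
  have yy1 : y != y1.
    apply: contraNneq yp => ->; rewrite (wfp wfF) //; apply/eqP.
    by move: bb; rewrite pr2 pc2; case: b1 {bx pr2 R leR RP Ri1 Ri2 tR}; case: b2 {pc2}; case: (par F r); case: (par F c).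
  have xy0 : x != y0.
    apply/eqP => e; move: f1 => /andP[m nb].
    have := plat_row latL.1 tL; rewrite e => /(_ _ m) e'.
    by move: nb; rewrite -e -e' tb.
  have xy1 : x != y1.
    apply/eqP => e; move: e1 => /andP[m nb].
    have := plat_col latL.1 tL; rewrite e => /(_ _ m) e'.
    by move: nb; rewrite -e -e' tb.
  set L' := double_switch L r c x r2 c2 y y0 y1 (eC F r y) (eR F c2 y) (eC F r2 y) (eR F c y).
  exists L'; split=> /=.
  + by apply: latin_dflip tb p1 f1 f2 f3 f4 e1 e2 e3 e4 yy0 yy1 yx.
  + exact: dflip_card latL f1 e1 yy0 yy1.
  + move=> t' dt a.
    case: (boolP (t' \in L)) dt => tl; case: (boolP (t' \in L')) => tl' // _.
      move: (dflip_old latL f1 e1 yy0 yy1 tl tl').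
      rewrite !inE; do 9?[case/orP] => /eqP ->; case: a => /=; by [right|left].
    move: (dflip_new tl' tl).
    rewrite !inE; do 9?[case/orP] => /eqP ->; case: a => /=; by [right|left].
  + exact: dflip_old_bad latL p1 f1 f2 f3 f4 e1 e2 e3 e4 yy0 yy1.
  + exact: dflip_new_pair p1 f1 f2 f3 f4 e1 e2 e3 e4.
  + by move=> a; eapply dflip_line; eassumption.
  + by have [] := mem_dflip L r c x r2 c2 y y0 y1 (eC F r y) (eR F c2 y) (eC F r2 y) (eR F c y).
  + by have [] := mem_dflip L r c x r2 c2 y y0 y1 (eC F r y) (eR F c2 y) (eC F r2 y) (eR F c y).
  + by have [] := mem_dflip L r c x r2 c2 y y0 y1 (eC F r y) (eR F c2 y) (eC F r2 y) (eR F c y).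
Qed.

End Fixed.
End Gadget.

(** * The last intercalate of an insertion *)

Section Finish.

Variable T : finType.
Implicit Types (t q : T * T * T) (L P : {set T * T * T}) (F : frame T) (A : axis -> {set T}).

(** The triples on which the gadget can work. Inside the core the parities must add up as in the
    table, otherwise no reference triple (r2, c2, x) of suitable parities exists; a single label
    outside the core escapes this condition. *)
Definition tame F t :=
  [&& t.1.1 \in core F, t.1.2 \in core F, t.2 \in core F
    & par F t.1.1 (+) par F t.1.2 == par F t.2]
  || ((t.1.1 \notin core F) + (t.1.2 \notin core F) + (t.2 \notin core F) == 1).

Record finishing_exchange F P A L L' (p : T * T * T) (x rh ch : T) : Prop := FinishingExchange {
  fm_latin : latin L';
  fm_mem : p \in L';
  fm_card : #|L :\: L'| <= 16;
  fm_line : forall t', (t' \in L) != (t' \in L') ->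
    [/\ [|| t'.1.1 \in A A0, t'.1.1 == p.1.1 | t'.1.1 == rh],
        [|| t'.1.2 \in A A1, t'.1.2 == p.1.2 | t'.1.2 == ch] &
        [|| t'.2 \in A A2, t'.2 == p.2 | t'.2 == x]];
  fm_old : forall t', t' \in L -> t' \notin L' -> bad P t' -> share2 p t';
  fm_new : forall t' q a, t' \in L' -> t' \notin L -> q \in P -> op a q = op a t' ->
    t' = p \/ co a t' \in A a /\ tame F t';
  fm_cnt2 : #|[set t' in L :\: L' | t'.2 == x]| <= 3;
  fm_cnt0 : rh \notin A A0 -> #|[set t' in L :\: L' | t'.1.1 == rh]| <= 3 }.

Variables (F : frame T) (k kq : nat) (P : {set T * T * T}).
Hypothesis wfF : wf F k kq.

(** With (r, ch, s) and (rh, c, s) in place, it remains to put a common symbol y into the cells (r,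
    c) and (rh, ch); exchanging the resulting intercalate inserts (r, c, s). The gadget serves the
    first cell and an intercalate at the corner (rh, ch) the second, and equal parity sums make the
    same y admissible for both. The hypotheses on P protect the pairs of the new triples (r, ch, y),
    (rh, c, y) and (rh, ch, s); the pair (s, rh) may belong to P when s lies outside the core. *)
Lemma finish L A W w r c s x rh ch :
  latin L -> clean_bound F P L W -> allowed F A w ->
  (r, c, s) \in P -> r \in core F -> c \in core F -> (r, c, x) \in L -> x != s ->
  (x \in core F -> par F r (+) par F c = par F x) ->
  (r, ch, s) \in L -> (rh, c, s) \in L -> rh \in core F -> ch \in A A1 ->
  par F rh (+) par F ch = par F r (+) par F c ->
  fresh P L (rh, ch, eS F rh ch) -> eS F rh ch \in A A2 -> eS F rh ch != x ->
  (forall q, q \in P -> op A2 q <> (r, ch)) ->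
  (forall q, q \in P -> op A0 q <> (ch, s)) ->
  (forall q, q \in P -> op A2 q <> (rh, c)) ->
  (forall q, q \in P -> op A1 q = (s, rh) -> s \notin core F) ->
  3 * W + 4 * w + 4 < kq -> 9 * W + 7 * w + 6 < k ->
  exists L', finishing_exchange F P A L L' (r, c, s) x rh ch.
Proof.
move=> latL cb al pP ri ci tL xs px m1 m2 rhi chA pp fu Aw wx n1 n2 n3 n4 lq lk.
set u := eS F rh ch in fu Aw wx.
have chi : ch \in core F by move/subsetP: (al A1).1 => /(_ _ chA).
have plL := latL.1.
have cch : c != ch.
  by apply: contraNneq xs => e; move: m1; rewrite -e => m; rewrite (plat_sym plL tL m).
have rrh : r != rh.
  by apply: contraNneq xs => e; move: m2; rewrite -e => m; rewrite (plat_sym plL tL m).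
have tb : bad P (r, c, x) by apply/badP; exists (r, c, s), A2.
(* Freezing row rh, column ch and symbol u during the gadget keeps the four triples of the
   intercalate at the corner (rh, ch). *)
pose A' a := A a :\ match a with A0 => rh | A1 => ch | A2 => u end.
have al' : allowed F A' w.+1.
  move=> a; split.
    by apply: subset_trans (al a).1; apply: subsetDl.
  set v := match a with A0 => rh | A1 => ch | A2 => u end.
  apply: leq_trans (_ : #|(core F :\: A a) :|: [set v]| <= _).
    apply: subset_leq_card; apply/subsetP => z; rewrite !inE.
    by case: (z == _) (z \in A a) (z \in core F) => [] [] [].
  apply: leq_trans (leq_card_setU _ _) _; rewrite cards1 addn1 ltnS; exact: (al a).2.
have subA a v : v \in A' a -> v \in A a by rewrite in_setD1 => /andP[].
have lt1 : 3 * W + 4 * w.+1 + #|(set0 : {set T})| < kq.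
  by move: lq; rewrite cards0 addn0 mulnS (addnC 4) addnA.
have [r2 [c2 [[Ar2 Ac2 _ pr2 pc2] [Y [sY cY HY]]]]] :=
  exchange_gadget wfF latL cb al' ri ci tL tb erefl px lt1.
have r2i : r2 \in core F by move/subsetP: (al A0).1; apply; exact: subA Ar2.
have c2i : c2 \in core F by move/subsetP: (al A1).1; apply; exact: subA Ac2.
have YP y : y \in Y -> [/\ y \in A A2, y != u, y \in core F & par F y != par F rh (+) par F ch] /\ y != x.
  move=> yY; move/subsetP: sY => /(_ _ yY); rewrite in_set pc2 pp => /andP[yA /andP[py yx]].
  move: (yA); rewrite in_setD1 => /andP[yu yA2]; do !split=> //.
  by move/subsetP: (al A2).1 => /(_ _ yA2).
have cor y : y \in Y -> eS F (eR F ch y) (eC F rh y) = u.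
  by move=> /YP[[_ _ yi py] _]; apply: (corner wfF).
(* The gadget has spent [6 * W + 5 * w.+1 + 1] symbols and this choice spends [3 * W + 2 * w]; the
   sum is [9 * W + 7 * w + 6]. *)
have [|y yY] := @pick_avoiding _ Y [::
   [set y in Y | ~~ fresh P L (rh, eC F rh y, y)];
   [set y in Y | ~~ fresh P L (eR F ch y, ch, y)];
   [set y in Y | ~~ fresh P L (eR F ch y, eC F rh y, u)];
   [set y in Y | eC F rh y \notin A A1];
   [set y in Y | eR F ch y \notin A A0]].
  have h1 : #|[set y in Y | ~~ fresh P L (rh, eC F rh y, y)]| <= W.
    apply: (curve_count (a := A0) (v := rh) cb) => // [y y' _ _ []|y /YP[[_ _ yi _] _]] //.
    by apply: (mem_eC wfF).
  have h2 : #|[set y in Y | ~~ fresh P L (eR F ch y, ch, y)]| <= W.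
    apply: (curve_count (a := A1) (v := ch) cb) => // [y y' _ _ []|y /YP[[_ _ yi _] _]] //.
    by apply: (mem_eR wfF).
  have h3 : #|[set y in Y | ~~ fresh P L (eR F ch y, eC F rh y, u)]| <= W.
    apply: (curve_count (a := A2) (v := u) cb) => // [y y' /YP[[_ _ yi _] _] /YP[[_ _ yi' _] _] [_]|y yY].
      by apply: (inj_eC wfF).
    have [[_ _ yi _] _] := YP y yY; rewrite -(cor y yY) (mem_eS wfF) ?(wfR wfF) ?(wfC wfF) //.
  have l1 : #|[set y in Y | eC F rh y \notin A A1]| <= w.
    apply: (line_count _ al) => // [y y' /YP[[_ _ yi _] _] /YP[[_ _ yi' _] _]|y /YP[[_ _ yi _] _]].
      by apply: (inj_eC wfF).
    by apply: (wfC wfF).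
  have l2 : #|[set y in Y | eR F ch y \notin A A0]| <= w.
    apply: (line_count _ al) => // [y y' /YP[[_ _ yi _] _] /YP[[_ _ yi' _] _]|y /YP[[_ _ yi _] _]].
      by apply: (inj_eR wfF).
    by apply: (wfR wfF).
  have := leq_add h1 (leq_add h2 (leq_add h3 (leq_add l1 l2))).
  rewrite /= addn0 => H; apply: leq_ltn_trans H _.
  move: cY lk; clear; lia.
rewrite /= !(sel _ yY) !negbK => /andP[f1] /andP[f2] /andP[f3] /andP[Ah /andP[Ag _]].
have [[yA yu yi py] yx0] := YP y yY.
set h := eC F rh y in f1 f3 Ah; set g := eR F ch y in f2 f3 Ag.
have [L1 X] := HY y yY.
have lat1 := xm_latin X.
have kept t : t \in L -> [\/ t.1.1 = rh, t.1.2 = ch | t.2 = u] -> t \in L1.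
  move=> tl H; apply/negPn/negP => tn.
  have li := xm_line X (t' := t); rewrite tl (negbTE tn) in li.
  case: H => e.
  - have [] := li isT A0; rewrite /= e; first by rewrite in_setD1 eqxx.
    by move=> e'; rewrite e' eqxx in rrh.
  - have [] := li isT A1; rewrite /= e; first by rewrite in_setD1 eqxx.
    by move=> e'; rewrite e' eqxx in cch.
  - have [] := li isT A2; rewrite /= e; first by rewrite in_setD1 eqxx.
    by move=> e'; rewrite e' eqxx in wx.
have badk t : t \in L -> share2 (r, c, s) t -> t != (r, c, x) -> t \in L1.
  move=> tl sh ne; apply/negPn/negP => tn; move: ne.
  by rewrite (xm_old X tl tn) ?eqxx //; apply/existsP; exists (r, c, s); rewrite pP.
have i1 : (r, ch, s) \in L1.
  apply: badk => //; first by rewrite /share2 /op /= !eqxx !orbT.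
  by rewrite !xpair_eqE (eq_sym ch) (negbTE cch) andbF.
have i2 : (rh, c, s) \in L1.
  apply: badk => //; first by rewrite /share2 /op /= !eqxx.
  by rewrite !xpair_eqE (eq_sym rh) (negbTE rrh).
have i3 : (r, c, y) \in L1 by exact: xm_mem2 X.
have j1 : (rh, ch, u) \in L1 by apply: kept; [case/andP: fu | apply: Or31].
have j2 : (rh, h, y) \in L1 by apply: kept; [case/andP: f1 | apply: Or31].
have j3 : (g, ch, y) \in L1 by apply: kept; [case/andP: f2 | apply: Or32].
have j4 : (g, h, u) \in L1 by apply: kept; [case/andP: f3 | apply: Or33].
have hch : h != ch.
  apply: contraNneq yu => e; move: j2; rewrite e => m; by rewrite (plat_sym lat1.1 m j1).
have grh : g != rh.
  apply: contraNneq yu => e; move: j3; rewrite e => m; by rewrite (plat_sym lat1.1 m j1).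
have ys : y != s.
  apply: contraNneq cch => e; move: i3; rewrite e => m; by rewrite (plat_row lat1.1 m i1).
pose L2 := switch L1 rh g ch h u y.
have lat2 : latin L2 by apply: latin_switch => //; rewrite eq_sym.
pose L3 := switch L2 r rh c ch y s.
have ne := (negbTE rrh, negbTE cch, negbTE hch, negbTE grh, negbTE ys, negbTE yu).
have ne' := (eq_sym rh r, eq_sym ch c, eq_sym ch h, eq_sym rh g, eq_sym s y, eq_sym u y).
have k1 : (r, c, y) \in L2.
  by apply: mem_switch_old => //; rewrite !inE !xpair_eqE ?ne' ?ne ?andbF.
have k2 : (r, ch, s) \in L2.
  by apply: mem_switch_old => //; rewrite !inE !xpair_eqE ?ne' ?ne ?andbF.
have k3 : (rh, c, s) \in L2.
  by apply: mem_switch_old => //; rewrite !inE !xpair_eqE ?ne' ?ne ?andbF.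
have k4 : (rh, ch, y) \in L2 by apply: mem_switch_new; rewrite inE eqxx.
have lat3 : latin L3 by apply: latin_switch.
have yx : (r, c, y) \notin L.
  by apply: contraNN yx0 => m; rewrite (plat_sym plL m tL).
have old t : t \in L -> t \notin L3 -> t \notin L1 \/
   t \in [:: (rh, ch, u); (rh, h, y); (g, ch, y); (g, h, u); (r, ch, s); (rh, c, s)].
  move=> tl tn; case: (boolP (t \in L1)) => t1; last by left.
  right; case: (boolP (t \in L2)) => t2; last first.
    by move: (switch_old t1 t2); rewrite !inE => /or4P[] ->; rewrite ?orbT.
  move: (switch_old t2 tn); rewrite !inE => /or4P[] e; rewrite ?e ?orbT //.
    by move: yx; rewrite -(eqP e) tl.
  move: tl; rewrite (eqP e) => tl.
  by move: yu; rewrite (plat_sym plL tl (andP fu).1) eqxx.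
have new t : t \in L3 -> t \notin L -> (t \in L1 /\ t <> (r, c, y)) \/
   t \in [:: (rh, h, u); (g, ch, u); (g, h, y); (r, c, s); (r, ch, y); (rh, c, y); (rh, ch, s)].
  rewrite {1}/L3 {1}/switch in_set => /orP[|/andP[t2 no]].
    by rewrite !inE => /or4P[] -> _; rewrite ?orbT; right.
  move=> tl; case: (boolP (t \in L1)) => t1.
    left; split=> // e; by move: no; rewrite e !inE eqxx.
  right; move: (switch_new t2 t1); rewrite !inE => /or4P[] e; rewrite ?e ?orbT //.
  by move: no; rewrite (eqP e) !inE eqxx ?orbT.
exists L3; split=> //.
- by apply: mem_switch_new; rewrite inE eqxx.
- pose l := [:: (rh, ch, u); (rh, h, y); (g, ch, y); (g, h, u); (r, ch, s); (rh, c, s)].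
  have sub : L :\: L3 \subset (L :\: L1) :|: [set t in l].
    apply/subsetP => t /setDP[tl tn]; rewrite in_setU in_setD tl andbT in_set.
    by case: (old t tl tn) => ->; rewrite ?orbT.
  apply: leq_trans (subset_leq_card sub) _; apply: leq_trans (leq_card_setU _ _) _.
  have c6 : #|[set t in l]| <= 6 by rewrite cardsE; exact: card_size.
  exact: leq_add (xm_card X) c6.
- move=> t' dt; case: (boolP (t' \in L)) dt => tl; case: (boolP (t' \in L3)) => tl' // _.
    case: (old _ tl tl') => [t1|]; last first.
      by rewrite !inE; do 5?[case/orP] => /eqP -> /=; rewrite ?eqxx ?chA ?Ah ?Ag ?Aw ?yA ?orbT.
    have li := xm_line X (t' := t'); rewrite tl (negbTE t1) in li.
    split; [have := li isT A0 | have := li isT A1 | have := li isT A2] => /=;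
      by case=> [/subA ->|->]; rewrite ?eqxx ?orbT.
  case: (new _ tl' tl) => [[t1 _]|]; last first.
    by rewrite !inE; do 6?[case/orP] => /eqP -> /=; rewrite ?eqxx ?chA ?Ah ?Ag ?Aw ?yA ?orbT.
  have li := xm_line X (t' := t'); rewrite t1 (negbTE tl) in li.
  split; [have := li isT A0 | have := li isT A1 | have := li isT A2] => /=;
    by case=> [/subA ->|->]; rewrite ?eqxx ?orbT.
- move=> t' tl tn tb'; case: (old _ tl tn) => [t1|].
    by rewrite (xm_old X tl t1 tb') /share2 /op /= !eqxx !orbT.
  have n t : fresh P L t -> (t' == t) = false.
    by move=> /andP[_ /negP fr]; apply/eqP => e; apply: fr; rewrite -e.
  by rewrite !inE (n _ fu) (n _ f1) (n _ f2) (n _ f3) /= => /orP[] /eqP ->; rewrite /share2 /op /= !eqxx ?orbT.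
- move=> t' q a tl' tl qP e.
  have [nb1 nb2 nb3 nb4] : [/\ ~~ bad P (rh, ch, y), ~~ bad P (rh, h, u), ~~ bad P (g, ch, u)
      & ~~ bad P (g, h, y)].
    by apply: switch_good; [case/andP: fu|case/andP: f1|case/andP: f2|case/andP: f3].
  have nb a' t : ~~ bad P t -> op a' q = op a' t -> False.
    by move=> /badPn n /n; exact.
  have xn a' t : op a' q = op a' t -> t \in L1 -> t \notin L -> _ :=
    fun e' i i' => xm_new X i i' qP e'.
  (* The triple (r, c, y), whose parities do not add up, is consumed by the last exchange; the other
     two triples of the gadget that may matter to P are tame. *)
  case: (new _ tl' tl) => [[t1 nt]|].
    have := xm_new X t1 tl qP e => /=; case: (a) => e'; right; rewrite e'.
    - split; first exact: subA Ar2.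
      by rewrite /tame /= r2i ci pr2 /=; case: (boolP (x \in core F)) => xi //; rewrite -px ?eqxx.
    - split; first exact: subA Ac2.
      by rewrite /tame /= ri c2i pc2 /=; case: (boolP (x \in core F)) => xi //; rewrite -px ?eqxx.
    - by [].
  rewrite !inE; do 6?[case/orP] => /eqP e'; move: e; rewrite e'; try by [left].
  - by move/(nb _ _ nb2).
  - by move/(nb _ _ nb3).
  - by move/(nb _ _ nb4).
  - case: (a) => e1.
    + by case: (nb A0 _ (andP f2).2 e1).
    + have [_ e2] : (r, c, y) = (r, c2, x) := xn A1 (r, c, y) e1 i3 yx.
      by rewrite e2 eqxx in yx0.
    + by case: (n1 q qP).
  - case: (a) => e1.
    + have [_ e2] : (r, c, y) = (r2, c, x) := xn A0 (r, c, y) e1 i3 yx.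
      by rewrite e2 eqxx in yx0.
    + by case: (nb A1 _ (andP f1).2 e1).
    + by case: (n3 q qP).
  - case: (a) => e1.
    + by case: (n2 q qP).
    + right; split=> //; rewrite /tame /= rhi chi (negbTE (n4 q qP e1)) //.
    + by case: (nb A2 _ (andP fu).2 e1).
- apply: leq_trans (xm_cnt X A2); apply: subset_leq_card; apply/subsetP => t.
  rewrite in_set => /andP[/setDP[tl tn] /eqP e].
  case: (old t tl tn) => [t1|]; first by rewrite in_set in_setD t1 tl /= e eqxx.
  rewrite !inE; do 5?[case/orP] => /eqP e'; move: e; rewrite e' /= => e.
  + by rewrite e eqxx in wx.
  + by rewrite e eqxx in yx0.
  + by rewrite e eqxx in yx0.
  + by rewrite e eqxx in wx.
  + by rewrite e eqxx in xs.
  + by rewrite e eqxx in xs.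
- move=> rhA; pose l := [:: (rh, ch, u); (rh, h, y); (rh, c, s)].
  apply: (@leq_trans (size l)) => //; apply: leq_trans (card_size l).
  apply: subset_leq_card; apply/subsetP => t.
  rewrite in_set => /andP[/setDP[tl tn] /eqP e].
  case: (old t tl tn) => [t1|].
    have li := xm_line X (t' := t); rewrite tl (negbTE t1) in li.
    case: (li isT A0) => /=; rewrite e; first by move/subA; rewrite (negbTE rhA).
    by move=> e'; rewrite e' eqxx in rrh.
  rewrite !inE; do 5?[case/orP] => /eqP e'; move: e; rewrite e' /= ?eqxx ?orbT // => e.
  + by rewrite e eqxx in grh.
  + by rewrite e eqxx in grh.
  + by rewrite e eqxx in rrh.
Qed.

End Finish.

(** * Insertion of an isolated triple *)

Section Isolated.

Variable T : finType.
Implicit Types (t q p : T * T * T) (L P : {set T * T * T}) (F : frame T) (A : axis -> {set T}).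

(** Outside the allowed lines, only the lines of p and those of the three triples of L covering its
    pairs may be touched. [in_cnt] limits the damage on the latter; [in_new] keeps the pairs of the
    other triples of P on allowed lines and covered by tame triples. *)
Record insertion F P A L L' p : Prop := Ins {
  in_latin : latin L';
  in_mem : p \in L';
  in_card : #|L :\: L'| <= 36;
  in_line : forall t', (t' \in L) != (t' \in L') -> forall a t, t \in L -> op a t = op a p ->
    [\/ co a t' \in A a, co a t' = co a p | co a t' = co a t];
  in_old : forall t', t' \in L -> t' \notin L' -> bad P t' -> share2 p t';
  in_new : forall t' q a, t' \in L' -> t' \notin L -> q \in P -> op a q = op a t' ->
    t' = p \/ co a t' \in A a /\ tame F t';
  in_cnt : forall a t, t \in L -> op a t = op a p -> co a t \notin A a ->
    #|[set t' in L :\: L' | co a t' == co a t]| <= 3 }.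

Variables (F : frame T) (k kq : nat) (P : {set T * T * T}).
Hypothesis wfF : wf F k kq.

Lemma insert_isolated L A W w r c s x c' r' :
  latin L -> clean_bound F P L W -> allowed F A w -> (r, c, s) \in P ->
  r \in core F -> c \in core F -> s \in core F -> x \in core F -> c' \in core F -> r' \in core F ->
  (r, c, x) \in L -> (r, c', s) \in L -> (r', c, s) \in L -> x != s ->
  eS F r c = x -> eS F r c' = s -> eS F r' c = s ->
  (forall q, q \in P -> share2 q (r, c, x) -> q = (r, c, s)) ->
  (forall q, q \in P -> share2 q (r, c', s) -> q = (r, c, s)) ->
  (forall q, q \in P -> share2 q (r', c, s) -> q = (r, c, s)) ->
  7 * W + 6 * w < k ->
  exists2 L', insertion F P A L L' (r, c, s) & #|L :\: L'| <= 10.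
Proof.
move=> latL cb al pP ri ci si xi c'i r'i t1L t2L t3L xs ex ec er i1 i2 i3 lt.
have plL := latL.1.
pose O := [set v in core F | par F v != par F c'].
have cO : #|O| = k by apply: card_par wfF _.
have OP v : v \in O -> [/\ v \in core F, eS F r v \in core F, eR F v x \in core F &
    par F v != par F c'].
  by rewrite inE => /andP[vi ->]; rewrite vi (wfS wfF) ?(wfR wfF).
have q1 v : v \in O -> eS F (eR F c' (eS F r v)) v = s.
  by move=> /OP[vi _ _ pv]; rewrite (wfq wfF) // eq_sym.
(* The parity of the column of s in row [eR F v x] is that of v, c and c' added up, hence opposite
   to c exactly when v is opposite to c'. *)
have q2 v : v \in O -> eS F r' (eC F (eR F v x) s) = eS F (eR F v x) c.
  move=> /OP[vi _ gi pv]; rewrite -(wfq wfF gi ci (wfC wfF gi si)).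
    rewrite (eSC wfF) //; congr (eS F _ _); apply/eqP; rewrite eq_sym (wfSR wfF) //; exact/eqP.
  rewrite (par_eC wfF) // (par_eR wfF) // -ex -ec !(wfp wfF) //.
  by move: pv; case: (par F v); case: (par F c'); case: (par F r); case: (par F c).
have jx : {in O &, injective (fun v => eR F v x)}.
  move=> v v' /OP[vi _ gi _] /OP[vi' _ _ _] e.
  by apply: (inj_eS wfF gi) => //; rewrite (eSR wfF) // e (eSR wfF).
have js : {in O &, injective (eS F r)}.
  by move=> v v' /OP[vi _ _ _] /OP[vi' _ _ _]; apply: (inj_eS wfF).
have jy : {in O &, injective (fun v => eS F (eR F v x) c)}.
  move=> v v' vO v'O /= e; have [_ _ gi _] := OP v vO; have [_ _ gi' _] := OP v' v'O.
  by apply: jx => //; apply: (inj_eS' wfF ci).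
have jh : {in O &, injective (fun v => eC F (eR F v x) s)}.
  move=> v v' vO v'O /= e; apply: jy => //=; by rewrite -(q2 v vO) -(q2 v' v'O) e.
have jg : {in O &, injective (fun v => eR F c' (eS F r v))}.
  move=> v v' vO v'O /= e; have [_ s1 _ _] := OP v vO; have [_ s2 _ _] := OP v' v'O.
  by apply: js => //; apply: (inj_eR wfF c'i).
(* Seven demands of freshness and six allowed lines: [7 * W + 6 * w]. *)
have [|v vO] := @pick_avoiding _ O [::
   [set v in O | ~~ fresh P L (r, v, eS F r v)];
   [set v in O | ~~ fresh P L (eR F c' (eS F r v), c', eS F r v)];
   [set v in O | ~~ fresh P L (eR F c' (eS F r v), v, s)];
   [set v in O | ~~ fresh P L (eR F v x, v, x)];
   [set v in O | ~~ fresh P L (eR F v x, c, eS F (eR F v x) c)];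
   [set v in O | ~~ fresh P L (eR F v x, eC F (eR F v x) s, s)];
   [set v in O | ~~ fresh P L (r', eC F (eR F v x) s, eS F (eR F v x) c)];
   [set v in O | v \notin A A1];
   [set v in O | eS F r v \notin A A2];
   [set v in O | eR F c' (eS F r v) \notin A A0];
   [set v in O | eR F v x \notin A A0];
   [set v in O | eS F (eR F v x) c \notin A A2];
   [set v in O | eC F (eR F v x) s \notin A A1]].
  have h1 : #|[set v in O | ~~ fresh P L (r, v, eS F r v)]| <= W.
    apply: (curve_count (a := A0) (v := r) cb) => // [v v' _ _ []|v /OP[vi _ _ _]] //.
    by apply: (mem_eS wfF).
  have h2 : #|[set v in O | ~~ fresh P L (eR F c' (eS F r v), c', eS F r v)]| <= W.
    apply: (curve_count (a := A1) (v := c') cb) => // [v v' vO v'O [_ e]|v /OP[vi sv _ _]] //.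
      exact: js.
    by apply: (mem_eR wfF).
  have h3 : #|[set v in O | ~~ fresh P L (eR F c' (eS F r v), v, s)]| <= W.
    apply: (curve_count (a := A2) (v := s) cb) => // [v v' _ _ []|v vO] //.
    by have [vi sv _ _] := OP v vO; rewrite -(q1 v vO) (mem_eS wfF) // (wfR wfF).
  have h4 : #|[set v in O | ~~ fresh P L (eR F v x, v, x)]| <= W.
    apply: (curve_count (a := A2) (v := x) cb) => // [v v' _ _ []|v /OP[vi _ _ _]] //.
    by apply: (mem_eR wfF).
  have h5 : #|[set v in O | ~~ fresh P L (eR F v x, c, eS F (eR F v x) c)]| <= W.
    apply: (curve_count (a := A1) (v := c) cb) => // [v v' vO v'O [_ e]|v /OP[vi _ gi _]] //.
      exact: jy.
    by apply: (mem_eS wfF).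
  have h6 : #|[set v in O | ~~ fresh P L (eR F v x, eC F (eR F v x) s, s)]| <= W.
    apply: (curve_count (a := A2) (v := s) cb) => // [v v' vO v'O [_ e]|v /OP[vi _ gi _]] //.
      exact: jh.
    by apply: (mem_eC wfF).
  have h7 : #|[set v in O | ~~ fresh P L (r', eC F (eR F v x) s, eS F (eR F v x) c)]| <= W.
    apply: (curve_count (a := A0) (v := r') cb) => // [v v' vO v'O [_ e]|v vO] //.
      exact: jy.
    by have [_ _ gi _] := OP v vO; rewrite -(q2 v vO) (mem_eS wfF) // (wfC wfF).
  have l1 : #|[set v in O | v \notin A A1]| <= w.
    by apply: (line_count (f := id) _ al) => // v /OP[].
  have l2 : #|[set v in O | eS F r v \notin A A2]| <= w.
    by apply: (line_count _ al) => // v /OP[].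
  have l3 : #|[set v in O | eR F c' (eS F r v) \notin A A0]| <= w.
    by apply: (line_count _ al) => // v /OP[? ? _ _]; apply: (wfR wfF).
  have l4 : #|[set v in O | eR F v x \notin A A0]| <= w.
    by apply: (line_count _ al) => // v /OP[].
  have l5 : #|[set v in O | eS F (eR F v x) c \notin A A2]| <= w.
    by apply: (line_count _ al) => // v /OP[? ? ? _]; apply: (wfS wfF).
  have l6 : #|[set v in O | eC F (eR F v x) s \notin A A1]| <= w.
    by apply: (line_count _ al) => // v /OP[? ? ? _]; apply: (wfC wfF).
  have := leq_add h1 (leq_add h2 (leq_add h3 (leq_add h4 (leq_add h5 (leq_add h6 (leq_add h7
    (leq_add l1 (leq_add l2 (leq_add l3 (leq_add l4 (leq_add l5 l6))))))))))).
  rewrite /= addn0 cO => H; apply: leq_ltn_trans H _; move: lt; clear; lia.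
have [vi yi rhi pv] := OP v vO.
have q1v := q1 v vO; have q2v := q2 v vO.
rewrite /= !(sel _ vO) !negbK => /andP[f1] /andP[f2] /andP[f3] /andP[f4] /andP[f5] /andP[f6] /andP[f7].
move=> /andP[av] /andP[ay] /andP[ag] /andP[arh] /andP[ay3] /andP[ah _].
set y := eS F r v in f1 f2 f3 ay ag yi q1v; set g := eR F c' y in f2 f3 ag q1v.
set rh := eR F v x in f4 f5 f6 f7 arh ay3 ah rhi q2v.
set y3 := eS F rh c in f5 f7 ay3 q2v; set h := eC F rh s in f6 f7 ah q2v.
have [[b1 nf1] [b2 nf2]] := (andP f1, andP f2); have [[b3 nf3] [b4 nf4]] := (andP f3, andP f4).
have [[b5 nf5] [b6 nf6]] := (andP f5, andP f6); have [b7 nf7] := andP f7.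
have pb t : share2 (r, c, s) t -> bad P t.
  by move=> sh; apply/existsP; exists (r, c, s); rewrite pP.
have sh1 : share2 (r, c, s) (r, c, x) by rewrite /share2 /op /= !eqxx !orbT.
have sh2 : share2 (r, c, s) (r, c', s) by rewrite /share2 /op /= !eqxx !orbT.
have sh3 : share2 (r, c, s) (r', c, s) by rewrite /share2 /op /= !eqxx.
have nf t t' : fresh P L t -> share2 (r, c, s) t' -> t != t'.
  by move=> /andP[_ nb] sh; apply: contraNneq nb => ->; exact: pb.
have vc : v != c.
  by apply: contraNneq (nf _ _ f1 sh1) => e; rewrite -e in t1L *; rewrite (plat_sym plL b1 t1L).
have cc' : c != c'.
  by apply: contraNneq xs => e; rewrite -e in t2L; rewrite (plat_sym plL t1L t2L).
have rr' : r != r'.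
  by apply: contraNneq xs => e; rewrite -e in t3L; rewrite (plat_sym plL t1L t3L).
have vc' : v != c' by apply: contraNneq pv => ->.
have ys : y != s.
  by apply: contraNneq vc' => e; move: b1; rewrite e => m; rewrite (plat_row plL m t2L).
have gr : g != r.
  by apply: contraNneq vc' => e; move: b3; rewrite e => m; rewrite (plat_row plL m t2L).
have rhr : rh != r.
  by apply: contraNneq vc => e; move: b4; rewrite e => m; rewrite (plat_row plL m t1L).
have rhr' : rh != r'.
  apply: contraNneq (nf _ _ f6 sh3) => e; move: b6; rewrite e => m.
  by rewrite (plat_row plL m t3L).
have grh : g != rh.
  by apply: contraNneq xs => e; move: b3; rewrite e => m; rewrite (plat_sym plL b4 m).
have y3s : y3 != s.
  by apply: contraNneq rhr' => e; move: b5; rewrite e => m; rewrite (plat_col plL m t3L).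
have hc : h != c.
  by apply: contraNneq y3s => e; move: b6; rewrite e => m; rewrite (plat_sym plL b5 m).
have hc' : h != c'.
  by apply: contraNneq rhr => e; move: b6; rewrite e => m; rewrite (plat_col plL m t2L).
have hv : h != v.
  by apply: contraNneq xs => e; move: b6; rewrite e => m; rewrite (plat_sym plL b4 m).
have ne := (negbTE vc, negbTE cc', negbTE rr', negbTE vc', negbTE ys, negbTE gr, negbTE rhr,
  negbTE rhr', negbTE grh, negbTE y3s, negbTE hc, negbTE hc', negbTE hv, negbTE xs).
have ne' := (eq_sym c v, eq_sym c' c, eq_sym r' r, eq_sym c' v, eq_sym s y, eq_sym r g,
  eq_sym r rh, eq_sym r' rh, eq_sym rh g, eq_sym s y3, eq_sym c h, eq_sym c' h, eq_sym v h, eq_sym s x).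
pose L1 := switch L r g c' v s y.
pose L2 := switch L1 r' rh c h s y3.
pose L3 := switch L2 r rh c v x s.
have lat1 : latin L1 by apply: latin_switch => //; rewrite eq_sym.
have lat2 : latin L2.
  by apply: latin_switch => //; rewrite 1?eq_sym //; apply: mem_switch_old => //; rewrite !inE !xpair_eqE ?ne' ?ne ?andbF.
have k1 : (r, c, x) \in L2.
  by apply: mem_switch_old; [apply: mem_switch_old => // |]; rewrite !inE !xpair_eqE ?ne' ?ne ?andbF.
have k2 : (r, v, s) \in L2.
  apply: mem_switch_old; last by rewrite !inE !xpair_eqE ?ne' ?ne ?andbF.
  by apply: mem_switch_new; rewrite !inE eqxx ?orbT.
have k3 : (rh, c, s) \in L2 by apply: mem_switch_new; rewrite !inE eqxx ?orbT.
have k4 : (rh, v, x) \in L2.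
  by apply: mem_switch_old; [apply: mem_switch_old => // |]; rewrite !inE !xpair_eqE ?ne' ?ne ?andbF.
have lat3 : latin L3 by apply: latin_switch.
have n5 : (r, v, s) \notin L.
  by apply: contra ys => m; rewrite (plat_sym plL b1 m).
have n6 : (rh, c, s) \notin L.
  by apply: contra y3s => m; rewrite (plat_sym plL b5 m).
have old t : t \in L -> t \notin L3 -> t \in [:: (r, c, x); (r, c', s); (r', c, s);
    (r, v, y); (g, c', y); (g, v, s); (rh, v, x); (rh, c, y3); (rh, h, s); (r', h, y3)].
  move=> tl tn.
  case: (boolP (t \in L1)) => m1; last first.
    by move: (switch_old tl m1); rewrite !inE => /or4P[] ->; rewrite ?orbT.
  case: (boolP (t \in L2)) => m2; last first.
    by move: (switch_old m1 m2); rewrite !inE => /or4P[] ->; rewrite ?orbT.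
  move: (switch_old m2 tn); rewrite !inE => /or4P[] e; rewrite ?e ?orbT //.
    by move: n5; rewrite -(eqP e) tl.
  by move: n6; rewrite -(eqP e) tl.
have new t : t \in L3 -> t \notin L -> t \in [:: (r, c', y); (g, c', s); (g, v, y);
    (r', c, y3); (r', h, s); (rh, h, y3); (r, c, s); (r, v, x); (rh, c, x); (rh, v, s)].
  rewrite {1}/L3 {1}/switch in_set => /orP[|/andP[m2 no]].
    by rewrite !inE => /or4P[] ->; rewrite ?orbT.
  move=> tl; case: (boolP (t \in L1)) => m1; last first.
    move: (switch_new m2 m1); rewrite !inE => /or4P[] e; rewrite ?e ?orbT //.
    by move: no; rewrite (eqP e) !inE eqxx ?orbT.
  move: (switch_new m1 tl); rewrite !inE => /or4P[] e; rewrite ?e ?orbT //.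
  by move: no; rewrite (eqP e) !inE eqxx ?orbT.
have pL3 : (r, c, s) \in L3 by apply: mem_switch_new; rewrite inE eqxx.
have c10 : #|L :\: L3| <= 10.
  apply: (@leq_trans (size [:: (r, c, x); (r, c', s); (r', c, s);
    (r, v, y); (g, c', y); (g, v, s); (rh, v, x); (rh, c, y3); (rh, h, s); (r', h, y3)])) => //.
  apply: leq_trans (card_size _); apply: subset_leq_card; apply/subsetP => t /setDP[tl tn].
  exact: old.
exists L3 => //; split=> //.
- exact: leq_trans c10 _.
- move=> t' dt a t tL e.
  have -> : co a t = match a with A0 => r' | A1 => c' | A2 => x end.
    case: a e => e.
    + by rewrite (plL A0 _ _ tL t3L e).
    + by rewrite (plL A1 _ _ tL t2L e).
    + by rewrite (plL A2 _ _ tL t1L e).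
  case: (boolP (t' \in L)) dt => tl; case: (boolP (t' \in L3)) => tl' // _.
    move: (old t' tl tl'); rewrite !inE; do 9?[case/orP] => /eqP ->; case: (a);
      by [apply: Or31|apply: Or32|apply: Or33].
  move: (new t' tl' tl); rewrite !inE; do 9?[case/orP] => /eqP ->; case: (a);
      by [apply: Or31|apply: Or32|apply: Or33].
- move=> t' tl tn tb'.
  have n t : ~~ bad P t -> (t' == t) = false.
    by move=> /negP fr; apply/eqP => e; apply: fr; rewrite -e.
  move: (old t' tl tn); rewrite !inE (n _ nf1) (n _ nf2) (n _ nf3) (n _ nf4) (n _ nf5) (n _ nf6) (n _ nf7).
  by rewrite !orbF => /or3P[] /eqP ->.
- move=> t' q a tl' tl qP e; left.
  have nb a' t : ~~ bad P t -> op a' q = op a' t -> False.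
    by move=> /badPn n /n; exact.
  have qp : q = (r, c, s) -> t' = (r, c, s).
    by move=> e1; apply: (lat3.1 a) => //; rewrite -e -e1.
  have u1 a' : op a' q = op a' (r, c, x) -> t' = (r, c, s).
    by move=> e1; apply: qp; apply: i1 => //; apply/share2P; exists a'.
  have u2 a' : op a' q = op a' (r, c', s) -> t' = (r, c, s).
    by move=> e1; apply: qp; apply: i2 => //; apply/share2P; exists a'.
  have u3 a' : op a' q = op a' (r', c, s) -> t' = (r, c, s).
    by move=> e1; apply: qp; apply: i3 => //; apply/share2P; exists a'.
  move: (new t' tl' tl); rewrite !inE.
  do 9?[case/orP] => /eqP e'; move: e; rewrite {1}e'; case: (a) => e1 //.
  + by case: (nb A0 _ nf2 e1).
  + by case: (nb A1 _ nf1 e1).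
  + exact: u2 A2 e1.
  + exact: u2 A0 e1.
  + by case: (nb A1 _ nf3 e1).
  + by case: (nb A2 _ nf2 e1).
  + by case: (nb A0 _ nf1 e1).
  + by case: (nb A1 _ nf2 e1).
  + by case: (nb A2 _ nf3 e1).
  + by case: (nb A0 _ nf5 e1).
  + by case: (nb A1 _ nf7 e1).
  + exact: u3 A2 e1.
  + by case: (nb A0 _ nf6 e1).
  + exact: u3 A1 e1.
  + by case: (nb A2 _ nf7 e1).
  + by case: (nb A0 _ nf7 e1).
  + by case: (nb A1 _ nf5 e1).
  + by case: (nb A2 _ nf6 e1).
  + by case: (nb A0 _ nf4 e1).
  + exact: u1 A1 e1.
  + by case: (nb A2 _ nf1 e1).
  + exact: u1 A0 e1.
  + by case: (nb A1 _ nf4 e1).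
  + by case: (nb A2 _ nf5 e1).
  + by case: (nb A0 _ nf3 e1).
  + by case: (nb A1 _ nf6 e1).
  + by case: (nb A2 _ nf4 e1).
- move=> a t tL e.
  have sub (l : seq (T * T * T)) z : size l <= 3 ->
     (forall t', t' \in L -> t' \notin L3 -> co a t' = z -> t' \in l) ->
     #|[set t' in L :\: L3 | co a t' == z]| <= 3.
    move=> sl H; apply: leq_trans sl; apply: leq_trans (card_size l).
    apply: subset_leq_card; apply/subsetP => t'; rewrite inE => /andP[/setDP[tl tn] /eqP e'].
    exact: H.
  case: a e sub => e sub.
  + rewrite (plL A0 _ _ tL t3L e) /= => nA.
    apply: (sub [:: (r', c, s); (r', h, y3)]) => // t' tl tn e'.
    move: (old t' tl tn); rewrite !inE; do 9?[case/orP] => /eqP e2; move: e'; rewrite e2 /= ?eqxx ?orbT // => e3;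
      by [rewrite e3 eqxx in rr' | rewrite -e3 arh in nA | rewrite -e3 ag in nA].
  + rewrite (plL A1 _ _ tL t2L e) /= => nA.
    apply: (sub [:: (r, c', s); (g, c', y)]) => // t' tl tn e'.
    move: (old t' tl tn); rewrite !inE; do 9?[case/orP] => /eqP e2; move: e'; rewrite e2 /= ?eqxx ?orbT // => e3;
      by [rewrite e3 eqxx in cc' | rewrite -e3 av in nA | rewrite -e3 ah in nA].
  + rewrite (plL A2 _ _ tL t1L e) /= => nA.
    apply: (sub [:: (r, c, x); (rh, v, x)]) => // t' tl tn e'.
    move: (old t' tl tn); rewrite !inE; do 9?[case/orP] => /eqP e2; move: e'; rewrite e2 /= ?eqxx ?orbT // => e3;
      by [rewrite e3 eqxx in xs | rewrite -e3 ay in nA | rewrite -e3 ay3 in nA].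
Qed.

End Isolated.

(** * Transport of the exchanges along the rotation of the axes *)

Section Rotation.

Variable T : finType.
Implicit Types (t q p : T * T * T) (L P : {set T * T * T}) (F : frame T) (A : axis -> {set T}).

Lemma co_unturn a t : co (nxt a) (unturn t) = co a t.
Proof. by rewrite -co_turn unturnK. Qed.
Lemma op_unturn a t : op (nxt a) (unturn t) = op a t.
Proof. by rewrite -op_turn unturnK. Qed.

Lemma op_turn2 a t : op a t = op (nxt (nxt a)) (turn t).
Proof. by rewrite op_turn nxt3. Qed.
Lemma co_turn2 a t : co a t = co (nxt (nxt a)) (turn t).
Proof. by rewrite co_turn nxt3. Qed.

Lemma mem_turnS2 L t : (t \in turnS (turnS L)) = (turn t \in L).
Proof. by rewrite !inE; case: t => [[]]. Qed.

Lemma share2_turn q t : share2 (turn q) (turn t) = share2 q t.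
Proof.
apply/share2P/share2P => [[a e]|[a]]; first by exists (nxt a); rewrite -!op_turn.
by rewrite (op_turn2 a q) (op_turn2 a t) => e; exists (nxt (nxt a)).
Qed.

Lemma bad_turn P t : bad (turnS P) (turn t) = bad P t.
Proof.
apply/badP/badP => [[q [a [qP e]]]|[q [a [qP]]]].
  exists (unturn q), (nxt a); split; first by rewrite inE in qP.
  by rewrite op_unturn e op_turn.
rewrite (op_turn2 a q) (op_turn2 a t) => e; exists (turn q), (nxt (nxt a)); split=> //.
by rewrite mem_turnS.
Qed.

Lemma fresh_turn P L t : fresh (turnS P) (turnS L) (turn t) = fresh P L t.
Proof. by rewrite /fresh bad_turn mem_turnS. Qed.

Lemma turnP t : exists t', t = turn t'. Proof. by exists (unturn t); rewrite unturnK. Qed.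

Lemma plat_turn L : plat L -> plat (turnS L).
Proof.
move=> pl a t t'; case: (turnP t) (turnP t') => u -> [u' ->].
by rewrite !mem_turnS !op_turn => m m' /(pl _ _ _ m m') ->.
Qed.

Lemma latin_turn L : latin L -> latin (turnS L).
Proof.
move=> [pl ex]; split; first exact: plat_turn.
move=> a v; have [t tL e] := ex (nxt a) v.
by exists (turn t); rewrite ?mem_turnS ?op_turn.
Qed.

Lemma card_turnS L : #|turnS L| = #|L|.
Proof.
rewrite -(card_imset (mem L) (can_inj (@turnK T))); apply: eq_card => t.
case: (turnP t) => u ->; rewrite mem_turnS; apply/idP/imsetP => [uL|[u' uL /(can_inj (@turnK T)) ->] //].
by exists u.
Qed.

Lemma turnSP L M (p : pred (T * T * T)) :
  #|[set t in turnS L :\: turnS M | p t]| = #|[set t in L :\: M | p (turn t)]|.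
Proof.
rewrite -[RHS]card_turnS; congr (#|pred_of_set _|); apply/setP => t.
by case: (turnP t) => u ->; rewrite mem_turnS !in_set !turnK.
Qed.

Lemma clean_turn F P L W : clean_bound F P L W -> clean_bound (turnF F) (turnS P) (turnS L) W.
Proof.
move=> cb a v; apply: leq_trans (cb (nxt a) v).
rewrite -[X in _ <= X]card_turnS; apply: subset_leq_card; apply/subsetP => t.
by case: (turnP t) => u ->; rewrite mem_turnS !in_set turnK fresh_turn co_turn.
Qed.

Lemma allowed_turn F A w : allowed F A w -> allowed (turnF F) (fun a => A (nxt a)) w.
Proof. by move=> al a; exact: al. Qed.

Lemma tame_turn F t : tame (turnF F) (turn t) = tame F t.
Proof.
case: t => [[r c] s]; rewrite /tame /=; congr orb; last by congr (_ == _); lia.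
case: (r \in core F) (c \in core F) (s \in core F) => [] [] [] //=.
by case: (par F r) (par F c) (par F s) => [] [] [].
Qed.

(** The gadget seen from one axis: the pair [op a0 t] gets the new third label v, and neither of the
    other two pairs of the triple that now covers it belongs to P. *)
Record axis_exchange F P A L L' t (a0 : axis) (v : T) : Prop := AxisExchange {
  gm_latin : latin L';
  gm_card : #|L :\: L'| <= 10;
  gm_line : forall t', (t' \in L) != (t' \in L') ->
    forall a, co a t' \in A a \/ co a t' = co a t;
  gm_old : forall t', t' \in L -> t' \notin L' -> bad P t' -> t' = t;
  gm_new : forall t' q a, t' \in L' -> t' \notin L -> q \in P -> op a q = op a t' ->
    op a q = op a t /\ (a = a0 \/ co a t' \in A a /\ tame F t');
  gm_cnt : forall a, #|[set t' in L :\: L' | co a t' == co a t]| <= 3;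
  gm_all : v \in A a0;
  gm_mem : exists t1, [/\ t1 \in L', op a0 t1 = op a0 t, co a0 t1 = v &
    forall a q, a <> a0 -> q \in P -> op a q <> op a t1] }.

Lemma axis_exchange_turn F P A L M t a0 v :
  axis_exchange (turnF F) (turnS P) (fun a => A (nxt a)) (turnS L) M (turn t) a0 v ->
  axis_exchange F P A L (turnS (turnS M)) t (nxt a0) v.
Proof.
case=> g1 g2 g3 g4 g5 g6 g7 [t1 [h1 h2 h3 h4]].
have mM : M = turnS (turnS (turnS M)) by rewrite turnS3.
have mt u : (u \in turnS (turnS M)) = (turn u \in M) by exact: mem_turnS2.
split=> //.
- by do 2!apply: latin_turn.
- rewrite -card_turnS; apply: leq_trans (subset_leq_card _) g2; apply/subsetP => t'.
  by case: (turnP t') => u ->; rewrite mem_turnS !in_setD mt mem_turnS.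
- move=> t'; rewrite mt -(mem_turnS L) => d a.
  by have := g3 _ d (nxt (nxt a)); rewrite !co_turn !nxt3.
- move=> t'; rewrite mt -(mem_turnS L) -bad_turn => i1 i2 i3.
  by apply: (can_inj (@turnK T)); apply: g4.
- move=> t' q a; rewrite mt -(mem_turnS L) -(mem_turnS P) (op_turn2 a q) (op_turn2 a t') => i1 i2 i3 e.
  have [e1 H] := g5 _ _ _ i1 i2 i3 e; split; first by rewrite (op_turn2 a t).
  case: H => [e2|]; first by left; rewrite -e2 nxt3.
  by rewrite tame_turn co_turn nxt3; right.
- move=> a.
  have := g6 (nxt (nxt a)); rewrite {1}mM turnSP; apply: leq_trans.
  by apply: subset_leq_card; apply/subsetP => u; rewrite !in_set !co_turn !nxt3.
- exists (unturn t1); split.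
  + by rewrite mt unturnK.
  + by rewrite op_unturn h2 op_turn.
  + by rewrite co_unturn.
  + move=> a q ne qP; rewrite (op_turn2 a q) (op_turn2 a (unturn t1)) unturnK.
    by apply: h4; [move=> e; apply: ne; rewrite -e nxt3|rewrite mem_turnS].
Qed.

(** Taking for (r2, c2) the parities of (r, c) keeps tame the two other triples that take over pairs
    of t. The label v has the wrong parity by necessity; [insert_core] makes two such errors
    cancel. *)
Lemma exchange_along_symbol F k kq P L A W w t (V : {set T}) : wf F k kq ->
  latin L -> clean_bound F P L W -> allowed F A w ->
  t \in L -> bad P t -> tame F t -> co A0 t \in core F -> co A1 t \in core F ->
  3 * W + 4 * w < kq -> 6 * W + 5 * w + 1 + #|V| < k ->
  exists L' v, [/\ axis_exchange F P A L L' t A2 v, v \notin V &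
    par F v != par F (co A0 t) (+) par F (co A1 t)].
Proof.
case: t => [[r c] x] wfF latL cb al tL tb ok /= ri ci l1 l2.
have px : x \in core F -> par F r (+) par F c = par F x.
  by move=> xi; move: ok; rewrite /tame /= ri ci xi /= orbF => /eqP.
have l1' : 3 * W + 4 * w + #|(set0 : {set T})| < kq by rewrite cards0 addn0.
have [r2 [c2 [[Ar2 Ac2 _ pr2 pc2] [Y [sY cY HY]]]]] :=
  exchange_gadget wfF latL cb al ri ci tL tb erefl px l1'.
have [y yY yV] : exists2 y, y \in Y & y \notin V.
  suff /set0Pn[y /setDP[]] : Y :\: V != set0 by exists y.
  rewrite -card_gt0 cardsD subn_gt0; apply: leq_ltn_trans (subset_leq_card (subsetIr _ _)) _.
  by move: l2 cY; clear; lia.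
have [L1 X] := HY y yY.
move/subsetP: sY => /(_ _ yY); rewrite in_set => /andP[yA /andP[py yx]].
have r2i : r2 \in core F by move/subsetP: (al A0).1; apply.
have c2i : c2 \in core F by move/subsetP: (al A1).1; apply.
exists L1, y; split=> //; last by rewrite -pc2.
have yL : (r, c, y) \notin L by apply: contraNN yx => m; rewrite (plat_sym latL.1 m tL).
have [x1 x2 x3 x4 x5 x6 x7 x8 x9] := X.
split=> //.
- move=> t' q a tl' tl qP e; have := x5 _ _ _ tl' tl qP e.
  case: a e => /= -> e' /=; rewrite ?e'; split; rewrite ?e //; try by left.
  + right; split=> //; rewrite /tame /= r2i ci pr2 /=.
    by case: (boolP (x \in core F)) => // xi; rewrite px ?eqxx.
  + right; split=> //; rewrite /tame /= ri c2i pc2 /=.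
    by case: (boolP (x \in core F)) => // xi; rewrite px ?eqxx.
- exists (r, c, y); split=> // a q ne qP e.
  have := x5 _ _ _ x7 yL qP e.
  by case: a ne e => // _ _ [] ? e2; rewrite e2 eqxx in yx.
Qed.

Lemma exchange_along F k kq P L A W w t a0 (V : {set T}) : wf F k kq ->
  latin L -> clean_bound F P L W -> allowed F A w ->
  t \in L -> bad P t -> tame F t -> co (nxt a0) t \in core F -> co (nxt (nxt a0)) t \in core F ->
  3 * W + 4 * w < kq -> 6 * W + 5 * w + 1 + #|V| < k ->
  exists L' v, [/\ axis_exchange F P A L L' t a0 v, v \notin V &
    par F v != par F (co (nxt a0) t) (+) par F (co (nxt (nxt a0)) t)].
Proof.
move=> wfF latL cb al tL tb ok i1 i2 l1 l2.
(* One rotation carries the statement from axis [nxt (nxt a)] to a: rows are reached from symbols,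
   and columns from rows. *)
have state F' P' L' A' t' a : wf F' k kq -> latin L' -> clean_bound F' P' L' W -> allowed F' A' w ->
  t' \in L' -> bad P' t' -> tame F' t' -> co (nxt a) t' \in core F' -> co (nxt (nxt a)) t' \in core F' ->
  (forall F P L A t, wf F k kq -> latin L -> clean_bound F P L W -> allowed F A w ->
    t \in L -> bad P t -> tame F t -> co (nxt (nxt (nxt a))) t \in core F -> co (nxt a) t \in core F ->
    exists L' v, [/\ axis_exchange F P A L L' t (nxt (nxt a)) v, v \notin V &
      par F v != par F (co (nxt (nxt (nxt a))) t) (+) par F (co (nxt a) t)]) ->
  exists L'' v, [/\ axis_exchange F' P' A' L' L'' t' a v, v \notin V &
    par F' v != par F' (co (nxt a) t') (+) par F' (co (nxt (nxt a)) t')].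
  move=> w1 w2 w3 w4 w5 w6 w7 w8 w9 H.
  have [||||||||| L1 [v [g1 g2 g3]]] := H (turnF F') (turnS P') (turnS L') (fun a => A' (nxt a)) (turn t').
  - exact: wf_turn.
  - exact: latin_turn.
  - exact: clean_turn.
  - exact: allowed_turn.
  - by rewrite mem_turnS.
  - by rewrite bad_turn.
  - by rewrite tame_turn.
  - by rewrite co_turn nxt3.
  - by rewrite co_turn.
  exists (turnS (turnS L1)), v; split=> //.
    by rewrite -[a in axis_exchange _ _ _ _ _ _ a](nxt3 a); apply: axis_exchange_turn.
  by move: g3; rewrite !co_turn !nxt3 /=.
have base : forall F P L A t, wf F k kq -> latin L -> clean_bound F P L W -> allowed F A w ->
    t \in L -> bad P t -> tame F t -> co A0 t \in core F -> co A1 t \in core F ->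
    exists L' v, [/\ axis_exchange F P A L L' t A2 v, v \notin V &
      par F v != par F (co A0 t) (+) par F (co A1 t)].
  by move=> *; apply: exchange_along_symbol; eassumption.
case: a0 i1 i2 => i1 i2; last by apply: base.
  by apply: (state) => // *; apply: base.
apply: (state) => // *.
by apply: (state) => // *; apply: base.
Qed.

End Rotation.

(** * Insertion of one triple *)

Section Insert.

Variable T : finType.
Implicit Types (t q p : T * T * T) (L P : {set T * T * T}) (F : frame T) (A : axis -> {set T}).

Lemma clean_step F P L L' W n :
  clean_bound F P L W -> #|L :\: L'| <= n -> clean_bound F P L' (W + n).
Proof.
move=> cb le a v.
have sub : [set t in ref F | (co a t == v) && ~~ fresh P L' t] \subset
   [set t in ref F | (co a t == v) && ~~ fresh P L t] :|: (L :\: L').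
  apply/subsetP => t; rewrite in_setU !in_set => /and3P[-> -> nf] /=.
  move: nf; rewrite /fresh; case: (t \in L); case: (t \in L') => //=.
    by move=> ->.
  by rewrite orbT.
apply: leq_trans (subset_leq_card sub) _; apply: leq_trans (leq_card_setU _ _) _.
exact: leq_add.
Qed.

Lemma allowed_rem F A w a0 v : allowed F A w ->
  allowed F (fun a => if a is A0 then if a0 is A0 then A a :\ v else A a
             else if a is A1 then if a0 is A1 then A a :\ v else A a
             else if a0 is A2 then A a :\ v else A a) w.+1.
Proof.
move=> al a.
have H : forall S : {set T}, S \subset core F /\ #|core F :\: S| <= w ->
   S \subset core F /\ #|core F :\: S| <= w.+1 by move=> S [? /leqW].
have K : forall S : {set T}, S \subset core F /\ #|core F :\: S| <= w ->
   S :\ v \subset core F /\ #|core F :\: (S :\ v)| <= w.+1.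
  move=> S [s1 s2]; split; first by apply: subset_trans s1; apply: subsetDl.
  apply: leq_trans (_ : #|(core F :\: S) :|: [set v]| <= _).
    apply: subset_leq_card; apply/subsetP => z; rewrite !inE.
    by case: (z == _) (z \in S) (z \in core F) => [] [] [].
  by apply: leq_trans (leq_card_setU _ _) _; rewrite cards1 addn1 ltnS.
by case: a; case: a0; [apply: K|apply: H|apply: H|apply: H|apply: K|apply: H|apply: H|apply: H|apply: K]; exact: al.
Qed.

Variables (F : frame T) (k kq : nat) (P : {set T * T * T}).
Hypothesis wfF : wf F k kq.

(** The symbol s is moved in row r to a column ch and in column c to a row rh, both of wrong parity;
    the errors cancel, so cell (rh, ch) has the parity sum of (r, c) and [finish] applies. The price
    is 10 + 10 + 16 = 36. As 20 triples are exchanged before [finish], W becomes [W + 20] there,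
    whence 64 = 3 * 20 + 4 and 186 = 9 * 20 + 6. *)
Lemma insert_core L A W w p :
  latin L -> clean_bound F P L W -> allowed F A w -> p \in P -> p \notin L ->
  (forall a, co a p \in core F) ->
  (forall t, t \in L -> share2 p t -> tame F t) ->
  3 * W + 4 * w + 64 < kq -> 9 * W + 7 * w + 186 < k ->
  exists L', insertion F P A L L' p.
Proof.
case: p => [[r c] s] latL cb al pP pL pc ok lq lk.
have ri : r \in core F := pc A0.
have ci : c \in core F := pc A1.
have si : s \in core F := pc A2.
have plL := latL.1.
have [[[r1 c1] x] t1L] := latL.2 A2 (r, c); rewrite /op /= => -[e1 e2]; subst r1 c1.
have [[[r1 c'] s1] t2L] := latL.2 A1 (s, r); rewrite /op /= => -[e1 e2]; subst r1 s1.
have [[[r' c1] s1] t3L] := latL.2 A0 (c, s); rewrite /op /= => -[e1 e2]; subst c1 s1.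
have sh1 : share2 (r, c, s) (r, c, x) by rewrite /share2 /op /= !eqxx !orbT.
have sh2 : share2 (r, c, s) (r, c', s) by rewrite /share2 /op /= !eqxx !orbT.
have sh3 : share2 (r, c, s) (r', c, s) by rewrite /share2 /op /= !eqxx.
have pb t : share2 (r, c, s) t -> bad P t.
  by move=> sh; apply/existsP; exists (r, c, s); rewrite pP.
have ok1 := ok _ t1L sh1; have ok2 := ok _ t2L sh2; have ok3 := ok _ t3L sh3.
have xs : x != s by apply: contraNneq pL => <-.
have cc' : c != c' by apply: contraNneq pL => ->.
have rr' : r != r' by apply: contraNneq pL => ->.
have l1 : 3 * W + 4 * w < kq by apply: leq_ltn_trans lq; apply: leq_addr.
have l2 : 6 * W + 5 * w + 1 + #|(set0 : {set T})| < k by rewrite cards0; move: lk; clear; lia.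
have [L1 [ch [g1 _ p1]]] :=
  exchange_along (a0 := A1) wfF latL cb al t2L (pb _ sh2) ok2 si ri l1 l2.
have {}p1 : par F ch != par F s (+) par F r by [].
have [lat1 cd1 li1 old1 new1 cnt1 all1 [[[r1 c1] s1] [m1 o1 c1E fr1]]] := g1.
move: o1 c1E; rewrite /op /= => -[? ?] ?; subst r1 s1 c1.
have chi : ch \in core F by move/subsetP: (al A1).1; apply.
have cb1 : clean_bound F P L1 (W + 10) := clean_step cb cd1.
have t1L1 : (r, c, x) \in L1.
  apply/negPn/negP => n; have [] := old1 _ t1L n (pb _ sh1).
  by move=> e _; rewrite e eqxx in cc'.
have t3L1 : (r', c, s) \in L1.
  apply/negPn/negP => n; have [] := old1 _ t3L n (pb _ sh3).
  by move=> e; rewrite e eqxx in rr'.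
have pL1 : (r, c, s) \notin L1.
  by apply: contra xs => m; rewrite (plat_sym lat1.1 t1L1 m).
have cch : c != ch by apply: contraNneq pL1 => ->.
(* Column ch is frozen so that the triple of cell (rh, ch) survives the second exchange. *)
pose A' a := match a with A1 => A A1 :\ ch | _ => A a end.
have al' : allowed F A' w.+1.
  by move=> a; have := allowed_rem A1 ch al a; case: a.
(* The rows excluded for rh: those whose reference triple in column ch is not fresh, has a forbidden
   symbol, or has symbol x. *)
pose V := [set v in core F | ~~ fresh P L1 (v, ch, eS F v ch)] :|:
          ([set v in core F | eS F v ch \notin A A2] :|: [set eR F ch x]).
have cV : #|V| <= W + 10 + (w + 1).
  apply: leq_trans (leq_card_setU _ _) _; apply: leq_add.
    apply: (curve_count (a := A1) (v := ch) cb1) => // [v v' _ _ []|v vi] //.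
    by apply: (mem_eS wfF).
  apply: leq_trans (leq_card_setU _ _) _; rewrite cards1 leq_add2r.
  apply: (line_count _ al) => [v v' vi vi'|v vi]; first exact: (inj_eS' wfF chi).
  by apply: (wfS wfF).
have l3 : 3 * (W + 10) + 4 * w.+1 < kq by move: lq; clear; lia.
have l4 : 6 * (W + 10) + 5 * w.+1 + 1 + #|V| < k by move: lk cV; clear; lia.
have [L2 [rh [g2 rhV p2]]] :=
  exchange_along (a0 := A0) wfF lat1 cb1 al' t3L1 (pb _ sh3) ok3 ci si l3 l4.
have {}p2 : par F rh != par F c (+) par F s by [].
have [lat2 cd2 li2 old2 new2 cnt2 all2 [[[r1 c1] s1] [m2 o2 c2E fr2]]] := g2.
move: o2 c2E; rewrite /op /= => -[? ?] ?; subst r1 s1 c1.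
have rhi : rh \in core F by move/subsetP: (al A0).1; apply.
have cb2 : clean_bound F P L2 (W + 20).
  by have := clean_step cb1 cd2; rewrite -addnA.
have k1 : (r, c, x) \in L2.
  apply/negPn/negP => n; have [] := old2 _ t1L1 n (pb _ sh1).
  by move=> e; rewrite e eqxx in rr'.
have sh4 : share2 (r, c, s) (r, ch, s) by rewrite /share2 /op /= !eqxx !orbT.
have k2 : (r, ch, s) \in L2.
  apply/negPn/negP => n; have [] := old2 _ m1 n (pb _ sh4).
  by move=> e; rewrite e eqxx in rr'.
move: rhV; rewrite in_setU negb_or (sel _ rhi) negbK => /andP[fu].
rewrite in_setU negb_or (sel _ rhi) negbK in_set1 => /andP[Au nx].
have ux : eS F rh ch != x.
  apply: contra nx => /eqP e; rewrite eq_sym -e (wfSR wfF) // (wfS wfF) //.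
have fu2 : fresh P L2 (rh, ch, eS F rh ch).
  case/andP: fu => m nb; rewrite /fresh nb andbT; apply/negPn/negP => n.
  have := li2 (rh, ch, eS F rh ch); rewrite m (negbTE n) => /(_ isT A1) [] /=.
    by rewrite in_setD1 eqxx.
  by move=> e; rewrite e eqxx in cch.
have pp : par F rh (+) par F ch = par F r (+) par F c.
  move: p1 p2; case: (par F rh); case: (par F ch); case: (par F r); case: (par F c);
  by case: (par F s).
have px : x \in core F -> par F r (+) par F c = par F x.
  by move=> xi; move: ok1; rewrite /tame /= ri ci xi /= orbF => /eqP.
have l5 : 3 * (W + 20) + 4 * w + 4 < kq by move: lq; clear; lia.
have l6 : 9 * (W + 20) + 7 * w + 6 < k by move: lk; clear; lia.
have n1 q : q \in P -> op A2 q <> (r, ch) by move=> qP; apply: (fr1 A2).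
have n2 q : q \in P -> op A0 q <> (ch, s) by move=> qP; apply: (fr1 A0).
have n3 q : q \in P -> op A2 q <> (rh, c) by move=> qP; apply: (fr2 A2).
have n4 q : q \in P -> op A1 q = (s, rh) -> s \notin core F.
  by move=> qP e; have [] : op A1 q <> op A1 (rh, c, s) by apply: fr2.
have [L3 [lat3 mp cd3 li3 old3 new3 cnt32 cnt30]] :=
  finish wfF lat2 cb2 al pP ri ci k1 xs px k2 m2 rhi all1 pp fu2 Au ux n1 n2 n3 n4 l5 l6.
exists L3.
have subA a v : v \in A' a -> v \in A a by case: a => //=; rewrite in_setD1 => /andP[].
have stepD u : (u \in L) != (u \in L3) ->
    [\/ (u \in L) != (u \in L1), (u \in L1) != (u \in L2) | (u \in L2) != (u \in L3)].
  case: (u \in L) (u \in L1) (u \in L2) (u \in L3) => [] [] [] [] //= _;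
  by [apply: Or31|apply: Or32|apply: Or33].
have oldD u : u \in L -> u \notin L3 -> [\/ u \notin L1, u \in L1 /\ u \notin L2 | u \in L2].
  by case: (u \in L1) (u \in L2) => [] [] //= _ _; [apply: Or33|apply: Or32|apply: Or31|apply: Or31].
split=> //.
- have sub : L :\: L3 \subset (L :\: L1) :|: ((L1 :\: L2) :|: (L2 :\: L3)).
    apply/subsetP => u; rewrite !in_setU !in_setD.
    by case: (u \in L) (u \in L1) (u \in L2) (u \in L3) => [] [] [] [].
  apply: leq_trans (subset_leq_card sub) _; apply: leq_trans (leq_card_setU _ _) _.
  apply: leq_trans (leq_add cd1 (leq_card_setU _ _)) _.
  by apply: leq_trans (leq_add (leqnn 10) (leq_add cd2 cd3)) _.
- move=> u d a t tL e.
  have -> : co a t = match a with A0 => r' | A1 => c' | A2 => x end.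
    case: a e => e.
    + by rewrite (plL A0 _ _ tL t3L e).
    + by rewrite (plL A1 _ _ tL t2L e).
    + by rewrite (plL A2 _ _ tL t1L e).
  case: (stepD u d) => d'.
  + case: (li1 u d' a) => [|->]; first by apply: Or31.
    by case: (a) => /=; [apply: Or32|apply: Or33|apply: Or32].
  + case: (li2 u d' a) => [/subA|->]; first by apply: Or31.
    by case: (a) => /=; [apply: Or33|apply: Or32|apply: Or32].
  + case: (li3 u d') => /or3P h0 /or3P h1 /or3P h2; case: (a) => /=.
    * by case: h0 => [?|/eqP ?|/eqP ->]; [apply: Or31|apply: Or32|apply: Or31].
    * by case: h1 => [?|/eqP ?|/eqP ->]; [apply: Or31|apply: Or32|apply: Or31].
    * by case: h2 => [?|/eqP ?|/eqP ->]; [apply: Or31|apply: Or32|apply: Or33].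
- move=> u uL u3 ub; case: (oldD u uL u3) => [n|[i n]|i].
  + by rewrite (old1 u uL n ub).
  + by rewrite (old2 u i n ub).
  + exact: old3 ub.
- move=> u q a u3 uL qP e.
  have fin : op a q = op a (r, c, s) -> u = (r, c, s).
    by move=> e'; apply: (lat3.1 a) => //; rewrite -e -e'.
  case: (boolP (u \in L1)) => u1.
    have [e' []] := new1 u q a u1 uL qP e; last by right.
    by move=> ea; left; apply: fin; rewrite e' ea.
  case: (boolP (u \in L2)) => u2.
    have [e' []] := new2 u q a u2 u1 qP e; last by case=> /subA ? ?; right.
    by move=> ea; left; apply: fin; rewrite e' ea.
  exact: new3 u q a u3 u2 qP e.
- move=> a t tL e; case: a e => e.
  + rewrite (plL A0 _ _ tL t3L e) /= => nA.
    apply: leq_trans (cnt2 A0); apply: subset_leq_card; apply/subsetP => u.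
    rewrite !in_set => /andP[/andP[u3 uL] /eqP ue]; rewrite /= ue eqxx andbT.
    case: (oldD u uL u3) => [n|[-> ->] //|i].
      have := li1 u; rewrite uL (negbTE n) => /(_ isT A0) [] /=; rewrite ue ?(negbTE nA) //.
      by move=> e'; rewrite e' eqxx in rr'.
    have := li3 u; rewrite i (negbTE u3) => /(_ isT) [] /or3P h _ _; exfalso; move: h; rewrite ue /=.
    by case=> [h|/eqP h|/eqP h]; [rewrite h in nA|rewrite h eqxx in rr'|rewrite h all2 in nA].
  + rewrite (plL A1 _ _ tL t2L e) /= => nA.
    apply: leq_trans (cnt1 A1); apply: subset_leq_card; apply/subsetP => u.
    rewrite !in_set => /andP[/andP[u3 uL] /eqP ue]; rewrite /= ue eqxx andbT.
    case: (oldD u uL u3) => [n|[i n]|i]; first by rewrite n uL.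
      have := li2 u; rewrite i (negbTE n) => /(_ isT A1) [/subA|] /=; rewrite ue ?(negbTE nA) //.
      by move=> e'; rewrite e' eqxx in cc'.
    have := li3 u; rewrite i (negbTE u3) => /(_ isT) [] _ /or3P h _; exfalso; move: h; rewrite ue /=.
    by case=> [h|/eqP h|/eqP h]; [rewrite h in nA|rewrite h eqxx in cc'|rewrite h all1 in nA].
  + rewrite (plL A2 _ _ tL t1L e) /= => nA.
    apply: leq_trans cnt32; apply: subset_leq_card; apply/subsetP => u.
    rewrite !in_set => /andP[/andP[u3 uL] /eqP ue]; rewrite /= ue eqxx andbT u3 /=.
    case: (oldD u uL u3) => [n|[i n]|i //].
      have := li1 u; rewrite uL (negbTE n) => /(_ isT A2) [] /=; rewrite ue ?(negbTE nA) //.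
      by move=> e'; rewrite e' eqxx in xs.
    have := li2 u; rewrite i (negbTE n) => /(_ isT A2) [/subA|] /=; rewrite ue ?(negbTE nA) //.
    by move=> e'; rewrite e' eqxx in xs.
Qed.

End Insert.

(** * Insertion of a triple with one label outside the core *)

Section Special.

Variable T : finType.
Implicit Types (t q p : T * T * T) (L P : {set T * T * T}) (F : frame T) (A : axis -> {set T}).

(** A symbol s outside the core rules out [exchange_along] for the pairs containing s. Instead the
    gadget is applied to (r, c', s), and its by-product (r, c2, s) plays the part of (r, ch, s) in
    [finish], while (r', c, s) is used as it stands. The hypothesis that P has no pair completed in
    L by an outside label at a triple covering p makes the cells (r, c') and (r', c) free for P. *)
Lemma insert_special2 F k kq P L A W w p : wf F k kq -> plat P ->
  latin L -> clean_bound F P L W -> allowed F A w -> p \in P -> p \notin L ->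
  co A0 p \in core F -> co A1 p \in core F -> co A2 p \notin core F ->
  (forall t, t \in L -> share2 p t -> tame F t) ->
  (forall q t a, q \in P -> t \in L -> share2 p t -> co a t \notin core F -> op a q <> op a t) ->
  4 * W + 5 * w + 64 < kq -> 9 * W + 7 * w + 186 < k ->
  exists L', insertion F P A L L' p.
Proof.
case: p => [[r c] s] wfF platP latL cb al pP pL ri ci si ok own lq lk.
rewrite /= in ri ci si.
have plL := latL.1.
have [[[r1 c1] x] t1L] := latL.2 A2 (r, c); rewrite /op /= => -[e1 e2]; subst r1 c1.
have [[[r1 c'] s1] t2L] := latL.2 A1 (s, r); rewrite /op /= => -[e1 e2]; subst r1 s1.
have [[[r' c1] s1] t3L] := latL.2 A0 (c, s); rewrite /op /= => -[e1 e2]; subst c1 s1.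
have sh1 : share2 (r, c, s) (r, c, x) by rewrite /share2 /op /= !eqxx !orbT.
have sh2 : share2 (r, c, s) (r, c', s) by rewrite /share2 /op /= !eqxx !orbT.
have sh3 : share2 (r, c, s) (r', c, s) by rewrite /share2 /op /= !eqxx.
have pb t : share2 (r, c, s) t -> bad P t.
  by move=> sh; apply/existsP; exists (r, c, s); rewrite pP.
have ok1 := ok _ t1L sh1; have ok2 := ok _ t2L sh2; have ok3 := ok _ t3L sh3.
have c'i : c' \in core F.
  by move: ok2; rewrite /tame /= ri (negbTE si) !andbF /=; case: (c' \in core F).
have r'i : r' \in core F.
  by move: ok3; rewrite /tame /= ci (negbTE si) !andbF /=; case: (r' \in core F).
have xs : x != s by apply: contraNneq pL => <-.
have cc' : c != c' by apply: contraNneq pL => ->.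
have rr' : r != r' by apply: contraNneq pL => ->.
pose A' a := match a with A0 => A A0 :\ r' | _ => A a end.
have al' : allowed F A' w.+1.
  by move=> a; have := allowed_rem A0 r' al a; case: a.
have subA a v : v \in A' a -> v \in A a by case: a => //=; rewrite in_setD1 => /andP[].
pose Cx := [set v in core F | ~~ fresh P L (r', v, eS F r' v)] :|:
          ([set v in core F | eS F r' v \notin A A2] :|: [set eC F r' x]).
have cC : #|Cx| <= W + (w + 1).
  apply: leq_trans (leq_card_setU _ _) _; apply: leq_add.
    apply: (curve_count (a := A0) (v := r') cb) => // [v v' _ _ []|v vi] //.
    by apply: (mem_eS wfF).
  apply: leq_trans (leq_card_setU _ _) _; rewrite cards1 leq_add2r.
  apply: (line_count _ al) => [v v' vi vi'|v vi]; first exact: (inj_eS wfF r'i).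
  by apply: (wfS wfF).
(* The parity of c2 is prescribed so that (r', c2) has the parity sum of (r, c); since s has no
   parity, b1 is then free to satisfy the equation of the gadget. *)
pose b2 := par F r (+) par F c (+) par F r'.
pose b1 := par F r (+) par F c' (+) b2.
have bb : b1 (+) b2 = par F r (+) par F c' by rewrite /b1 -addbA addbb addbF.
have bx : s \in core F -> b1 (+) b2 = par F s by rewrite (negbTE si).
have l1 : 3 * W + 4 * w.+1 + #|Cx| < kq by move: lq cC; clear; lia.
have [r2 [c2 [[Ar2 Ac2 nC pr2 pc2] [Y [sY cY HY]]]]] :=
  exchange_gadget wfF latL cb al' ri c'i t2L (pb _ sh2) bb bx l1.
have r2i : r2 \in core F by move/subsetP: (al A0).1; apply; exact: subA Ar2.
have c2i : c2 \in core F by move/subsetP: (al A1).1; apply.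
have [y yY] : exists y, y \in Y.
  by apply/set0Pn; rewrite -card_gt0; move: cY lk; clear; lia.
move/subsetP: sY => /(_ _ yY); rewrite in_set => /andP[yA /andP[py yx]].
have [L1 [lat1 cd1 li1 old1 new1 cnt1 x7 x8 x9]] := HY y yY.
rewrite /= in x7 x8 x9 new1.
have k1 : (r, c, x) \in L1.
  apply/negPn/negP => n; have := old1 _ t1L n (pb _ sh1).
  by case=> e _; rewrite e eqxx in cc'.
have k3 : (r', c, s) \in L1.
  apply/negPn/negP => n; have := old1 _ t3L n (pb _ sh3).
  by case=> e; rewrite e eqxx in rr'.
have n2 : (r, c', s) \notin L1.
  by apply: contra yx => m; rewrite (plat_sym lat1.1 x7 m).
have c2c' : c2 != c' by apply: contraNneq n2 => <-.
have nm : (r, c2, s) \notin L by apply: contra c2c' => m; rewrite (plat_row plL m t2L).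
have ys : y != s by [].
move: nC; rewrite in_setU negb_or (sel _ c2i) negbK => /andP[fu].
rewrite in_setU negb_or (sel _ c2i) negbK in_set1 => /andP[Au nx].
have ux : eS F r' c2 != x.
  by apply: contra nx => /eqP e; rewrite eq_sym -e (wfSC wfF) // (wfS wfF).
have fu2 : fresh P L1 (r', c2, eS F r' c2).
  case/andP: fu => m nb; rewrite /fresh nb andbT; apply/negPn/negP => n.
  have := li1 (r', c2, eS F r' c2); rewrite m (negbTE n) => /(_ isT A0) [] /=.
    by rewrite in_setD1 eqxx.
  by move=> e; rewrite e eqxx in rr'.
have pp : par F r' (+) par F c2 = par F r (+) par F c.
  by rewrite pc2 /b2; case: (par F r'); case: (par F r); case: (par F c).
have px : x \in core F -> par F r (+) par F c = par F x.
  by move=> xi; move: ok1; rewrite /tame /= ri ci xi /= orbF => /eqP.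
have cb1 : clean_bound F P L1 (W + 10) := clean_step cb cd1.
have m1 q : q \in P -> op A2 q <> (r, c2).
  move=> qP e; have [_ e'] : (r, c2, s) = (r, c', y) by apply: (new1 _ q A2).
  by rewrite e' eqxx in ys.
have m2 q : q \in P -> op A0 q <> (c2, s).
  move=> qP e; have [_ e'] : (r, c2, s) = (r2, c', s) by apply: (new1 _ q A0).
  by rewrite e' eqxx in c2c'.
have m3 q : q \in P -> op A2 q <> (r', c).
  by move=> qP; apply: (own q (r', c, s) A2).
have m4 q : q \in P -> op A1 q = (s, r') -> s \notin core F by [].
have l5 : 3 * (W + 10) + 4 * w + 4 < kq by move: lq; clear; lia.
have l6 : 9 * (W + 10) + 7 * w + 6 < k by move: lk; clear; lia.
have [L3 [lat3 mp cd3 li3 old3 new3 cnt32 cnt30]] :=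
  finish wfF lat1 cb1 al pP ri ci k1 xs px x8 k3 r'i Ac2 pp fu2 Au ux m1 m2 m3 m4 l5 l6.
exists L3.
have stepD u : (u \in L) != (u \in L3) ->
    (u \in L) != (u \in L1) \/ (u \in L1) != (u \in L3).
  by case: (u \in L) (u \in L1) (u \in L3) => [] [] [] //= _; [right|left|left|right].
split=> //.
- have sub : L :\: L3 \subset (L :\: L1) :|: (L1 :\: L3).
    apply/subsetP => u; rewrite !in_setU !in_setD.
    by case: (u \in L) (u \in L1) (u \in L3) => [] [] [].
  apply: leq_trans (subset_leq_card sub) _; apply: leq_trans (leq_card_setU _ _) _.
  by apply: leq_trans (leq_add cd1 cd3) _.
- move=> u d a t tL e.
  have -> : co a t = match a with A0 => r' | A1 => c' | A2 => x end.
    case: a e => e.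
    + by rewrite (plL A0 _ _ tL t3L e).
    + by rewrite (plL A1 _ _ tL t2L e).
    + by rewrite (plL A2 _ _ tL t1L e).
  case: (stepD u d) => d'.
  + case: (li1 u d' a) => [/subA|->]; first by apply: Or31.
    by case: (a) => /=; [apply: Or32|apply: Or33|apply: Or32].
  + case: (li3 u d') => /or3P h0 /or3P h1 /or3P h2; case: (a) => /=.
    * by case: h0 => [?|/eqP ?|/eqP ->]; [apply: Or31|apply: Or32|apply: Or33].
    * by case: h1 => [?|/eqP ?|/eqP ->]; [apply: Or31|apply: Or32|apply: Or31].
    * by case: h2 => [?|/eqP ?|/eqP ->]; [apply: Or31|apply: Or32|apply: Or33].
- move=> u uL u3 ub; case: (boolP (u \in L1)) => u1; first exact: old3 ub.
  by rewrite (old1 u uL u1 ub).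
- move=> u q a u3 uL qP e.
  case: (boolP (u \in L1)) => u1; last exact: new3 u q a u3 u1 qP e.
  have := new1 u q a u1 uL qP e; case: a e => e e'.
  + right; rewrite e' /=; split; first exact: subA Ar2.
    by rewrite /tame /= r2i c'i (negbTE si).
  + left; apply: (lat3.1 A1) => //; by rewrite e'.
  + exfalso; apply: (own q (r, c', s) A2) => //; by rewrite e e'.
- move=> a t tL e; case: a e => e.
  + rewrite (plL A0 _ _ tL t3L e) /= => nA.
    apply: leq_trans (cnt30 nA); apply: subset_leq_card; apply/subsetP => u.
    rewrite !in_set => /andP[/andP[u3 uL] /eqP ue]; rewrite /= ue eqxx andbT u3 /=.
    apply/negPn/negP => n.
    have := li1 u; rewrite uL (negbTE n) => /(_ isT A0) [/subA|] /=; rewrite ue ?(negbTE nA) //.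
    by move=> e'; rewrite e' eqxx in rr'.
  + rewrite (plL A1 _ _ tL t2L e) /= => nA.
    apply: leq_trans (cnt1 A1); apply: subset_leq_card; apply/subsetP => u.
    rewrite !in_set => /andP[/andP[u3 uL] /eqP ue]; rewrite /= ue eqxx andbT uL andbT.
    apply/negP => i.
    have := li3 u; rewrite i (negbTE u3) => /(_ isT) [] _ /or3P h _; move: h; rewrite ue /=.
    by case=> [h|/eqP h|/eqP h]; [rewrite h in nA|rewrite h eqxx in cc'|rewrite h Ac2 in nA].
  + rewrite (plL A2 _ _ tL t1L e) /= => nA.
    apply: leq_trans cnt32; apply: subset_leq_card; apply/subsetP => u.
    rewrite !in_set => /andP[/andP[u3 uL] /eqP ue]; rewrite /= ue eqxx andbT u3 /=.
    apply/negPn/negP => n.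
    have := li1 u; rewrite uL (negbTE n) => /(_ isT A2) [/subA|] /=; rewrite ue ?(negbTE nA) //.
    by move=> e'; rewrite e' eqxx in xs.
Qed.

Lemma ins_turn F P A L M p :
  insertion (turnF F) (turnS P) (fun a => A (nxt a)) (turnS L) M (turn p) ->
  insertion F P A L (turnS (turnS M)) p.
Proof.
case=> g1 g2 g3 g4 g5 g6 g7.
have mM : M = turnS (turnS (turnS M)) by rewrite turnS3.
have mt u : (u \in turnS (turnS M)) = (turn u \in M) by exact: mem_turnS2.
split=> //.
- by do 2!apply: latin_turn.
- by rewrite mt.
- rewrite -card_turnS; apply: leq_trans (subset_leq_card _) g3; apply/subsetP => t'.
  by case: (turnP t') => u ->; rewrite mem_turnS !in_setD mt mem_turnS.
- move=> t'; rewrite mt -(mem_turnS L) => d a t; rewrite -(mem_turnS L) => tL e.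
  have := g4 _ d (nxt (nxt a)) (turn t) tL; rewrite !op_turn !co_turn !nxt3; exact.
- move=> t'; rewrite mt -(mem_turnS L) -bad_turn -share2_turn; exact: g5.
- move=> t' q a; rewrite mt -(mem_turnS L) -(mem_turnS P) => i1 i2 i3.
  rewrite (op_turn2 a q) (op_turn2 a t') => e.
  case: (g6 _ _ _ i1 i2 i3 e) => [/(can_inj (@turnK T))|]; first by left.
  by rewrite tame_turn co_turn nxt3; right.
- move=> a t tL; rewrite (op_turn2 a t) (op_turn2 a p) (co_turn2 a t) => e nA.
  have := g7 (nxt (nxt a)) (turn t); rewrite mem_turnS => /(_ tL e).
  rewrite nxt3 => /(_ nA); rewrite {1}mM turnSP; apply: leq_trans.
  by apply: subset_leq_card; apply/subsetP => u; rewrite !in_set !co_turn !nxt3.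
Qed.

Lemma insert_special F k kq P L A W w p a0 : wf F k kq -> plat P ->
  latin L -> clean_bound F P L W -> allowed F A w -> p \in P -> p \notin L ->
  co (nxt a0) p \in core F -> co (nxt (nxt a0)) p \in core F -> co a0 p \notin core F ->
  (forall t, t \in L -> share2 p t -> tame F t) ->
  (forall q t a, q \in P -> t \in L -> share2 p t -> co a t \notin core F -> op a q <> op a t) ->
  4 * W + 5 * w + 64 < kq -> 9 * W + 7 * w + 186 < k ->
  exists L', insertion F P A L L' p.
Proof.
have state F' P' L' A' p' a : wf F' k kq -> plat P' -> latin L' -> clean_bound F' P' L' W ->
  allowed F' A' w -> p' \in P' -> p' \notin L' ->
  co (nxt a) p' \in core F' -> co (nxt (nxt a)) p' \in core F' -> co a p' \notin core F' ->
  (forall t, t \in L' -> share2 p' t -> tame F' t) ->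
  (forall q t a, q \in P' -> t \in L' -> share2 p' t -> co a t \notin core F' -> op a q <> op a t) ->
  (forall F P L A p, wf F k kq -> plat P -> latin L -> clean_bound F P L W ->
    allowed F A w -> p \in P -> p \notin L ->
    co a p \in core F -> co (nxt a) p \in core F -> co (nxt (nxt a)) p \notin core F ->
    (forall t, t \in L -> share2 p t -> tame F t) ->
    (forall q t a, q \in P -> t \in L -> share2 p t -> co a t \notin core F -> op a q <> op a t) ->
    exists L', insertion F P A L L' p) ->
  exists L'', insertion F' P' A' L' L'' p'.
  move=> w1 w2 w3 w4 w5 w6 w7 w8 w9 w10 w11 w12 H.
  have [|||||||||||| M HM] := H (turnF F') (turnS P') (turnS L') (fun a => A' (nxt a)) (turn p').
  - exact: wf_turn.
  - exact: plat_turn.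
  - exact: latin_turn.
  - exact: clean_turn.
  - exact: allowed_turn.
  - by rewrite mem_turnS.
  - by rewrite mem_turnS.
  - by rewrite co_turn.
  - by rewrite co_turn.
  - by rewrite co_turn nxt3.
  - by move=> t; case: (turnP t) => u ->; rewrite mem_turnS share2_turn tame_turn; apply: w11.
  - move=> q t b; case: (turnP t) => u ->; case: (turnP q) => v ->.
    by rewrite !mem_turnS share2_turn co_turn !op_turn; apply: w12.
  exists (turnS (turnS M)); exact: ins_turn.
move=> wfF pP latL cb al i1 i2 c1 c2 c3 ok own l1 l2.
have base : forall F P L A p, wf F k kq -> plat P -> latin L -> clean_bound F P L W ->
    allowed F A w -> p \in P -> p \notin L ->
    co A0 p \in core F -> co A1 p \in core F -> co A2 p \notin core F ->
    (forall t, t \in L -> share2 p t -> tame F t) ->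
    (forall q t a, q \in P -> t \in L -> share2 p t -> co a t \notin core F -> op a q <> op a t) ->
    exists L', insertion F P A L L' p.
  by move=> *; apply: insert_special2; eassumption.
case: a0 c1 c2 c3 => c1 c2 c3; last by apply: base.
  by apply: (state _ _ _ _ _ A0) => // *; apply: base.
apply: (state _ _ _ _ _ A1) => // *.
by apply: (state _ _ _ _ _ A0) => // *; apply: base.
Qed.

End Special.

(** * Loads and iterated insertion *)

Lemma load_arith g b m Th : g + 3 * b <= Th -> g + (b + (m + m)) <= Th + 2 * m.
Proof. lia. Qed.

Lemma load_arith1 g b g' b' e m0 : b' <= b + 36 -> e <= 36 -> g' <= g + e ->
  g + 3 * b + 144 <= m0 -> g' + 3 * b' <= m0.
Proof. lia. Qed.

Lemma load_arith2 g b g' b' e m0 n0 n n' : b' <= b -> n < n' -> 36 <= n0 ->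
  g + 3 * b <= m0 + n0 * n -> e <= 36 -> g' <= g + e -> g' + 3 * b' <= m0 + n0 * n'.
Proof. nia. Qed.

Lemma load_arith3 g b g' b' e m0 n0 n n' : b' < b -> e <= 3 -> n <= n' ->
  g + 3 * b <= m0 + n0 * n -> g' <= g + e -> g' + 3 * b' <= m0 + n0 * n'.
Proof. nia. Qed.

Section Potential.

Variable T : finType.
Implicit Types (t q p : T * T * T) (L P : {set T * T * T}) (F : frame T) (A : axis -> {set T}).

Definition line P a v := [set q in P | co a q == v].
Definition gone F L a v := [set t in ref F :\: L | co a t == v].
Definition placed P L a v :=
  [set q in P :\: L | [exists t in L, (co a t == v) && (op a t == op a q)]].

(* Removed reference triples of a line, plus three for every unfulfilled triple
   of P one of whose pairs is currently placed on that line: inserting such a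
   triple removes at most three triples from the line. *)
Definition load F P L a v := #|gone F L a v| + 3 * #|placed P L a v|.

Lemma co_op_inj a t t' : co a t = co a t' -> op a t = op a t' -> t = t'.
Proof. by case: t t' => [[? ?] ?] [[? ?] ?]; case: a; rewrite /op /= => -> [-> ->]. Qed.

Lemma plat_eq P p q : plat P -> p \in P -> q \in P -> share2 p q -> p = q.
Proof. by move=> pl pP qP /share2P[a e]; apply: pl a _ _ pP qP e. Qed.

Lemma card_latin L : latin L -> #|L| = #|T| * #|T|.
Proof.
move=> [pl ex]; rewrite -card_prod -(card_in_imset (f := op A0) (D := mem L)); last first.
  by move=> t t' tL t'L; apply: pl.
apply: eq_card => u; rewrite inE; apply/imsetP.
by have [t tL e] := ex A0 u; exists t.
Qed.

Lemma card_exchanged L L' : latin L -> latin L' -> #|L' :\: L| = #|L :\: L'|.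
Proof.
move=> l l'; have := cardsID L' L; have := cardsID L L'.
by rewrite (card_latin l) (card_latin l') setIC => e1 e2; apply/eqP; rewrite -(eqn_add2l #|L :&: L'|) e1 e2.
Qed.

Section Loc.
Variables (P L : {set T * T * T}).
Hypothesis latL : latin L.

(** The triple of L on the pair [op a q]. The label [co a q] is not read, so q may carry a filler
    there; the default does not occur when L is Latin. *)
Definition loc a q := odflt q [pick t in L | op a t == op a q].

Lemma locP a q t : t \in L -> op a t = op a q -> loc a q = t.
Proof.
move=> tL e; rewrite /loc; case: pickP => [u /andP[uL /eqP e']|]; last first.
  by move/(_ t); rewrite tL e eqxx.
by apply: (latL.1 a) => //; rewrite e e'.
Qed.

Lemma mem_loc a q : loc a q \in L /\ op a (loc a q) = op a q.
Proof. by have [t tL e] := latL.2 a (op a q); rewrite (locP tL e). Qed.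

Lemma placedP a v q : (q \in placed P L a v) = [&& q \in P, q \notin L & co a (loc a q) == v].
Proof.
rewrite in_set in_setD; case: (q \in P); case: (q \in L); rewrite //= ?andbT.
have [lL le] := mem_loc a q.
apply/existsP/idP => [[t /and3P[tL c /eqP e]]|c].
  by rewrite (locP tL e).
by exists (loc a q); rewrite lL c le eqxx.
Qed.

Lemma sum_placed a : \sum_v #|placed P L a v| = #|P :\: L|.
Proof.
rewrite -sum1_card (partition_big (fun q => co a (loc a q)) predT) //=.
apply: eq_bigr => v _; rewrite -sum1_card; apply: eq_bigl => q.
by rewrite placedP in_setD; case: (q \in P); case: (q \in L).
Qed.

Lemma sum_gone F a : \sum_v #|gone F L a v| = #|ref F :\: L|.
Proof.
rewrite -[RHS]sum1_card (partition_big (fun q => co a q) predT) //=.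
by apply: eq_bigr => v _; rewrite -sum1_card; apply: eq_bigl => q; rewrite in_set.
Qed.

Lemma sum_load F a : \sum_v load F P L a v = #|ref F :\: L| + 3 * #|P :\: L|.
Proof. by rewrite big_split /= sum_gone -big_distrr /= sum_placed. Qed.

(** A reference triple of the line is lost for three reasons: it is gone; it covers the pair
    [op a q] of a pending q placed there; or it covers a pair containing v of a triple of P on the
    line. The last kind yields at most 2 * m triples, one for each of two axes. Fulfilled triples of
    P are themselves of the last kind. *)
Lemma load_clean F m Th : (forall a v, #|line P a v| <= m) ->
  (forall a v, load F P L a v <= Th) -> clean_bound F P L (Th + 2 * m).
Proof.
move=> lm lt a v.
have sub : [set t in ref F | (co a t == v) && ~~ fresh P L t] \subset
   gone F L a v :|: (loc a @: placed P L a v :|: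
    (loc (nxt a) @: line P a v :|: loc (nxt (nxt a)) @: line P a v)).
  apply/subsetP => t; rewrite in_set => /and3P[tr /eqP c nf].
  case: (boolP (t \in L)) => tL; last by rewrite in_setU in_set in_setD tr tL c eqxx.
  move: nf; rewrite /fresh tL negbK => /badP[q [b [qP e]]].
  have lb : loc b q = t by apply: locP.
  have qL : q \in L -> q = t by move=> qL; rewrite -lb; apply/esym/locP.
  have onl : co a q = v -> q \in line P a v by rewrite in_set qP => ->; rewrite eqxx.
  case: (boolP (q \in L)) => qi.
    rewrite !in_setU; apply/or4P; apply: Or43; apply/imsetP; exists q.
      by apply: onl; rewrite (qL qi).
    by rewrite (qL qi); apply/esym/locP.
  have [ab|nab] : b = a \/ a <> b by case: (a) (b) => [] []; (by left) || (by right).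
    subst b; rewrite !in_setU; apply/or4P; apply: Or42; apply/imsetP; exists q => //.
    by rewrite placedP qP qi lb c eqxx.
  have ql : q \in line P a v by apply: onl; rewrite (op_co (a := b) (b := a) _ e) // => e'; apply: nab.
  have [bb|bb] : b = nxt a \/ b = nxt (nxt a) by case: (a) (b) nab => [] [] //; (by left) || (by right).
    by subst b; rewrite !in_setU; apply/or4P; apply: Or43; apply/imsetP; exists q.
  by subst b; rewrite !in_setU; apply/or4P; apply: Or44; apply/imsetP; exists q.
have l0 := lt a v; rewrite /load in l0; have lm0 := lm a v.
apply: leq_trans (subset_leq_card sub) _; apply: leq_trans (leq_card_setU _ _) _.
apply: (@leq_trans (#|gone F L a v| + (#|placed P L a v| + (m + m)))).
  rewrite leq_add2l; apply: leq_trans (leq_card_setU _ _) _; apply: leq_add; first exact: leq_imset_card.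
  apply: leq_trans (leq_card_setU _ _) _.
  by apply: leq_add; apply: leq_trans (leq_imset_card _ _) _.
exact: load_arith l0.
Qed.

End Loc.

Lemma load_ins F P A L L' p m0 n0 : latin L -> plat P -> p \in P -> p \notin L ->
  insertion F P A L L' p -> (forall a v, v \in A a -> load F P L a v + 144 <= m0) ->
  (forall a v, load F P L a v <= m0 + n0 * #|line (P :&: L) a v|) -> 36 <= n0 ->
  forall a v, load F P L' a v <= m0 + n0 * #|line (P :&: L') a v|.
Proof.
move=> latL plP pP pL [lat' mp cd li old new cnt] hA hL hn a v.
have keep q : q \in P -> q \in L -> q \in L'.
  move=> qP qL; apply/negPn/negP => n; case/negP: pL.
  by rewrite (plat_eq plP pP qP (old q qL n (bad_self qP))).
have cdg b u : #|gone F L' b u| <= #|gone F L b u| + #|[set t in L :\: L' | co b t == u]|.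
  apply: leq_trans (leq_card_setU _ _).1; apply: subset_leq_card; apply/subsetP => t.
  rewrite in_setU !in_set => /andP[/andP[-> ->] ->].
  by case: (t \in L).
have cd36 b u : #|[set t in L :\: L' | co b t == u]| <= 36.
  apply: leq_trans cd; apply: subset_leq_card; apply/subsetP => t.
  by rewrite in_set => /andP[].
have mono : #|line (P :&: L) a v| <= #|line (P :&: L') a v|.
  apply: subset_leq_card; apply/subsetP => q; rewrite !in_set => /andP[/andP[qP qL] ->].
  by rewrite qP keep.
(* Allowed line: at most 36 triples go and at most 36 pending triples come, so the reserve 144 = 36
   + 3 * 36 suffices. *)
case: (boolP (v \in A a)) => vA.
  apply: leq_trans (leq_addr _ _); apply: leq_trans (hA _ _ vA); rewrite /load.
  have pl : #|placed P L' a v| <= #|placed P L a v| + 36.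
    have sub : placed P L' a v \subset placed P L a v :|: [set q in P :\: L' | loc L' a q \notin L].
      apply/subsetP => q; rewrite in_setU (placedP _ lat') (placedP _ latL) => /and3P[qP qn /eqP c].
      have qL : q \notin L by apply: contra qn; apply: keep.
      rewrite in_set in_setD qP qn qL /=; case: (boolP (_ \in L)) => lL; last by rewrite orbT.
      have [_ e] := mem_loc lat' a q.
      by rewrite (locP latL lL e) c eqxx.
    apply: leq_trans (subset_leq_card sub) _; apply: leq_trans (leq_card_setU _ _) _.
    rewrite leq_add2l; apply: leq_trans cd; rewrite -(card_exchanged latL lat').
    rewrite -(card_in_imset (f := loc L' a)); last first.
      move=> q q'; rewrite !in_set => /andP[/andP[_ qP] _] /andP[/andP[_ qP'] _] e.
      have [_ e1] := mem_loc lat' a q; have [_ e2] := mem_loc lat' a q'.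
      by apply: (plP a) => //; rewrite -e1 -e2 e.
    apply: subset_leq_card; apply/subsetP => _ /imsetP[q + ->]; rewrite !in_set => /andP[_ ->].
    by have [] := mem_loc lat' a q.
  exact: load_arith1 pl (cd36 a v) (cdg a v) (leqnn _).
have pls : placed P L' a v \subset placed P L a v.
  apply/subsetP => q; rewrite (placedP _ lat') (placedP _ latL) => /and3P[qP qn /eqP c].
  have qL : q \notin L by apply: contra qn; apply: keep.
  rewrite qP qL /=; have [lm e] := mem_loc lat' a q.
  case: (boolP (loc L' a q \in L)) => lL; first by rewrite (locP latL lL e) c.
  case: (new (loc L' a q) q a lm lL qP (esym e)) => [e'|[+ _]]; last by rewrite c (negbTE vA).
  move: e; rewrite e' => e; case/negP: qn.
  by rewrite -(plP a _ _ pP qP e).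
have plc := subset_leq_card pls.
(* Line of p: up to 36 triples go, paid by p, which is now fulfilled on this line. *)
case: (v =P co a p) => [vp|vp].
  have lt : #|line (P :&: L) a v| < #|line (P :&: L') a v|.
    rewrite (cardsD1 p (line (P :&: L') a v)) !in_set pP mp vp eqxx /= add1n ltnS.
    apply: subset_leq_card; apply/subsetP => q; rewrite in_setD1 !in_set => /andP[/andP[qP qL] ->].
    rewrite qP keep // !andbT; by apply: contraNneq pL => <-.
  exact: load_arith2 plc lt hn (hL a v) (cd36 a v) (cdg a v).
have [t tL te] := latL.2 a (op a p).
have fin g b g' b' n n' : g' <= g -> b' <= b -> n <= n' -> g + 3 * b <= m0 + n0 * n ->
    g' + 3 * b' <= m0 + n0 * n'.
  move=> h1 h2 h3 h4; apply: leq_trans (leq_trans _ h4) _.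
    by apply: leq_add => //; rewrite leq_mul2l h2 orbT.
  by rewrite leq_add2l leq_mul2l h3 orbT.
(* Line where a pair of p was placed: at most three triples go, and p, of weight three, stops being
   pending. *)
case: (v =P co a t) => [vt|vt].
  have lt : #|placed P L' a v| < #|placed P L a v|.
    rewrite (cardsD1 p (placed P L a v)) (placedP _ latL) pP pL (locP latL tL te) -vt eqxx /= add1n ltnS.
    apply: subset_leq_card; apply/subsetP => q qi; rewrite in_setD1 (subsetP pls _ qi) andbT.
    by apply: contraTneq qi => ->; rewrite (placedP _ lat') mp andbF.
  have := cnt a t tL te; rewrite -vt vA => /(_ isT) c3.
  exact: load_arith3 lt c3 mono (hL a v) (cdg a v).
apply: fin (hL a v) => //.
apply: subset_leq_card; apply/subsetP => u; rewrite !in_set => /andP[/andP[un ->] /eqP c].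
rewrite c eqxx !andbT; apply/negP => uL.
have := li u; rewrite uL (negbTE un) => /(_ isT a t tL te); rewrite c.
by case=> [h|h|h]; [rewrite h in vA|case: vp|case: vt].
Qed.

End Potential.

Lemma tot_arith g g' b b' d e D : g' <= g + d -> d <= e + 3 -> b' < b ->
  g + 3 * b <= D -> g' + 3 * b' <= D + e.
Proof. lia. Qed.

(** * The invariant of the insertions and their order *)

Section State.

Variable T : finType.
Implicit Types (t q p : T * T * T) (L P : {set T * T * T}).

Variables (F : frame T) (k kq m Th : nat) (P I : {set T * T * T}).
Hypothesis wfF : wf F k kq.
Hypothesis platP : plat P.
Hypothesis lineP : forall a v, #|line P a v| <= m.
Hypothesis subI : I \subset P.
Hypothesis coreI : forall q a, q \in I -> co a q \in core F.
Hypothesis one_special : #|~: core F| <= 1.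
Hypothesis specialP : forall q a, q \in P -> co a q \notin core F ->
  co (nxt a) q \in core F /\ co (nxt (nxt a)) q \in core F.

(** By [sum_load], [st_tot] bounds the sum of the loads over each axis; the number of exhausted
    lines is read off from it. [st_ok] provides the gadgets with tame triples, and [st_iso] lets the
    isolated triples be inserted last. *)
Record state D L : Prop := St {
  st_lat : latin L;
  st_load : forall a v, load F P L a v <= Th + 36 * #|line (P :&: L) a v|;
  st_tot : #|ref F :\: L| + 3 * #|P :\: L| <= D;
  st_ok : forall q, q \in P -> q \notin L -> q \notin I ->
    forall t, t \in L -> share2 q t -> tame F t;
  st_iso : forall q, q \in I -> q \notin L -> forall t, t \in L -> share2 q t ->
    [/\ t \in ref F, forall a, co a t \in core F &
        forall q', q' \in P -> share2 q' t -> q' = q] }.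

Lemma st_mono D D' L : D <= D' -> state D L -> state D' L.
Proof. by move=> le [h1 h2 h3 h4 h5]; split=> //; apply: leq_trans le. Qed.

(* An insertion removes at most 36 triples, hence raises a load by at most
   36 + 3 * 36. *)
Definition usable L a := [set v in core F | load F P L a v + 144 <= Th].

(** Markov's inequality: an unusable line of the core has load at least [Th - 143], and the loads of
    an axis sum to at most D. *)
Lemma usable_allowed D L w : state D L -> D < w.+1 * (Th - 143) -> allowed F (usable L) w.
Proof.
move=> s lt a; split; first by apply/subsetP => v; rewrite in_set => /andP[].
have lat := st_lat s.
rewrite -ltnS -(@ltn_pmul2r (Th - 143)); last by move: lt; case: (Th - 143) => //; rewrite muln0.
apply: leq_ltn_trans lt; apply: leq_trans (st_tot s).
rewrite -(sum_load P lat F a) -sum_nat_const.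
apply: (@leq_trans (\sum_(v in core F :\: usable L a) load F P L a v)).
  apply: leq_sum => v; rewrite in_setD in_set => /andP[+ vi]; rewrite vi /= -ltnNge.
  by move: (load _ _ _ _ _) => l; clear; lia.
rewrite [X in _ <= X](bigID (mem (core F :\: usable L a))) /=; exact: leq_addr.
Qed.

Definition defects := Th + 36 * m + 2 * m.

Lemma st_clean D L : state D L -> clean_bound F P L defects.
Proof.
move=> s; apply: load_clean => //; first exact: st_lat s.
move=> a v; apply: leq_trans (st_load s a v) _; rewrite leq_add2l leq_mul2l /=.
apply: leq_trans (lineP a v); apply: subset_leq_card; apply/subsetP => q.
by rewrite !in_set => /andP[/andP[-> _] ->].
Qed.

Definition keeps L L' := forall q, q \in P -> q \in L -> q \in L'.

Lemma st_ins D L L' p e : state D L -> p \in P -> p \notin L ->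
  insertion F P (usable L) L L' p -> #|L :\: L'| <= e + 3 -> 
  [/\ state (D + e) L', p \in L' & keeps L L'].
Proof.
move=> s pP pL i ce; have [lat ld tot ok iso] := s; have [lat' mp cd li old new cnt] := i.
have keep : keeps L L'.
  move=> q qP qL; apply/negPn/negP => n; case/negP: pL.
  by rewrite (plat_eq platP pP qP (old q qL n (bad_self qP))).
split=> //; split=> //.
- move=> a v; apply: load_ins i _ _ _ a v => // a v.
  by rewrite in_set => /andP[].
- apply: tot_arith ce _ tot.
    apply: leq_trans (leq_card_setU _ _); apply: subset_leq_card; apply/subsetP => t.
    by rewrite in_setU !in_setD => /andP[-> ->]; case: (t \in L).
  rewrite (cardsD1 p (P :\: L)) in_setD pP pL /= add1n ltnS.
  apply: subset_leq_card; apply/subsetP => q; rewrite in_setD1 !in_setD => /andP[n qP].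
  rewrite qP (contra (keep q qP)) // !andbT; by apply: contraNneq n => ->.
- move=> q qP qL' qI t tL' sh; have qL : q \notin L by apply: contra qL'; apply: keep.
  case: (boolP (t \in L)) => tL; first exact: ok q qP qL qI t tL sh.
  case/share2P: sh => a e1; case: (new t q a tL' tL qP e1) => [e2|[] //].
  move: e1; rewrite e2 => e1; case/negP: qL'; by rewrite (platP qP pP e1).
- move=> q qI qL' t tL' sh; have qP : q \in P by exact: subsetP subI _ qI.
  have qL : q \notin L by apply: contra qL'; apply: keep.
  case/share2P: (sh) => a e1; have [t0 t0L e0] := lat.2 a (op a q).
  have sh0 : share2 q t0 by apply/share2P; exists a.
  have [i1 i2 i3] := iso q qI qL t0 t0L sh0.
  (* The triple covering a pair of q has not changed: if removed, it would share a pair with p, and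
     isolation would give p = q. *)
  suff <- : t0 = t by [].
  apply: (lat'.1 a) => //; last by rewrite e0.
  apply/negPn/negP => n.
  have b0 : bad P t0 by apply/badP; exists q, a.
  have e2 := i3 p pP (old t0 t0L n b0).
  by case/negP: qL'; rewrite -e2.
Qed.

Lemma step_core D L p w : state D L -> p \in P -> p \notin L -> p \notin I ->
  (forall a, co a p \in core F) -> D < w.+1 * (Th - 143) ->
  3 * defects + 4 * w + 64 < kq -> 9 * defects + 7 * w + 186 < k ->
  exists L', [/\ state (D + 33) L', p \in L' & keeps L L'].
Proof.
move=> s pP pL pI pc lt l1 l2.
have [L' i] := insert_core wfF (st_lat s) (st_clean s) (usable_allowed s lt) pP pL pc
  (st_ok s pP pL pI) l1 l2.
exists L'; apply: (st_ins s pP pL i); exact: in_card i.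
Qed.

(** Why the ordinary core triples come first: a q of P competing for a pair that t completes by the
    outside label would be pending with all labels in the core, hence isolated, but the triples
    covering an isolated triple stay inside the core. *)
Lemma step_special D L p w a0 : state D L -> p \in P -> p \notin L -> co a0 p \notin core F ->
  (forall q, q \in P -> q \notin I -> (forall a, co a q \in core F) -> q \in L) ->
  D < w.+1 * (Th - 143) ->
  4 * defects + 5 * w + 64 < kq -> 9 * defects + 7 * w + 186 < k ->
  exists L', [/\ state (D + 33) L', p \in L' & keeps L L'].
Proof.
move=> s pP pL pa hq lt l1 l2; have [c1 c2] := specialP pP pa.
have pI : p \notin I by apply: contra pa => /coreI.
have ok := st_ok s pP pL pI.
have own q t a : q \in P -> t \in L -> share2 p t -> co a t \notin core F -> op a q <> op a t.
  move=> qP tL sh ta e; have okt := ok t tL sh.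
  have qL : q \notin L.
    apply/negP => qL; have qt : q = t by apply: (st_lat s).1 e.
    by case/negP: pL; rewrite (plat_eq platP pP qP) // qt.
  case: (boolP (co a q \in core F)) => qa; last first.
    case/negP: qL; suff -> : q = t by [].
    apply: co_op_inj e.
    apply/eqP; apply: contraTT one_special => ne; rewrite -ltnNge.
    rewrite (cardD1 (co a q)) (cardD1 (co a t)) !inE qa ta eq_sym ne //.
  have qc b : co b q \in core F.
    have [n1 n2] : co (nxt a) t \in core F /\ co (nxt (nxt a)) t \in core F.
      move: okt ta; rewrite /tame; case: (a) => /= /orP[/and4P[]|]; rewrite ?negbK;
      by case: (t.1.1 \in core F) (t.1.2 \in core F) (t.2 \in core F) => [] [] [].
    move: e qa n1 n2; rewrite /op; case: (a) => /= -[<- <-] q0 q1 q2; by case: b.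
  case: (boolP (q \in I)) => qI; last by move: qL; rewrite hq.
  have shq : share2 q t by apply/share2P; exists a.
  have [_ h _] := st_iso s qI qL tL shq.
  by rewrite h in ta.
have [L' i] := insert_special wfF platP (st_lat s) (st_clean s) (usable_allowed s lt) pP pL c1 c2 pa
  ok own l1 l2.
exists L'; apply: (st_ins s pP pL i); exact: in_card i.
Qed.

Lemma step_isolated D L p w : state D L -> p \in I -> p \notin L ->
  D < w.+1 * (Th - 143) -> 7 * defects + 6 * w < k ->
  exists L', [/\ state (D + 7) L', p \in L' & keeps L L'].
Proof.
case: p => [[r c] s0] s pI pL lt l.
have pP : (r, c, s0) \in P by exact: subsetP subI _ pI.
have [[ri ci] si] := (coreI A0 pI, coreI A1 pI, coreI A2 pI); rewrite /= in ri ci si.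
have lat := st_lat s.
have [[[r1 c1] x] t1L] := lat.2 A2 (r, c); rewrite /op /= => -[e1 e2]; subst r1 c1.
have [[[r1 c'] s1] t2L] := lat.2 A1 (s0, r); rewrite /op /= => -[e1 e2]; subst r1 s1.
have [[[r' c1] s1] t3L] := lat.2 A0 (c, s0); rewrite /op /= => -[e1 e2]; subst c1 s1.
have sh1 : share2 (r, c, s0) (r, c, x) by rewrite /share2 /op /= !eqxx !orbT.
have sh2 : share2 (r, c, s0) (r, c', s0) by rewrite /share2 /op /= !eqxx !orbT.
have sh3 : share2 (r, c, s0) (r', c, s0) by rewrite /share2 /op /= !eqxx.
have [f1 g1 h1] := st_iso s pI pL t1L sh1.
have [f2 g2 h2] := st_iso s pI pL t2L sh2.
have [f3 g3 h3] := st_iso s pI pL t3L sh3.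
have xi : x \in core F := g1 A2.
have c'i : c' \in core F := g2 A1.
have r'i : r' \in core F := g3 A0.
have xs : x != s0 by apply: contraNneq pL => <-.
have [L' i c10] := insert_isolated wfF lat (st_clean s) (usable_allowed s lt) pP ri ci si xi c'i r'i
  t1L t2L t3L xs (eqP (etrans (esym (wfE wfF ri ci xi)) f1)) (eqP (etrans (esym (wfE wfF ri c'i si)) f2))
  (eqP (etrans (esym (wfE wfF r'i ci si)) f3)) h1 h2 h3 l.
exists L'; exact: (@st_ins D L L' _ 7 s pP pL i c10).
Qed.

Lemma iterate (C : {set T * T * T} -> Prop) (S : {set T * T * T}) e Dm :
  S \subset P -> (forall L L', C L -> keeps L L' -> C L') ->
  (forall D L p, state D L -> C L -> D <= Dm -> p \in S -> p \notin L ->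
     exists L', [/\ state (D + e) L', p \in L' & keeps L L']) ->
  forall n D L, state D L -> C L -> #|S :\: L| <= n -> D + e * n <= Dm ->
  exists L', [/\ state (D + e * n) L', S \subset L' & keeps L L'].
Proof.
move=> sS mC step; elim=> [|n IH] D L s cL.
  rewrite leqn0 cards_eq0 setD_eq0 => sub _; exists L; rewrite muln0 addn0; split=> // q.
move=> le ld; case: (boolP (S \subset L)) => [sub|/subsetPn[p pS pL]].
  exists L; split=> //; by apply: st_mono s; apply: leq_addr.
have [|L1 [s1 p1 k1]] := step D L p s cL _ pS pL; first by apply: leq_trans ld; apply: leq_addr.
have [||L2 [s2 h2 k2]] := IH _ _ s1 (mC _ _ cL k1).
- rewrite -ltnS; apply: leq_trans le.
  rewrite (cardsD1 p (S :\: L)) in_setD pS pL /= add1n ltnS.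
  apply: subset_leq_card; apply/subsetP => q; rewrite in_setD1 !in_setD => /andP[nq qS].
  rewrite qS (contra (k1 q (subsetP sS q qS))) // !andbT; by apply: contraNneq nq => ->.
- by rewrite -addnA -mulnS.
exists L2; split=> //; first by rewrite mulnS addnA.
by move=> q qP qL; apply: k2 => //; apply: k1.
Qed.

(** The X costly insertions are made while at most w1 lines per axis are unusable; the isolated
    ones, at 7 each, need fewer fresh triples and tolerate the larger number w2. *)
Lemma completion D0 X N w1 w2 L0 : state D0 L0 ->
  #|P :\: I :\: L0| <= X -> #|P| <= N ->
  D0 + 33 * X < w1.+1 * (Th - 143) ->
  4 * defects + 5 * w1 + 64 < kq -> 9 * defects + 7 * w1 + 186 < k ->
  D0 + 33 * X + 7 * N < w2.+1 * (Th - 143) ->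
  7 * defects + 6 * w2 < k ->
  exists2 L, latin L & P \subset L.
Proof.
move=> s0 cX cN n1 n2 n3 n4 n5.
pose S1 := [set q in P | (q \notin I) && [&& co A0 q \in core F, co A1 q \in core F & co A2 q \in core F]].
pose S2 := [set q in P | ~~ [&& co A0 q \in core F, co A1 q \in core F & co A2 q \in core F]].
have n2' : 3 * defects + 4 * w1 + 64 < kq by move: n2; clear; lia.
have c12 : #|S1 :\: L0| + #|S2 :\: L0| <= X.
  apply: leq_trans cX; rewrite -cardsUI (_ : (S1 :\: L0) :&: (S2 :\: L0) = set0) ?cards0 ?addn0.
    apply: subset_leq_card; apply/subsetP => q; rewrite in_setU !in_setD !in_set.
    case: (q \in L0) => //=; case: (boolP (q \in I)) => //= qI.
      rewrite andbF /=; move: (coreI A0 qI) (coreI A1 qI) (coreI A2 qI) => /= -> -> -> /=.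
      by rewrite andbF.
    by case: (q \in P).
  apply/setP => q; rewrite !inE.
  by case: (q \in L0); case: (q \in P); case: (q \in I) => //=; case: and3P.
have [||||L1 [s1 h1 k1]] := @iterate (fun _ => True) S1 33 (D0 + 33 * X) _ _ _ #|S1 :\: L0| D0 L0 s0 Logic.I (leqnn _).
- by apply/subsetP => q; rewrite in_set => /andP[].
- by [].
- move=> D L p s _ ld; rewrite in_set => /and3P[pP pI /and3P[c0 c1 c2]] pL.
  apply: (step_core s pP pL pI _ (leq_ltn_trans ld n1)) => //.
  by case.
- rewrite leq_add2l leq_mul2l /=; apply: leq_trans c12; exact: leq_addr.
pose C L := forall q, q \in P -> q \notin I -> (forall a, co a q \in core F) -> q \in L.
have CL1 : C L1.
  move=> q qP qI qc; apply: (subsetP h1); rewrite in_set qP qI.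
  by have := qc A0; have := qc A1; have := qc A2 => /= -> -> ->.
have sub2 : #|S2 :\: L1| <= #|S2 :\: L0|.
  apply: subset_leq_card; apply/subsetP => q; rewrite !in_setD => /andP[qn qS]; rewrite qS andbT.
  by apply: contra qn; apply: k1; move: qS; rewrite in_set => /andP[].
have [||||L2 [s2 h2 k2]] := @iterate C S2 33 (D0 + 33 * X) _ _ _ #|S2 :\: L0| _ L1 s1 CL1 sub2.
- by apply/subsetP => q; rewrite in_set => /andP[].
- by move=> L L' cL kL q qP qI qc; apply: kL => //; apply: cL.
- move=> D L p s cL ld; rewrite in_set => /andP[pP ps] pL.
  have [a pa] : exists a, co a p \notin core F.
    by move: ps; rewrite !negb_and => /or3P[]; [exists A0|exists A1|exists A2].
  by apply: (step_special s pP pL pa cL (leq_ltn_trans ld n1)).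
- by rewrite -addnA -mulnDr leq_add2l leq_mul2l.
have cI : #|I :\: L2| <= N.
  apply: leq_trans cN; apply: leq_trans (subset_leq_card subI).
  by apply: subset_leq_card; apply: subsetDl.
have [|||L3 [s3 h3 k3]] := @iterate (fun _ => True) I 7 (D0 + 33 * X + 7 * N) subI _ _ N _ L2 s2 Logic.I cI.
- by [].
- by move=> D L p s _ ld pI pL; apply: (step_isolated s pI pL (leq_ltn_trans ld n4)).
- by rewrite leq_add2r -addnA -mulnDr leq_add2l leq_mul2l.
exists L3; first exact: st_lat s3.
apply/subsetP => q qP; case: (boolP (q \in I)) => qI; first exact: subsetP h3 _ qI.
apply: k3 => //; case: (boolP [&& co A0 q \in core F, co A1 q \in core F & co A2 q \in core F]) => qc.
  apply: k2 => //; apply: (subsetP h1); by rewrite in_set qP qI.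
by apply: (subsetP h2); rewrite in_set qP.
Qed.

End State.

(** * Random permutations *)

Lemma bin_le_exp n k : 'C(n, k) <= 2 ^ n.
Proof.
have <- : #|[set A : {set 'I_n} | A \subset [set: 'I_n] & #|A| == k]| = 'C(n, k).
  by rewrite cards_draws cardsT card_ord.
rewrite -[n in X in _ <= X](card_ord n) -cardsT -card_powerset.
by apply: subset_leq_card; apply/subsetP => A; rewrite !inE => /andP[].
Qed.

(** A weak Stirling bound: M ^ M is at most the falling factorial of 2 * M of length M, which is
    ['C(2 * M, M)] times the factorial of M. *)
Lemma expn_le_fact M : M ^ M <= 4 ^ M * M`!.
Proof.
have h j : M ^ j <= (M + j) ^_ j.
  elim: j => [|j IH] //.
  rewrite addnS ffactnS expnS; apply: leq_mul => //.
  by rewrite -addnS leq_addr.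
apply: leq_trans (h M) _; rewrite -bin_ffact leq_mul2r; apply/orP; right.
apply: leq_trans (bin_le_exp _ _) _.
by rewrite (_ : 4 = 2 ^ 2) // -expnM mul2n addnn.
Qed.

Lemma leq_card_bigcup (I T : finType) (C : pred I) (B : I -> {set T}) :
  #|\bigcup_(i | C i) B i| <= \sum_(i | C i) #|B i|.
Proof.
elim/big_rec2: _ => [|i U x _ IH]; first by rewrite cards0.
by apply: leq_trans (leq_card_setU _ _) _; rewrite leq_add2l.
Qed.

(** Of the w permutations, fewer than half are counted by b and at most half by c, so they cannot
    exhaust them. *)
Lemma union_bound_arith b c j q x y z w a B : 0 < w ->
  b * y <= j * (w * x) -> c * B.+1 <= q * z -> w <= b + c ->
  2 * j * x < y -> 2 * q <= a * B -> w = a * z -> False.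
Proof.
move=> w0 c1 c2 c3 l1 l2 e.
have h1 : 2 * b < w.
  have y0 : 0 < y by apply: leq_ltn_trans l1.
  rewrite -(ltn_pmul2r y0); apply: (@leq_ltn_trans (2 * j * x * w)).
    rewrite -mulnA; apply: (@leq_trans (2 * (j * (w * x)))); first by rewrite leq_mul2l.
    by rewrite !mulnA -(mulnAC _ x w).
  by rewrite mulnC ltn_pmul2l.
have h2 : 2 * c <= w.
  rewrite leqNgt; apply/negP => h.
  have : 2 * c * B.+1 <= w * B.
    rewrite -mulnA; apply: (@leq_trans (2 * (q * z))); first by rewrite leq_mul2l.
    by rewrite mulnA e (mulnAC a) leq_mul2r l2 orbT.
  apply/negP; rewrite -ltnNge; apply: (@leq_trans (w.+1 * B.+1)); last by rewrite leq_mul2r h.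
  by rewrite mulSn mulnS; lia.
lia.
Qed.

Section RandomPermutations.

Variable T : finType.
Implicit Types (A I : {set T}) (S : T -> {set T}) (p : {perm T}).

(** Induction on I. With y the image of i, composing with the transposition of y and i gives a
    permutation of A without i; the sets S j are moved by the same transposition and keep their
    size. *)
Lemma card_perm_prescribed A I S m : I \subset A -> (forall i, #|S i| <= m) ->
  #|[set p | perm_on A p && [forall i in I, p i \in S i]]| <= m ^ #|I| * (#|A| - #|I|)`!.
Proof.
move: {2}#|I| (erefl #|I|) => n; elim: n A I S => [|n IH] A I S cI sub cS.
  rewrite cI expn0 mul1n subn0 -card_perm; apply: subset_leq_card.
  by apply/subsetP => p; rewrite !inE => /andP[].
have [i iI] : exists i, i \in I by apply/set0Pn; rewrite -card_gt0 cI.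
have iA := subsetP sub i iI.
pose X y := [set p | perm_on (A :\ i) p && [forall j in I :\ i, p j \in [set tperm y i z | z in S j]]].
have cover : [set p | perm_on A p && [forall i in I, p i \in S i]] \subset
    \bigcup_(y in S i) [set (p * tperm y i)%g | p in X y].
  apply/subsetP => p; rewrite inE => /andP[pA /forall_inP pS].
  apply/bigcupP; exists (p i); first exact: pS.
  apply/imsetP; exists (p * tperm (p i) i)%g; last by rewrite -mulgA tperm2 mulg1.
  rewrite inE; apply/andP; split.
    apply/subsetP => j; rewrite inE permM in_setD1 => nj.
    have ji : j != i by apply: contraNneq nj => ->; rewrite tpermL.
    rewrite ji; apply: (subsetP pA); rewrite inE; apply: contraNneq nj => pj.
    rewrite pj tpermD // 1?eq_sym //; apply: contraNneq ji => e.
    by rewrite -(inj_eq (@perm_inj _ p)) pj e.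
  apply/forall_inP => j /setD1P[ji jI]; apply/imsetP; exists (p j); first exact: pS.
  by rewrite permM.
apply: leq_trans (subset_leq_card cover) _.
apply: leq_trans (leq_card_bigcup _ _) _ => /=.
have cI' : #|I :\ i| = n by have := cardsD1 i I; rewrite iI cI add1n => -[].
have cA' : #|A| = (#|A :\ i|).+1 by rewrite (cardsD1 i A) iA.
apply: (@leq_trans (\sum_(y in S i) m ^ n * (#|A| - #|I|)`!)).
  apply: leq_sum => y _; apply: leq_trans (leq_imset_card _ _) _.
  rewrite cA' cI subSS -cI'; apply: IH => //; first exact: setSD.
  by move=> j; apply: leq_trans (leq_imset_card _ _) (cS j).
rewrite sum_nat_const cI expnS mulnA leq_mul2r; apply/orP; right.
by rewrite leq_mul2r cS orbT.
Qed.

(* Union bound over the M-subsets of A. *)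
Lemma card_perm_hits A S m M : (forall i, #|S i| <= m) ->
  #|[set p | perm_on A p && (M <= #|[set i in A | p i \in S i]|)]| * M`! <= #|A|`! * m ^ M.
Proof.
move=> cS; set B := [set p | _].
have [AM|MA] := ltnP #|A| M.
  rewrite (_ : B = set0) ?cards0 //; apply/setP => p; rewrite !inE.
  apply/negP => /andP[_ le]; move: AM; rewrite ltnNge (leq_trans le) //.
  by apply: subset_leq_card; apply/subsetP => i; rewrite inE => /andP[].
pose D := [set I : {set T} | I \subset A & #|I| == M].
have cover : B \subset \bigcup_(I in D) [set p | perm_on A p && [forall i in I, p i \in S i]].
  apply/subsetP => p; rewrite inE => /andP[pA /card_geqP[s [us ss sub]]].
  apply/bigcupP; exists [set i in s].
    rewrite inE cardsE (card_uniqP us) ss eqxx andbT; apply/subsetP => i; rewrite inE => /sub.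
    by rewrite inE => /andP[].
  rewrite inE pA; apply/forall_inP => i; rewrite inE => /sub.
  by rewrite inE => /andP[].
apply: (@leq_trans ('C(#|A|, M) * (m ^ M * (#|A| - M)`!) * M`!)).
  rewrite leq_mul2r; apply/orP; right; apply: leq_trans (subset_leq_card cover) _.
  apply: leq_trans (leq_card_bigcup _ _) _; rewrite -cards_draws -sum_nat_const.
  apply: leq_sum => I; rewrite inE => /andP[sub /eqP <-]; exact: card_perm_prescribed.
rewrite -[X in _ <= X * _](bin_fact MA).
move: 'C(_, _) (m ^ M) (_ - _)`! (M`!) => x y z w; rewrite leq_eqVlt; apply/orP; left; apply/eqP.
by rewrite mulnAC -!mulnA; congr (_ * (_ * _)); rewrite mulnC.
Qed.

Lemma sum_perm_hits A (X : finType) (Q : {set X}) (f g : X -> T) :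
  (forall x, x \in Q -> f x \in A) ->
  \sum_(p | perm_on A p) #|[set x in Q | p (f x) == g x]| <= #|Q| * (#|A| - 1)`!.
Proof.
move=> fA.
rewrite (eq_bigr (fun p => \sum_(x in Q) (p (f x) == g x : nat))); last first.
  move=> p _; rewrite -sum1dep_card -big_mkcondr; apply: eq_bigl => x.
  by [].
rewrite exchange_big -sum_nat_const /=; apply: leq_sum => x xQ.
have sub : [set f x] \subset A by rewrite sub1set fA.
have cS (i : T) : #|[set g x]| <= 1 by rewrite cards1.
have := card_perm_prescribed sub cS; rewrite exp1n mul1n (cards1 (f x)); apply: leq_trans.
rewrite -big_mkcondr /= sum1dep_card; apply: subset_leq_card; apply/subsetP => p.
rewrite !inE => /andP[-> /eqP e]; apply/forall_inP => y; rewrite inE => /eqP ->.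
by rewrite e inE.
Qed.

(** [card_perm_hits] with a union bound over J controls the hits, and Markov's inequality on
    [sum_perm_hits] the coincidences in Q. *)
Lemma good_perm_exists A (J : finType) (S : J -> T -> {set T}) m M
    (X : finType) (Q : {set X}) (f g : X -> T) B :
  (forall x, x \in Q -> f x \in A) -> (forall j i, #|S j i| <= m) ->
  2 * #|J| * m ^ M < M`! -> 2 * #|Q| <= #|A| * B -> 0 < #|A| ->
  exists p : {perm T}, [/\ perm_on A p,
    forall j, #|[set i in A | p i \in S j i]| < M &
    #|[set x in Q | p (f x) == g x]| <= B].
Proof.
move=> fA cS l1 l2 A0.
pose Bj j := [set p | perm_on A p && (M <= #|[set i in A | p i \in S j i]|)].
pose C := [set p | perm_on A p && (B < #|[set x in Q | p (f x) == g x]|)].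
have c1 : #|\bigcup_j Bj j| * M`! <= #|J| * (#|A|`! * m ^ M).
  apply: (@leq_trans (\sum_j #|Bj j| * M`!)).
    rewrite -big_distrl /= leq_mul2r; apply/orP; right.
    exact: leq_trans (leq_card_bigcup _ _) _.
  by rewrite -sum_nat_const; apply: leq_sum => j _; apply: card_perm_hits.
have c2 : #|C| * B.+1 <= #|Q| * (#|A| - 1)`!.
  apply: leq_trans (sum_perm_hits g fA); rewrite -sum_nat_const.
  rewrite [X in _ <= X](bigID (mem C)) /=; apply: leq_trans (leq_addr _ _).
  rewrite [X in _ <= X](eq_bigl (mem C)) => [|p]; last by rewrite !inE; case: (perm_on A p).
  by apply: leq_sum => p; rewrite inE => /andP[].
case: (pickP [pred p | [&& perm_on A p, p \notin \bigcup_j Bj j & p \notin C]]) => [p /and3P[pA pB pC]|none].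
  exists p; split=> //.
    move=> j; rewrite ltnNge; apply: contra pB => h.
    by apply/bigcupP; exists j; rewrite // inE pA.
  by rewrite leqNgt; apply: contra pC => h; rewrite inE pA.
have c3 : #|A|`! <= #|\bigcup_j Bj j| + #|C|.
  rewrite -card_perm -cardsUI; apply: leq_trans (leq_addr _ _); apply: subset_leq_card.
  apply/subsetP => p pA; have := none p; rewrite in_setU /= -[perm_on A p]/(p \in perm_on A) pA /=.
  by rewrite -negb_or => /negbFE.
have fA1 : #|A|`! = #|A| * (#|A| - 1)`! by case: #|A| A0 => // a _; rewrite factS subn1.

by case: (union_bound_arith (fact_gt0 _) c1 c2 c3 l1 l2 fA1).
Qed.

End RandomPermutations.

Import GRing.Theory.

(** * Dihedral frames *)

Section Dihedral.

Variable k' : nat.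
Notation k := k'.+1.
Notation dih := (ordinal k * bool)%type.
Implicit Types x y z : dih.

(* The dihedral group: (i, b) stands for the i-th rotation followed, if b, by a
   fixed reflection. *)
Definition dmul x y : dih := ((if x.2 then x.1 - y.1 else x.1 + y.1)%R, x.2 (+) y.2).
Definition dinv x : dih := ((if x.2 then x.1 else - x.1)%R, x.2).

Lemma dmulKl x y : dmul (dinv x) (dmul x y) = y.
Proof.
case: x y => [i []] [j b]; rewrite /dmul /dinv /=.
  by rewrite negbK opprB addrC subrK.
by rewrite addKr.
Qed.

Lemma dmulKVl x y : dmul x (dmul (dinv x) y) = y.
Proof.
case: x y => [i []] [j b]; rewrite /dmul /dinv /=.
  by rewrite negbK opprB addrC subrK.
by rewrite addNKr.
Qed.

Lemma dmulKVr x y : dmul (dmul x (dinv y)) y = x.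
Proof.
case: x y => [i a] [j b]; rewrite /dmul /dinv /=; congr pair; last by case: a; case: b.
by case: a; case: b => /=; rewrite ?addrK ?subrK ?opprK ?addrK ?subrK.
Qed.

Lemma dmulKr x y : dmul (dmul x y) (dinv y) = x.
Proof.
case: x y => [i a] [j b]; rewrite /dmul /dinv /=; congr pair; last by case: a; case: b.
by case: a; case: b => /=; rewrite ?addrK ?subrK ?opprK ?addrK ?subrK.
Qed.

(** For y and z of different types the product of z and the inverse of y is a reflection, hence an
    involution. This is the abundance of intercalates required by [wfq]. *)
Lemma dmul_quad x y z : y.2 != z.2 -> dmul (dmul (dmul x z) (dinv y)) z = dmul x y.
Proof.
case: x y z => [i a] [j b] [l c]; rewrite /dmul /dinv /=.
by case: a; case: b; case: c => //= _; congr pair; rewrite ?opprK addrAC ?addrK ?subrK // addrAC ?addrK ?subrK.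
Qed.

Lemma card_dih : #|{: dih}| = k.*2.
Proof. by rewrite card_prod card_ord card_bool muln2. Qed.

Lemma card_dih_par b : #|[set x : dih | x.2 == b]| = k.
Proof.
rewrite (_ : [set _ | _] = setX setT [set b]) ?cardsX ?cards1 ?cardsT ?card_ord ?muln1 //.
by apply/setP => -[i c]; rewrite !inE.
Qed.

End Dihedral.

Arguments dmul : simpl never.
Arguments dinv : simpl never.

Section Embedded.

Variables (k' : nat) (T : finType).
Notation k := k'.+1.
Notation dih := (ordinal k * bool)%type.
Variables (emb : dih -> T) (pr : T -> dih) (S : {set T * T * T}).
Hypothesis embK : cancel emb pr.

Definition emb3 (t : dih * dih * dih) : T * T * T := (emb t.1.1, emb t.1.2, emb t.2).

(** In the frame built from this table, S holds the reference triples with a label outside the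
    group: none in even order, those through the added row, column or symbol in odd order. *)
Definition cayley : {set dih * dih * dih} := [set t | dmul t.1.1 t.1.2 == t.2].

Definition dihF := Frame (emb @: setT) (fun v => (pr v).2)
  (fun r c => emb (dmul (pr r) (pr c)))
  (fun r s => emb (dmul (dinv (pr r)) (pr s)))
  (fun c s => emb (dmul (pr s) (dinv (pr c))))
  (emb3 @: cayley :|: S).

Lemma emb_core x : emb x \in core dihF.
Proof. exact: imset_f. Qed.

Lemma coreP v : reflect (exists x, v = emb x) (v \in core dihF).
Proof. by apply: (iffP imsetP) => [[x _ ->]|[x ->]]; exists x. Qed.

Lemma co_emb3 a t : co a (emb3 t) = emb (co a t).
Proof. by case: a. Qed.

Lemma emb3_inj : injective emb3.
Proof.
move=> [[x y] z] [[x' y'] z']; rewrite /emb3 /= => -[e1 e2 e3].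
by rewrite (can_inj embK e1) (can_inj embK e2) (can_inj embK e3).
Qed.

Lemma cayley_latin a u : exists2 t, t \in cayley & op a t = u.
Proof.
case: u => x y; case: a.
- by exists (dmul y (dinv x), x, y); rewrite // inE /= dmulKVr.
- by exists (y, dmul (dinv y) x, x); rewrite // inE /= dmulKVl.
by exists (x, y, dmul x y); rewrite // inE.
Qed.

Lemma cayley_plat a t t' : t \in cayley -> t' \in cayley -> op a t = op a t' -> t = t'.
Proof.
case: t t' => [[x y] z] [[x' y'] z']; rewrite !inE /= => /eqP <- /eqP <-.
case: a; rewrite /op /= => e; move: (congr1 fst e) (congr1 snd e) => {e} /=.
- by move=> <- e; rewrite -(dmulKr x y) e dmulKr.
- by move=> e e'; rewrite -(dmulKl x y) e -e' dmulKl.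
by move=> <- <-.
Qed.

Hypothesis S_special : forall t, t \in S -> exists a, co a t \notin core dihF.
Hypothesis S_one : forall t a, t \in S -> co a t \notin core dihF ->
  (co (nxt a) t \in core dihF) && (co (nxt (nxt a)) t \in core dihF).
Hypothesis S_inj : forall a b t t', t \in S -> t' \in S -> co a t \notin core dihF ->
  co a t = co a t' -> b <> a -> co b t = co b t' -> t = t'.
Variable kq : nat.
Hypothesis kq_le : kq <= k.
Hypothesis S_many : forall a x b1 b2, x \notin core dihF ->
  kq <= #|[set t in S | [&& co a t == x, (pr (co (nxt a) t)).2 == b1 &
              (pr (co (nxt (nxt a)) t)).2 == b2]]|.

Lemma core_ref t : t \in ref dihF -> (forall a, co a t \in core dihF) ->
  exists2 t0, t0 \in cayley & t = emb3 t0.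
Proof.
move=> + tc; rewrite in_setU => /orP[/imsetP[t0 h ->]|/S_special[a]]; first by exists t0.
by rewrite tc.
Qed.

Lemma wf_dihF : wf dihF k kq.
Proof.
have S1 t a : t \in ref dihF -> co a t \notin core dihF -> t \in S.
  rewrite in_setU => /orP[/imsetP[t0 h ->]|//]; by rewrite co_emb3 emb_core.
split.
- by move=> r c _ _; apply: emb_core.
- by move=> r c _ _; apply: emb_core.
- by move=> r c _ _; apply: emb_core.
- move=> r c s /coreP[x ->] /coreP[y ->] /coreP[z ->] /=; rewrite !embK !(inj_eq (can_inj embK)).
  by apply/eqP/eqP => <-; rewrite ?dmulKVl ?dmulKl.
- move=> r c s /coreP[x ->] /coreP[y ->] /coreP[z ->] /=; rewrite !embK !(inj_eq (can_inj embK)).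
  by apply/eqP/eqP => <-; rewrite ?dmulKVr ?dmulKr.
- by move=> r c /coreP[x ->] /coreP[y ->] /=; rewrite !embK.
- move=> r c h /coreP[x ->] /coreP[y ->] /coreP[z ->] /=; rewrite !embK => ne.
  by rewrite dmul_quad.
- move=> b; rewrite -(card_dih_par k' b) -(card_imset _ (can_inj embK)); apply: eq_card => v.
  rewrite !inE /=; apply/andP/imsetP => [[/coreP[x ->]]|[x + ->]].
    by rewrite /= embK => p; exists x; rewrite // inE.
  by rewrite inE embK => ->; rewrite emb_core.
- move=> r c s /coreP[x ->] /coreP[y ->] /coreP[z ->]; rewrite /= !embK (inj_eq (can_inj embK)).
  apply/idP/eqP => [h|<-]; last first.
    by rewrite in_setU; apply/orP; left; apply/imsetP; exists (x, y, dmul x y); rewrite // inE.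
  have [|[[x' y'] z']] := core_ref h; first by case; apply: emb_core.
  by rewrite inE /emb3 /= => /eqP <- [/(can_inj embK) -> /(can_inj embK) -> /(can_inj embK) ->].
- move=> t a tr ta; apply: S_one (ta); exact: S1 tr ta.
- move=> a t t' tr tr' e c1 c2 c3 c4 h.
  case: (boolP (co a t \in core dihF)) => ta; last first.
    have tS := S1 _ _ tr ta; have tS' : t' \in S by apply: (S1 t' a); rewrite // -e.
    case: h => h; apply: (S_inj tS tS' ta e _ h); by case: (a).
  have [|u uE eu] := core_ref tr.
    by move: ta c1 c2; case: (a) => /= ? ? ? [].
  have [|u' uE' eu'] := core_ref tr'.
    by move: ta c3 c4; rewrite e; case: (a) => /= ? ? ? [].
  rewrite eu eu' in e h *; congr emb3.
  move: e h; rewrite !co_emb3 => /(can_inj embK) e h.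
  have {}h : co (nxt a) u = co (nxt a) u' \/ co (nxt (nxt a)) u = co (nxt (nxt a)) u'.
    by case: h => /(can_inj embK); [left|right].
  case: h => h.
    by apply: (@cayley_plat (nxt (nxt a))); rewrite // /op nxt3 e h.
  by apply: (@cayley_plat (nxt a)); rewrite // /op nxt3 e h.
move=> a x b1 b2 h; case: (boolP (x \in core dihF)) => xc; last first.
  apply: leq_trans (S_many a b1 b2 xc) _; apply: subset_leq_card; apply/subsetP => t.
  rewrite !inE => /andP[tS /and3P[/eqP e p1 p2]]; rewrite tS orbT /= e eqxx /= p1 p2 !andbT.
  by apply: S_one; rewrite // e.
apply: leq_trans kq_le _; rewrite -(card_dih_par k' b1).
have {}h := h xc; have [z ez] := coreP _ xc; rewrite ez /= embK in h.
pose f (y : dih) := match a with A0 => (z, y, dmul z y) | A1 => (dmul y (dinv z), z, y)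
  | A2 => (y, dmul (dinv y) z, z) end.
rewrite -(@card_imset _ _ (fun y => emb3 (f y))); last first.
  by move=> y y' /emb3_inj; rewrite /f; case: (a) => -[].
apply: subset_leq_card; apply/subsetP => _ /imsetP[y + ->]; rewrite inE => /eqP yb.
rewrite inE in_setU imset_f /=; last by rewrite /f inE; case: (a); rewrite /= ?dmulKVr ?dmulKVl.
rewrite !co_emb3 !emb_core !embK ez (inj_eq (can_inj embK)) /f.
by case: (a); rewrite /= eqxx /= yb -h ?eqxx; case: (b1); case: (b2).
Qed.

End Embedded.

(** * Prolongation to odd order *)

Section Prolongation.

Variables (k' : nat).
Notation k := k'.+1.
Notation dih := (ordinal k * bool)%type.
Notation T := (option dih).
Variables (Tr : {set dih * dih * dih}) (miss : axis -> dih).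
Hypothesis Tr_cayley : Tr \subset cayley k'.
Hypothesis Tr_inj : forall a t t', t \in Tr -> t' \in Tr -> co a t = co a t' -> t = t'.
Hypothesis Tr_onto : forall a y, y != miss a -> exists2 t, t \in Tr & co a t = y.
Hypothesis Tr_miss : forall a t, t \in Tr -> co a t != miss a.
Variable kq : nat.
Hypothesis kq_le : kq <= k.
Hypothesis Tr_many : forall b1 b2,
  kq <= #|[set t in Tr | (t.1.1.2 == b1) && (t.1.2.2 == b2)]|.

Definition hole a (t : dih * dih * dih) : T * T * T := match a with
  | A0 => (None, Some t.1.2, Some t.2) | A1 => (Some t.1.1, None, Some t.2)
  | A2 => (Some t.1.1, Some t.1.2, None) end.

(** A full transversal would leave only (None, None, None) to be added. A near transversal misses
    one label on each axis and requires these three triples, which have two new labels and are the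
    only ones that are not tame. *)
Definition lone a : T * T * T := match a with
  | A0 => (Some (miss a), None, None) | A1 => (None, Some (miss a), None)
  | A2 => (None, None, Some (miss a)) end.

Notation emb3 := (emb3 (@Some dih)).

Definition holes := hole A0 @: Tr :|: (hole A1 @: Tr :|: hole A2 @: Tr).

Definition prolongation :=
  emb3 @: (cayley k' :\: Tr) :|: (holes :|: [set lone A0; lone A1; lone A2]).

Definition optF := dihF (@Some dih) (odflt (ord0, false)) holes.

Lemma holesP t : reflect (exists a t0, t0 \in Tr /\ t = hole a t0) (t \in holes).
Proof.
apply: (iffP idP) => [|[a [t0 [h ->]]]].
  by rewrite !in_setU => /or3P[] /imsetP[t0 h ->]; [exists A0|exists A1|exists A2]; exists t0.
by rewrite !in_setU; case: a; rewrite imset_f ?orbT.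
Qed.

Lemma optcoreP v : (v \in core optF) = (v != None).
Proof.
case: v => [x|]; first exact: (emb_core (@Some dih)).
by apply/negbTE/imsetP => -[].
Qed.

Lemma co_hole a b t : co b (hole a t) = if (a, b) is ((A0, A0) | (A1, A1) | (A2, A2)) then None else Some (co b t).
Proof. by case: a; case: b. Qed.

Lemma wf_optF : wf optF k kq.
Proof.
apply: wf_dihF => //.
- by move=> t /holesP[a [t0 [_ ->]]]; exists a; rewrite optcoreP co_hole; case: a.
- move=> t b /holesP[a [t0 [_ ->]]]; rewrite !optcoreP !co_hole; by case: a; case: b.
- move=> a b t t' /holesP[c [t0 [h ->]]] /holesP[c' [t0' [h' ->]]].
  rewrite optcoreP !co_hole.
  case: c; case: c'; case: a; case: b => //= _ _ _ [] e;
  solve [by rewrite (@Tr_inj A0 t0 t0') | by rewrite (@Tr_inj A1 t0 t0') | by rewrite (@Tr_inj A2 t0 t0')].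
move=> a x b1 b2; rewrite optcoreP negbK => /eqP ->.
pose c1 := match a with A0 => b1 (+) b2 | A1 => b2 | A2 => b1 end.
pose c2 := match a with A0 => b1 | A1 => b1 (+) b2 | A2 => b2 end.
apply: leq_trans (Tr_many c1 c2) _; rewrite -(@card_in_imset _ _ (hole a)); last first.
  move=> t t'; rewrite !inE => /andP[h _] /andP[h' _] e.
  apply: (@Tr_inj (nxt a)) => //; have := congr1 (co (nxt a)) e; rewrite !co_hole.
  by case: (a) => -[].
apply: subset_leq_card; apply/subsetP => _ /imsetP[t + ->]; rewrite in_set => /and3P[h /eqP p1 /eqP p2].
have := subsetP Tr_cayley t h; rewrite inE => /eqP e.
have p3 : t.2.2 = c1 (+) c2 by rewrite -e -p1 -p2.
rewrite in_set (_ : hole a t \in holes); last by apply/holesP; exists a, t.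
rewrite !co_hole; move: p1 p2 p3; rewrite /c1 /c2.
by case: (a) => /= q1 q2 q3; rewrite ?q1 ?q2 ?q3; case: (b1); case: (b2).
Qed.

Lemma prolongation_ex a u : exists2 t, t \in prolongation & op a t = u.
Proof.
case: u => -[y|] [z|].
- have [t tE e] := cayley_latin a (y, z).
  case: (boolP (t \in Tr)) => tT.
    exists (hole a t); last by rewrite /op !co_hole; move: e; rewrite /op; case: (a) => /= -[-> ->].
    by rewrite in_setU in_setU (_ : hole a t \in holes) ?orbT //; apply/holesP; exists a, t.
  exists (emb3 t); last by rewrite /op !co_emb3; case: e => -> ->.
  by rewrite in_setU imset_f // in_setD tT.
- case: (eqVneq y (miss (nxt a))) => [->|/Tr_onto[t h e]].
    by exists (lone (nxt a)); rewrite /prolongation; case: (a); rewrite // !inE eqxx ?orbT.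
  exists (hole (nxt (nxt a)) t); last by rewrite /op !co_hole -e; case: (a).
  by rewrite in_setU in_setU (_ : hole _ t \in holes) ?orbT //; apply/holesP; exists (nxt (nxt a)), t.
- case: (eqVneq z (miss (nxt (nxt a)))) => [->|/Tr_onto[t h e]].
    by exists (lone (nxt (nxt a))); rewrite /prolongation; case: (a); rewrite // !inE eqxx ?orbT.
  exists (hole (nxt a) t); last by rewrite /op !co_hole -e; case: (a).
  by rewrite in_setU in_setU (_ : hole _ t \in holes) ?orbT //; apply/holesP; exists (nxt a), t.
by exists (lone a); rewrite /prolongation; case: (a); rewrite // !inE eqxx ?orbT.
Qed.

Lemma card_Tr : #|Tr| = k.*2.-1.
Proof.
rewrite -(@card_in_imset _ _ (co A0)); last by move=> t t' ? ?; apply: (@Tr_inj A0).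
rewrite (_ : _ @: _ = [set~ miss A0]); first by rewrite cardsC1 card_dih.
apply/setP => x; rewrite !inE; apply/imsetP/idP => [[t h ->]|]; first exact: Tr_miss A0 _ h.
by move/(@Tr_onto A0) => [t h <-]; exists t.
Qed.

Lemma card_cayley : #|cayley k'| = k.*2 * k.*2.
Proof.
rewrite -card_dih -card_prod -(@card_in_imset _ _ (op A2)); last first.
  by move=> t t' ? ?; apply: (@cayley_plat _ A2).
apply: eq_card => u; rewrite inE; apply/imsetP.
by have [t h <-] := cayley_latin A2 u; exists t.
Qed.

Lemma card_prolongation : #|prolongation| <= #|{: T}| * #|{: T}|.
Proof.
have c3 a : #|hole a @: Tr| <= k.*2.-1 by apply: leq_trans (leq_imset_card _ _) _; rewrite card_Tr.
have c1 : #|emb3 @: (cayley k' :\: Tr)| <= k.*2 * k.*2 - k.*2.-1.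
  apply: leq_trans (leq_imset_card _ _) _; rewrite cardsDS // card_cayley card_Tr //.
have c2 : #|[set lone A0; lone A1; lone A2]| <= 3.
  by rewrite -setUA !cardsU1 cards1; case: (_ \notin _); case: (_ \notin _).
have c4 := c3 A0; have c5 := c3 A1; have c6 := c3 A2.
rewrite card_option card_dih.
apply: leq_trans (leq_card_setU _ _) _; apply: leq_trans (leq_add c1 (leq_card_setU _ _)) _.
apply: leq_trans (leq_add (leqnn _) (leq_add (leq_trans (leq_card_setU _ _) (leq_add c4 (leq_trans (leq_card_setU _ _) (leq_add c5 c6)))) c2)) _.
clear; nia.
Qed.

(** Each [op a] is onto all pairs and the set has at most that many triples, so it is injective. *)
Lemma latin_prolongation : latin prolongation.
Proof.
split; last exact: prolongation_ex.
move=> a; suff /imset_injP h : #|op a @: prolongation| == #|prolongation| by move=> t t' tL tL' e; apply: h.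
rewrite eqn_leq leq_imset_card; apply: leq_trans card_prolongation _.
rewrite -card_prod; apply: subset_leq_card; apply/subsetP => u _; apply/imsetP.
by have [t tL <-] := prolongation_ex a u; exists t.
Qed.

Lemma prolongation_ok t : t \in prolongation -> tame optF t \/ exists a, t = lone a.
Proof.
rewrite in_setU in_setU => /or3P[/imsetP[u /setDP[uE _] ->]|/holesP[a [u [_ ->]]]|].
- left; rewrite /tame !optcoreP /=; move: uE; rewrite inE => /eqP <-; by rewrite eqxx.
- by left; rewrite /tame !optcoreP; case: a.
by rewrite !inE => /orP[/orP[]|] /eqP ->; right; [exists A0|exists A1|exists A2].
Qed.

Lemma prolongation_ref t : t \in prolongation -> (forall a, co a t \in core optF) -> t \in ref optF.
Proof.
rewrite in_setU in_setU => /or3P[/imsetP[u /setDP[uE _] ->]|h|].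
- by rewrite in_setU imset_f.
- by rewrite in_setU h orbT.
by rewrite !inE => /orP[/orP[]|] /eqP -> h; move: (h A0) (h A1); rewrite !optcoreP.
Qed.

(** The missing reference triples are those of the near transversal, which meets each line at most
    once. *)
Lemma prolongation_gone a v : #|[set t in ref optF :\: prolongation | co a t == v]| <= 1.
Proof.
have h t : t \in ref optF :\: prolongation -> exists2 u, u \in Tr & t = emb3 u.
  move=> /setDP[/setUP[/imsetP[u uE e]|th] n]; last first.
    by case/negP: n; rewrite in_setU in_setU th orbT.
  exists u => //; apply: contraNT n => nu; by rewrite in_setU e imset_f // in_setD nu.
have g t : t \in [set t in ref optF :\: prolongation | co a t == v] ->
    exists2 u, u \in Tr & t = emb3 u /\ Some (co a u) = v.
  by rewrite in_set => /andP[/h[u uT ->] /eqP <-]; exists u; rewrite // co_emb3.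
rewrite leqNgt; apply/negP => /card_gt1P[t [t' [/g[u uT [-> e]] /g[u' uT' [-> e']]]]].
by move: e'; rewrite -e => -[] /(Tr_inj uT' uT) ->; rewrite eqxx.
Qed.

End Prolongation.

Lemma eqmod_small k u v : u = v %[mod k] -> u < 3 * k -> v < 3 * k ->
  u = v \/ u = v + k \/ v = u + k \/ u = v + 2 * k \/ v = u + 2 * k.
Proof.
move=> e lu lv; have := divn_eq u k; have := divn_eq v k; rewrite e.
have h w : w < 3 * k -> w %/ k < 3.
  by move=> lw; case: (posnP k) lw => [->|k0]; rewrite ?muln0 // ltn_divLR.
have := h u lu; have := h v lv; move: (u %/ k) (v %/ k) (v %% k) => x y z; clear -k u v.
case: y => [|[|[|//]]] _; case: x => [|[|[|//]]] _ -> ->; lia.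
Qed.

(** * A near transversal of the dihedral table *)

Section NearTransversal.

Variable k' : nat.
Notation k := k'.+1.
Notation dih := (ordinal k * bool)%type.

Let a := k./2.
Let e : nat := odd k.

Let ke : k = 2 * a + e.
Proof. by rewrite mul2n addnC odd_double_half. Qed.

Let e1 : e <= 1.
Proof. exact: leq_b1. Qed.

(* Columns and symbols of a near transversal of the dihedral table, the row being
   (i, b); the values are taken modulo k. *)
Let tauN (i : nat) (b : bool) : nat * bool :=
  if b then if i < a + e then (k.+1 - i, true) else (k + a - i.+1, false)
  else if i < a then (i, false) else (i + 2 - a, true).

Let sigN (i : nat) (b : bool) : nat * bool :=
  if b then if i < a + e then (2 * i + k - 1, false) else (2 * i + 1 - a, true)
  else if i < a then (2 * i, false) else (2 * i + 2 - a, true).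

Let Zd (u : nat * bool) : dih := (inZp u.1, u.2).
Let tau (x : dih) : dih := Zd (tauN x.1 x.2).
Let sig (x : dih) : dih := Zd (sigN x.1 x.2).
(** The omitted row: the last reflection for even k, the last rotation for odd k. *)
Let i0 : dih := (inZp k', e == 0).

Lemma inZp_add u v : (inZp u + inZp v = inZp (u + v) :> 'I_k)%R.
Proof. by apply: val_inj; rewrite /= modnDm. Qed.

Lemma dmul_tau x : dmul x (tau x) = sig x.
Proof.
case: x => i b; rewrite /tau /sig /Zd /dmul /= /tauN /sigN.
have li := ltn_ord i; case: b; case: ltnP => h /=; congr pair.
- apply/eqP; rewrite subr_eq inZp_add; apply/eqP/val_inj => /=.
  rewrite (_ : 2 * i + k - 1 + _ = i + (k + k)); first by rewrite addnA !modnDr modn_small.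
  by move: (val i) li h ke e1 => /= j; move: k a e; clear; lia.
- apply/eqP; rewrite subr_eq inZp_add; apply/eqP/val_inj => /=.
  rewrite (_ : 2 * i + 1 - a + _ = i + k); first by rewrite modnDr modn_small.
  by move: (val i) li h ke e1 => /= j; move: k a e; clear; lia.
- by apply: val_inj; rewrite /= modnDmr addnn mul2n.
apply: val_inj; rewrite /= modnDmr; congr (_ %% _).
by move: (val i) li h ke e1 => /= j; move: k a e; clear; lia.
Qed.

Lemma Zd_inj (f : nat -> bool -> nat * bool) :
  (forall i b, i < k -> (f i b).1 < 3 * k) ->
  (forall i b j c, i < k -> j < k -> (i, b) != (k', e == 0) -> (j, c) != (k', e == 0) ->
    (f i b).2 = (f j c).2 -> (f i b).1 = (f j c).1 \/ (f i b).1 = (f j c).1 + k \/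
      (f j c).1 = (f i b).1 + k \/ (f i b).1 = (f j c).1 + 2 * k \/ (f j c).1 = (f i b).1 + 2 * k ->
    i = j /\ b = c) ->
  {in [set~ i0] &, injective (fun x : dih => Zd (f x.1 x.2))}.
Proof.
move=> bd h [i b] [j c]; rewrite !inE => ni nj [] /= e2 e3.
have n0 (l : 'I_k) d : (l, d) != i0 -> (nat_of_ord l, d) != (k', e == 0).
  apply: contraNneq => -[el ->]; rewrite /i0 xpair_eqE eqxx andbT; apply/eqP/val_inj => /=.
  by rewrite el modn_small.
have [|el ->] := h i b j c (ltn_ord i) (ltn_ord j) (n0 _ _ ni) (n0 _ _ nj) e3.
  by apply: eqmod_small => //; apply: bd.
by congr pair; apply: val_inj.
Qed.

Lemma tau_inj : {in [set~ i0] &, injective tau}.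
Proof.
apply: Zd_inj => [i b li|i b j c li lj].
  rewrite /tauN; move: li ke e1; move: k' a e => m x y; clear.
  by case: b => li h1 h2; case: (ltnP i) => h3 /=; lia.
rewrite /tauN !(xpair_eqE _ _ _ _).
move: li lj ke e1; move: k' a e => m x y; clear => li lj h1 h2.
case: b; case: c => /=; case: (ltnP i) => h6; case: (ltnP j) => h7 //= h4 h5 _; lia.
Qed.

Lemma sig_inj : {in [set~ i0] &, injective sig}.
Proof.
apply: Zd_inj => [i b li|i b j c li lj].
  rewrite /sigN; move: li ke e1; move: k' a e => m x y; clear.
  by case: b => li h1 h2; case: (ltnP i) => h3 /=; lia.
rewrite /sigN !(xpair_eqE _ _ _ _).
move: li lj ke e1; move: k' a e => m x y; clear => li lj h1 h2.
case: b; case: c => /=; case: (ltnP i) => h6; case: (ltnP j) => h7 //= h4 h5 _; lia.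
Qed.

Let Tr : {set dih * dih * dih} := [set (x, tau x, sig x) | x in [set~ i0]].

Lemma image_misses_one (f : dih -> dih) : {in [set~ i0] &, injective f} ->
  exists m, forall y, (y \in f @: [set~ i0]) = (y != m).
Proof.
move=> fi; have : #|~: (f @: [set~ i0])| == 1.
  have := cardsC (f @: [set~ i0]); rewrite (card_in_imset fi) cardsC1.
  have : 0 < #|{: dih}| by apply/card_gt0P; exists i0.
  by move: #|{: dih}| #|~: _| => x y; clear; lia.
case/cards1P => m em; exists m => y.
by rewrite -[LHS]negbK -in_setC em inE.
Qed.

(** For odd k the Sylow 2-subgroups are cyclic and the table has no full transversal; omitting one
    row treats both parities of k alike. Rotations and reflections are each split into halves with
    columns of both types, so that all four parity classes are large, as [wfn] demands for the added
    labels. *)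
Lemma near_transversal : exists (Tr : {set dih * dih * dih}) (miss : axis -> dih),
  [/\ Tr \subset cayley k',
    forall a t t', t \in Tr -> t' \in Tr -> co a t = co a t' -> t = t',
    forall a y, y != miss a -> exists2 t, t \in Tr & co a t = y,
    forall a t, t \in Tr -> co a t != miss a &
    forall b1 b2, k./2 - 1 <= #|[set t in Tr | (t.1.1.2 == b1) && (t.1.2.2 == b2)]|].
Proof.
have [m1 h1] := image_misses_one tau_inj; have [m2 h2] := image_misses_one sig_inj.
exists Tr, (fun a => match a with A0 => i0 | A1 => m1 | A2 => m2 end); split.
- apply/subsetP => _ /imsetP[x _ ->]; by rewrite inE /= dmul_tau.
- move=> a0 _ _ /imsetP[x xi ->] /imsetP[y yi ->]; case: a0 => /= [->|/(tau_inj xi yi) ->|/(sig_inj xi yi) ->] //.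
- case=> y.
  + by move=> yi; exists (y, tau y, sig y) => //; apply: imset_f; rewrite !inE.
  + by rewrite -h1 => /imsetP[x xi ->]; exists (x, tau x, sig x) => //; apply: imset_f.
  + by rewrite -h2 => /imsetP[x xi ->]; exists (x, tau x, sig x) => //; apply: imset_f.
- move=> a0 _ /imsetP[x xi ->]; case: a0 => /=.
  + by move: xi; rewrite !inE.
  + by rewrite -h1 imset_f.
  + by rewrite -h2 imset_f.
move=> b1 b2; rewrite -/a.
(* The first row of the class of (b1, b2); a - 1 consecutive rows from there stay below the omitted
   row. *)
pose off := if b1 == b2 then 0 else if b1 then a + e else a.
pose row (u : 'I_(a - 1)) : dih := (inZp (off + u), b1).
have lo (u : 'I_(a - 1)) : off + u < k'.
  have := ltn_ord u; rewrite /off; move: (val u) ke e1 => w; move: k' a e; clear => m x y.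
  by case: (b1 == b2); case: b1 => /=; lia.
have vr u : nat_of_ord (row u).1 = off + u by rewrite /= modn_small //; apply: ltnW; apply: lo.
rewrite -[X in X <= _](card_ord (a - 1)) -(@card_imset _ _ (fun u => (row u, tau (row u), sig (row u)))); last first.
  by move=> u v /(congr1 (fun t : dih * dih * dih => nat_of_ord t.1.1.1)); rewrite !vr => /addnI /val_inj.
apply: subset_leq_card; apply/subsetP => _ /imsetP[u _ ->]; rewrite inE /= eqxx /=; apply/andP; split.
  apply: imset_f; rewrite !inE; apply: contraTneq (lo u) => /(congr1 (fun x : dih => nat_of_ord x.1)).
  by rewrite vr /= modn_small // => ->; rewrite ltnn.
have ->: (off + u) %% k = off + u by apply: vr.
rewrite /tauN; have := ltn_ord u; rewrite /off; move: (nat_of_ord u) ke e1 => w; move: k' a e; clear => m x y.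
case: b1; case: b2 => /= h1 h2 h3; case: ltnP => //=; lia.
Qed.

End NearTransversal.

(** * Random relabelling *)

Section Relabel.

Variable T : finType.
Implicit Types (t q : T * T * T) (L P : {set T * T * T}).
Variable p : axis -> {perm T}.

Definition relabel q : T * T * T := (p A0 q.1.1, p A1 q.1.2, p A2 q.2).

Lemma co_relabel a q : co a (relabel q) = p a (co a q).
Proof. by case: a. Qed.

Lemma op_relabel a q q' : op a (relabel q) = op a (relabel q') -> op a q = op a q'.
Proof. by rewrite /op !co_relabel => -[/perm_inj -> /perm_inj ->]. Qed.

Lemma relabel_inj : injective relabel.
Proof. by move=> [[r c] s] [[r' c'] s'] [/perm_inj -> /perm_inj -> /perm_inj ->]. Qed.

Lemma plat_relabel P : plat P -> plat (relabel @: P).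
Proof.
move=> pl a _ _ /imsetP[q qP ->] /imsetP[q' qP' ->] /op_relabel e.
by rewrite (pl a q q').
Qed.

Lemma line_relabel P a v : #|line (relabel @: P) a v| = #|line P a ((p a)^-1%g v)|.
Proof.
rewrite -[RHS](card_imset _ relabel_inj); apply: eq_card => t; rewrite [_ \in line _ _ _]in_set; apply/andP/imsetP.
  by case=> /imsetP[q qP ->]; rewrite co_relabel => /eqP <-; exists q; rewrite // inE qP permK eqxx.
by case=> q; rewrite inE => /andP[qP /eqP e] ->; rewrite imset_f // co_relabel e permKV eqxx.
Qed.

Lemma latin_relabel L : latin L -> latin (relabel @: L).
Proof.
move=> [pl ex]; split; first exact: plat_relabel.
move=> a [y z]; have [t tL e] := ex a ((p (nxt a))^-1%g y, (p (nxt (nxt a)))^-1%g z).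
exists (relabel t); first exact: imset_f.
by rewrite /op !co_relabel; case: e => -> ->; rewrite !permKV.
Qed.

Section Fixing.
Variable A : axis -> {set T}.
Hypothesis pA : forall a, perm_on (A a) (p a).

Lemma perm_outside a x : p a x \notin A a -> p a x = x.
Proof.
case: (boolP (x \in A a)) => xA; last by rewrite (out_perm (pA a)).
by rewrite perm_closed // xA.
Qed.

Lemma perm_stable a (C : {set T}) x : A a \subset C -> (p a x \in C) = (x \in C).
Proof.
move=> sub; case: (boolP (x \in A a)) => xA; last by rewrite (out_perm (pA a)).
by rewrite !(subsetP sub) // perm_closed.
Qed.

(** Used for the triples of the initial square that are not tame: relabelling must not make them
    relevant to P. *)
Lemma bad_relabel P t : (forall a, co a t \notin A a) -> bad (relabel @: P) t -> bad P t.
Proof.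
move=> tA /badP[_ [a [/imsetP[q qP ->] e]]]; apply/badP; exists q, a; split=> //.
move: e; rewrite /op !co_relabel => -[e1 e2].
have f b : p b (co b q) = co b t -> co b q = co b t.
  by move=> e; rewrite -[RHS]e (perm_outside (a := b)) // e.
by rewrite (f _ e1) (f _ e2).
Qed.

End Fixing.

End Relabel.

Lemma relabelK (T : finType) (p : axis -> {perm T}) q : relabel (fun a => (p a)^-1%g) (relabel p q) = q.
Proof. by case: q => [[r c] s]; rewrite /relabel /= !permK. Qed.

(** * The initial state and the number of triples that are not isolated *)

Section Start.

Variable T : finType.
Implicit Types (t q : T * T * T).
Variables (F : frame T) (L0 P : {set T * T * T}) (m : nat).
Hypothesis latL : latin L0.
Hypothesis goneL : forall a v, #|gone F L0 a v| <= 1.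
Hypothesis refL : forall t, t \in L0 -> (forall a, co a t \in core F) -> t \in ref F.
Hypothesis one_special : #|~: core F| <= 1.
Hypothesis platP : plat P.
Hypothesis lineP : forall a v, #|line P a v| <= m.
Hypothesis specialP : forall q a, q \in P -> co a q \notin core F ->
  co (nxt a) q \in core F /\ co (nxt (nxt a)) q \in core F.
Hypothesis okL : forall t, t \in L0 -> bad P t -> tame F t.

Definition isolated := [set q in P | [&& co A0 q \in core F, co A1 q \in core F & co A2 q \in core F] &&
  [forall t in L0, share2 q t ==> [&& t \in ref F, co A0 t \in core F, co A1 t \in core F, co A2 t \in core F &
     [forall q' in P, share2 q' t ==> (q' == q)]]]].

Definition clash := [set q in P | [exists q' in P, (q' != q) && [exists t in L0, share2 q t && share2 q' t]]].

Lemma isolatedP q : q \in isolated -> [/\ q \in P, forall a, co a q \in core F &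
  forall t, t \in L0 -> share2 q t -> [/\ t \in ref F, forall a, co a t \in core F &
        forall q', q' \in P -> share2 q' t -> q' = q]].
Proof.
rewrite inE => /andP[qP /andP[/and3P[c0 c1 c2] /forall_inP h]]; split=> //; first by case.
move=> t tL sh; have := h t tL; rewrite sh /= => /and5P[tr t0 t1 t2 /forall_inP u]; split=> //; first by case.
by move=> q' qP' sh'; have := u q' qP'; rewrite sh' => /eqP.
Qed.

Lemma sum_special (f : axis -> T -> nat) c : (forall a v, f a v <= c) ->
  \sum_(v in ~: core F) f A0 v + (\sum_(v in ~: core F) f A1 v + \sum_(v in ~: core F) f A2 v) <= 3 * c.
Proof.
have h a : (forall a v, f a v <= c) -> \sum_(v in ~: core F) f a v <= c.
  move=> hf; apply: (@leq_trans (#|~: core F| * c)); first by rewrite -sum_nat_const; apply: leq_sum.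
  by rewrite -[X in _ <= X]mul1n leq_mul2r one_special orbT.
by move=> hf; rewrite !mulSn mul0n addn0; apply: leq_add; [|apply: leq_add]; apply: h.
Qed.

(** Without a clash, a pending triple fails to be isolated only if it has a label outside the core
    or one of its pairs is placed on an outside line. There is at most one outside line per axis,
    with at most m triples of the first kind and b of the second. *)
Lemma card_not_isolated b : (forall a v, #|placed P L0 a v| <= b) ->
  #|P :\: isolated :\: L0| <= #|clash| + 3 * b + 3 * m.
Proof.
move=> pb; rewrite -addnA addnC.
pose U (f : axis -> T -> {set T * T * T}) :=
  \bigcup_(v in ~: core F) f A0 v :|: (\bigcup_(v in ~: core F) f A1 v :|: \bigcup_(v in ~: core F) f A2 v).
have cU (f : axis -> T -> {set T * T * T}) c : (forall a v, #|f a v| <= c) -> #|U f| <= 3 * c.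
  move=> hf; apply: leq_trans (sum_special (f := fun a v => #|f a v|) hf).
  apply: leq_trans (leq_card_setU _ _) _; apply: leq_add; first exact: leq_card_bigcup.
  by apply: leq_trans (leq_card_setU _ _) _; apply: leq_add; apply: leq_card_bigcup.
have inU (f : axis -> T -> {set T * T * T}) a v q : v \notin core F -> q \in f a v -> q \in U f.
  move=> vc qf; rewrite /U 2!in_setU; apply/or3P; case: a qf => qf;
  [apply: Or31|apply: Or32|apply: Or33]; by apply/bigcupP; exists v; rewrite // in_setC.
apply: (@leq_trans #|(U (placed P L0) :|: U (line P)) :|: clash|); last first.
  apply: leq_trans (leq_card_setU _ _) _; rewrite leq_add2r.
  by apply: leq_trans (leq_card_setU _ _) _; apply: leq_add; apply: cU.
apply: subset_leq_card; apply/subsetP => q /setDP[/setDP[qP qI] qL].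
apply: contraR qI; rewrite 2!in_setU !negb_or => /andP[/andP[n1 n2] n3].
have qc a : co a q \in core F.
  by apply: contraR n2 => h; apply: (inU _ a (co a q)) => //; rewrite inE qP eqxx.
rewrite inE qP (qc A0) (qc A1) (qc A2) /=; apply/forall_inP => t tL; apply/implyP => sh.
have tc a : co a t \in core F.
  have /share2P[d e] := sh.
  have [->|ab] : a = d \/ d <> a by case: (a) (d) => [] []; (by left) || (by right).
    apply: contraR n1 => h; apply: (inU _ d (co d t)) => //.
    by rewrite placedP // qP qL (locP latL tL (esym e)) eqxx.
  by rewrite -(op_co ab e).
rewrite refL ?(tc A0) ?(tc A1) ?(tc A2) //=; apply/forall_inP => q' qP'; apply/implyP => sh'.
apply: contraR n3 => ne; rewrite inE qP; apply/existsP; exists q'; rewrite qP' ne.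
by apply/existsP; exists t; rewrite tL sh sh'.
Qed.

Lemma start_state Th b : (forall a v, #|placed P L0 a v| <= b) -> 3 * b + 1 <= Th ->
  state F Th P isolated (#|T| + 3 * #|P|) L0.
Proof.
move=> pb lt; split=> //.
- move=> a v; apply: leq_trans (leq_addr _ _); apply: leq_trans lt.
  by rewrite /load addnC leq_add // leq_mul2l pb.
- apply: leq_add; last by rewrite leq_mul2l /=; apply: subset_leq_card; apply: subsetDl.
  rewrite -(sum_gone L0 F A0) -sum1_card; apply: leq_sum => v _; exact: goneL.
- move=> q qP _ _ t tL sh; apply: okL => //; apply/existsP; exists q; by rewrite qP.
by move=> q /isolatedP[qP qc h] _ t tL sh; apply: h.
Qed.

End Start.

Lemma card_plat (T : finType) (P : {set T * T * T}) m :
  (forall a v, #|line P a v| <= m) -> #|P| <= #|T| * m.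
Proof.
move=> lineP; rewrite -sum1_card (partition_big (fun q => co A0 q) predT) //= -sum_nat_const.
apply: leq_sum => v _; rewrite sum1dep_card.
by apply: leq_trans (lineP A0 v); apply: subset_leq_card; apply/subsetP => q; rewrite !inE.
Qed.

(** * Choice of the row and column permutations *)

Section Choice.

Variable T : finType.
Implicit Types (t q : T * T * T).
Variables (L0 P : {set T * T * T}) (m : nat).
Hypothesis latL : latin L0.
Hypothesis platP : plat P.
Hypothesis lineP : forall a v, #|line P a v| <= m.

(** The first y is a filler: [loc] on axis A0 reads the column and the symbol. *)
Definition rowL y s := co A0 (loc L0 A0 (y, y, s)).
Definition colL x s := co A1 (loc L0 A1 (x, x, s)).

Lemma rowLP t : t \in L0 -> rowL (co A1 t) (co A2 t) = co A0 t.
Proof. by move=> tL; rewrite /rowL (@locP _ _ latL A0 _ t). Qed.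

Lemma colLP t : t \in L0 -> colL (co A0 t) (co A2 t) = co A1 t.
Proof. by move=> tL; rewrite /colL (@locP _ _ latL A1 _ t). Qed.

(** A triple placed on line v is determined by its label on axis b, since v and the image of this
    label determine the covering triple. So at most M - 1 hits of [p b] are counted, plus the at
    most two labels outside A. *)
Lemma placed_hits (p : axis -> {perm T}) a b v (A : {set T}) (S : T -> {set T}) M :
  b <> a -> #|~: A| <= 2 -> #|[set i in A | p b i \in S i]| < M ->
  (forall q t, q \in P -> t \in L0 -> op a t = op a (relabel p q) -> co a t = v ->
     p b (co b q) \in S (co b q)) ->
  #|placed (relabel p @: P) L0 a v| <= M.+1.
Proof.
move=> ba cA hits hS.
pose C := [set q in P | relabel p q \in placed (relabel p @: P) L0 a v].
have Cv q : q \in C -> exists2 t, q \in P /\ t \in L0 & op a t = op a (relabel p q) /\ co a t = v.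
  rewrite in_set => /andP[qP]; rewrite placedP // => /and3P[_ _ /eqP e].
  by have [lL le] := mem_loc latL a (relabel p q); exists (loc L0 a (relabel p q)).
apply: (@leq_trans #|C|).
  apply: leq_trans (leq_imset_card (relabel p) C); apply: subset_leq_card; apply/subsetP => t tp.
  have : t \in relabel p @: P by move: tp; rewrite in_set in_setD => /andP[/andP[]].
  by case/imsetP => q qP e; apply/imsetP; exists q; rewrite // in_set qP -e.
rewrite -(@card_in_imset _ _ (co b) C); last first.
  move=> q q' /Cv[t [qP tL] [e1 e2]] /Cv[t' [qP' tL'] [e1' e2']] eb.
  have et : t = t'.
    have e3 : co b t = co b t' by rewrite (op_co (a := a) _ e1) ?(op_co (a := a) (b := b) _ e1') ?co_relabel ?eb // => /esym.
    have [c ec] : exists c, forall u u' : T * T * T, co a u = co a u' -> co b u = co b u' -> op c u = op c u'.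
      by move: ba; case: (a); case: (b) => // _; [exists A2|exists A1|exists A2|exists A0|exists A1|exists A0]; rewrite /op /= => u u' -> ->.
    by apply: (latL.1 c) => //; apply: ec; rewrite ?e2.
  by apply: (platP (a := a)) => //; apply: (op_relabel (p := p)); rewrite -e1 -e1' et.
apply: (@leq_trans #|[set i in A | p b i \in S i] :|: ~: A|).
  apply: subset_leq_card; apply/subsetP => _ /imsetP[q /Cv[t [qP tL] [e1 e2]] ->].
  by rewrite in_setU in_set in_setC (hS q t) // andbT orbN.
apply: leq_trans (leq_card_setU _ _) _; move: hits cA; clear; lia.
Qed.

Definition near : {set (T * T * T) * (T * T * T)} :=
  [set u in setX P P | (u.1 != u.2) &&
    [|| co A0 u.1 == co A0 u.2, co A1 u.1 == co A1 u.2 | co A2 u.1 == co A2 u.2]].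

Lemma card_near (R : {set T * T * T}) : #|[set u in near | u.2 \in R]| <= #|R| * (3 * m).
Proof.
rewrite -sum1dep_card -sum_nat_const.
rewrite (partition_big snd (mem R)) /= => [|u /andP[] //].
apply: leq_sum => q qR; rewrite sum1dep_card.
apply: (@leq_trans #|line P A0 (co A0 q) :|: (line P A1 (co A1 q) :|: line P A2 (co A2 q))|).
  rewrite -(@card_in_imset _ _ fst); last first.
    by move=> [u u'] [w w']; rewrite !inE /= => /andP[_ /eqP ->] /andP[_ /eqP ->] ->.
  apply: subset_leq_card; apply/subsetP => _ /imsetP[[u u']] + -> /=; rewrite !inE /=.
  by move=> /andP[/andP[/andP[/andP[-> _] /andP[_ h]] _] /eqP <-].
rewrite !mulSn mul0n addn0.
by do 2 (apply: leq_trans (leq_card_setU _ _) _; apply: leq_add => //).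
Qed.

(* u = (q, q') belongs to it when, after relabelling, the triple of L0 with the
   row of q', the symbol of q and the column of either shares a pair with both. *)
Definition crossing (al be : {perm T}) :=
  [set u in near | al u.2.1.1 == rowL (be (if u.1.2 == u.2.2 then u.1.1.2 else u.2.1.2)) u.1.2].

(** The common triple meets q and q' in pairs of different axes, since q and q' share no pair. Two
    such pairs overlap in one label, so q and q' are near, and the position of their labels in that
    triple is one equation for an image under [al]. Either member of the ordered pair may be the
    clashing one, whence the factor 2. *)
Lemma clash_crossing (al be : {perm T}) p : p A0 = al -> p A1 = be -> p A2 = 1%g ->
  #|clash L0 (relabel p @: P)| <= 2 * #|crossing al be|.
Proof.
move=> p0 p1 p2.
apply: (@leq_trans #|[set relabel p u.1 | u in crossing al be] :|: [set relabel p u.2 | u in crossing al be]|); last first.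
  apply: leq_trans (leq_card_setU _ _) _; rewrite mul2n -addnn; apply: leq_add; exact: leq_imset_card.
apply: subset_leq_card; apply/subsetP => t; rewrite in_set => /andP[/imsetP[q qP ->]].
case/existsP => _ /and3P[/imsetP[q' qP' ->] ne /existsP[x /and3P[xL sh sh']]] {t}.
have {}ne : q != q' by apply: contraNneq ne => ->.
have xr := rowLP xL.
suff : (q, q') \in crossing al be \/ (q', q) \in crossing al be.
  by case=> h; rewrite in_setU; apply/orP; [left|right]; apply/imsetP; eexists; try exact: h.
have nes a : op a q <> op a q' by move=> e; case/eqP: ne; apply: platP e.
case/share2P: sh => a ea; case/share2P: sh' => b eb.
have nab : a <> b.
  by move=> ab; subst b; apply: (nes a); apply: (op_relabel (p := p)); rewrite ea eb.
have s1 : forall z, p A2 z = z by move=> z; rewrite p2 perm1.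
have mem u u' : u \in P -> u' \in P -> u != u' ->
   [|| co A0 u == co A0 u', co A1 u == co A1 u' | co A2 u == co A2 u'] ->
   al u'.1.1 = rowL (be (if u.2 == u'.2 then u.1.2 else u'.1.2)) u.2 -> (u, u') \in crossing al be.
  by move=> uP uP' n h e; rewrite in_set /= e eqxx andbT in_set /= n h in_setX uP uP'.
have ne' : q' != q by rewrite eq_sym.
move: q q' qP qP' ne ne' ea eb nes xr mem => [[r c] s] [[r' c'] s'] qP qP' ne ne' + + nes + mem.
case: x xL => [[x y] z] xL; rewrite /op /relabel /= !s1 !p0 !p1.
case: a nab; case: b => nab; try by case: nab.
all: rewrite /= => -[e1 e2] -[e3 e4] xr.
- by left; apply: mem => //=; rewrite ?e2 ?e3 eqxx ?orbT // e4 e1.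
- have cc : c = c' by apply: (@perm_inj _ be); rewrite e1 e4.
  by left; apply: mem => //=; rewrite -?cc ?eqxx ?orbT // if_same e3 e1 e2.
- by right; apply: mem => //=; rewrite ?e1 ?e4 eqxx ?orbT // e2 e3.
- have rr : r = r' by apply: (@perm_inj _ al); rewrite e2 e3.
  have ss : s != s' by apply/eqP => h; apply: (nes A1); rewrite /op /= h rr.
  by left; apply: mem => //=; rewrite -?rr ?eqxx ?orbT // (negbTE ss) e2 e4 e1.
- have cc : c = c' by apply: (@perm_inj _ be); rewrite e2 e3.
  by right; apply: mem => //=; rewrite -?cc ?eqxx ?orbT // if_same e1 e2 e4.
have rr : r = r' by apply: (@perm_inj _ al); rewrite e1 e4.
have ss : s' != s by apply/eqP => h; apply: (nes A1); rewrite /op /= h rr.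
by right; apply: mem => //=; rewrite -?rr ?eqxx ?orbT // (negbTE ss) e1 e2 e3.
Qed.

(** The placements on rows depend on the column permutation [be] alone, those on symbols on both
    permutations. Hence [be] is chosen first and [al] afterwards, with the remaining two families of
    lines and the crossings as its constraints. *)
Lemma good_relabel (Ar Ac : {set T}) M :
  #|~: Ar| <= 2 -> #|~: Ac| <= 2 -> 14 <= #|T| -> 4 * #|T| * m ^ M < M`! ->
  exists p : axis -> {perm T}, [/\ perm_on Ar (p A0), perm_on Ac (p A1), p A2 = 1%g,
    forall a v, #|placed (relabel p @: P) L0 a v| <= M.+1 &
    #|clash L0 (relabel p @: P)| <= 26 * m ^ 2].
Proof.
move=> cr cc T14 lt.
have cP := card_plat lineP.
have cA (A : {set T}) : #|~: A| <= 2 -> #|T| <= #|A| + 2.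
  by move=> h; rewrite -(cardsC A) leq_add2l.
have cAr := cA _ cr; have cAc := cA _ cc.
have Ac0 : 0 < #|Ac| by move: cAc T14; clear; lia.
have Ar0 : 0 < #|Ar| by move: cAr T14; clear; lia.
pose Sb x c := [set colL x (co A2 q) | q in line P A1 c].
have cSb x c : #|Sb x c| <= m by apply: leq_trans (leq_imset_card _ _) (lineP _ _).
have ltb : 2 * #|T| * m ^ M < M`!.
  by apply: leq_ltn_trans lt; rewrite leq_mul2r leq_mul2r /= !orbT.
have [be [beA hitb _]] := @good_perm_exists T Ac T Sb m M T set0 id id 0
   (fun x (h : x \in set0) => ltac:(by rewrite inE in h)) cSb ltb ltac:(by rewrite cards0) Ac0.
pose Sa (j : T + T) r := match j with
  | inl y => [set rowL y (co A2 q) | q in line P A0 r]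
  | inr z => [set rowL (be (co A1 q)) z | q in line P A0 r] end.
have cSa j r : #|Sa j r| <= m by case: j => z; apply: leq_trans (leq_imset_card _ _) (lineP _ _).
pose Q := [set u in near | u.2.1.1 \in Ar].
(* The left side is at most 6 * m ^ 2 times [#|T|]; the factor 7 absorbs the two labels outside [Ar]
   as soon as [14 <= #|T|]. *)
have cQ : 2 * #|Q| <= #|Ar| * (7 * m ^ 2).
  have h : #|Q| <= #|P| * (3 * m).
    apply: leq_trans (card_near P); apply: subset_leq_card; apply/subsetP => u; rewrite !in_set.
    by case/andP => /andP[/andP[-> ->] ->] _.
  by move: h cP cAr T14; move: #|Q| #|P| #|T| #|Ar| => x y z w; clear; nia.
have lta : 2 * #|{: T + T}| * m ^ M < M`! by rewrite card_sum addnn -mul2n mulnA.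
have [al [alA hita cross]] := @good_perm_exists T Ar _ Sa m M _ Q (fun u => u.2.1.1)
   (fun u => rowL (be (if u.1.2 == u.2.2 then u.1.1.2 else u.2.1.2)) u.1.2) (7 * m ^ 2)
   (fun u (h : u \in Q) => ltac:(by move: h; rewrite in_set => /andP[])) cSa lta cQ Ar0.
pose p a := match a with A0 => al | A1 => be | A2 => 1%g end.
exists p; split=> //.
- case=> v.
  + apply: (placed_hits (b := A1) _ cc (hitb v)) => // q t qP tL; rewrite /op /= perm1 => -[e1 e2] e3.
    apply/imsetP; exists q; first by rewrite in_set qP eqxx.
    by rewrite /= -e1 -e2 -e3; exact: esym (colLP tL).
  + apply: (placed_hits (b := A0) _ cr (hita (inl v))) => // q t qP tL; rewrite /op /= perm1 => -[e1 e2] e3.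
    apply/imsetP; exists q; first by rewrite in_set qP eqxx.
    by rewrite /= -e1 -e2 -e3; exact: esym (rowLP tL).
  apply: (placed_hits (b := A0) _ cr (hita (inr v))) => // q t qP tL; rewrite /op /= => -[e1 e2] e3.
  apply/imsetP; exists q; first by rewrite in_set qP eqxx.
  by rewrite /= -e1 -e2 -e3; exact: esym (rowLP tL).
apply: leq_trans (clash_crossing (al := al) (be := be) _ _ _) _ => //.
(* Rows outside [Ar] are not randomized. They carry at most 2 * m triples, each near at most 3 * m
   others, so the clashes number at most 2 * (7 + 6) * m ^ 2. *)
pose R := [set q in P | q.1.1 \notin Ar].
have cR : #|R| <= 2 * m.
  apply: (@leq_trans #|\bigcup_(r in ~: Ar) line P A0 r|).
    apply: subset_leq_card; apply/subsetP => q; rewrite in_set => /andP[qP n].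
    by apply/bigcupP; exists q.1.1; rewrite in_set // qP eqxx.
  apply: leq_trans (leq_card_bigcup _ _) _; apply: (@leq_trans (#|~: Ar| * m)).
    by rewrite -sum_nat_const; apply: leq_sum.
  by rewrite leq_mul2r cr orbT.
have cN : #|crossing al be| <= 7 * m ^ 2 + #|R| * (3 * m).
  apply: leq_trans (leq_add cross (card_near R)); apply: leq_trans (leq_card_setU _ _).1.
  apply: subset_leq_card; apply/subsetP => u; rewrite in_setU [_ \in crossing _ _]in_set => /andP[un e].
  case: (boolP (u.2.1.1 \in Ar)) => h; apply/orP; [left|right].
    by rewrite in_set e andbT in_set un h.
  rewrite in_set un in_set h andbT /=.
  by move: un; rewrite in_set => /andP[]; rewrite in_set => /andP[_ ->].
by move: cN cR; move: #|crossing al be| #|R| => x y; clear; nia.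
Qed.

End Choice.

(** * Numerical estimates *)

Lemma density_lt_exp m n : 12 <= m -> n <= 4 * 2709 * m -> 4 * n < 2 ^ (8 * m).
Proof.
have [e [he h]] : exists e, e <= 14 /\ 4 * 2709 <= 2 ^ e by exists 14; split; vm_compute.
move=> m12 nm; apply: (@leq_trans (2 ^ (2 + e + m))); last first.
  by rewrite leq_exp2l //; move: m12 he; clear; lia.
rewrite 2!expnD -mulnA ltn_pmul2l //; apply: leq_ltn_trans nm _.
apply: (@leq_ltn_trans (2 ^ e * m)); first by rewrite leq_mul2r h orbT.
by rewrite ltn_pmul2l ?expn_gt0 // ltn_expl.
Qed.

(** With M = 8 * m, [expn_le_fact] bounds the factorial below by (2 * m) ^ (8 * m), which leaves the
    factor 2 ^ (8 * m) against 4 * n. *)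
Lemma expn_lt_fact n m : 12 <= m -> n <= 4 * 2709 * m -> 4 * n * m ^ (8 * m) < (8 * m)`!.
Proof.
move=> m12 nm; have m0 : 0 < m by apply: leq_trans m12.
have h := expn_le_fact (8 * m).
have h2 : 2 ^ (8 * m) * m ^ (8 * m) <= (8 * m)`!.
  rewrite -(leq_pmul2l (_ : 0 < 4 ^ (8 * m))) ?expn_gt0 //; apply: leq_trans h.
  by rewrite -!expnMn leq_exp2r ?muln_gt0 // mulnA.
by apply: leq_trans h2; rewrite ltn_pmul2r ?expn_gt0 ?m0 // density_lt_exp.
Qed.

Lemma budget_arith m n N X M : 12 <= m -> n <= 4 * 2709 * m -> N <= 4 * 2709 * M ->
  12 * m <= M -> X <= 26 * M + 3 * (8 * m).+1 + 3 * m ->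
  n + 3 * N + 33 * X < 130 * 278 * M /\ n + 3 * N + 33 * X + 7 * N < 400 * 278 * M.
Proof. lia. Qed.

(** The threshold is 290 * m, and [12 <= m] gives 278 * m <= 290 * m - 143. The numbers of unusable
    lines are 130 * m before the isolated insertions and 400 * m at the end; 7 * N is the dominant
    term. *)
Lemma budget m n N X : 12 <= m -> n <= 4 * 2709 * m -> N <= n * m ->
  X <= 26 * m ^ 2 + 3 * (8 * m).+1 + 3 * m ->
  n + 3 * N + 33 * X < (130 * m).+1 * (290 * m - 143) /\
  n + 3 * N + 33 * X + 7 * N < (400 * m).+1 * (290 * m - 143).
Proof.
rewrite -mulnn => h1 h2 h3 h4.
have h5 : N <= 4 * 2709 * (m * m) by apply: leq_trans h3 _; rewrite mulnA leq_mul2r h2 orbT.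
have h6 : 278 * m <= 290 * m - 143 by move: h1; clear; lia.
have h7 : 12 * m <= m * m by rewrite leq_mul2r h1 orbT.
have h8 w : w * 278 * (m * m) <= (w * m).+1 * (290 * m - 143).
  rewrite mulnACA mulSn; apply: leq_trans (leq_addl _ _); by rewrite leq_mul2l h6 orbT.
have [h9 h10] := budget_arith h1 h2 h5 h7 h4.
by split; [apply: leq_trans h9 (h8 130)|apply: leq_trans h10 (h8 400)].
Qed.

Section Main.

Variable T : finType.
Implicit Types (t q : T * T * T).
Variables (F : frame T) (k kq m : nat) (L0 P : {set T * T * T}) (Ar Ac : {set T}).

Lemma completable_triples : wf F k kq -> latin L0 ->
  (forall a v, #|gone F L0 a v| <= 1) ->
  (forall t, t \in L0 -> (forall a, co a t \in core F) -> t \in ref F) ->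
  #|~: core F| <= 1 -> plat P -> (forall a v, #|line P a v| <= m) ->
  (forall q a, q \in P -> co a q \notin core F ->
    co (nxt a) q \in core F /\ co (nxt (nxt a)) q \in core F) ->
  (forall t, t \in L0 -> ~~ tame F t -> [/\ co A0 t \notin Ar, co A1 t \notin Ac & ~~ bad P t]) ->
  Ar \subset core F -> Ac \subset core F -> #|~: Ar| <= 2 -> #|~: Ac| <= 2 ->
  12 <= m -> #|T| <= 4 * 2709 * m -> 5000 * m <= k -> 2500 * m - 1 <= kq ->
  exists2 L, latin L & P \subset L.
Proof.
move=> wfF latL goneL refL one platP lineP specialP okL sr sc cr cc m12 nm km kqm.
have T14 : 14 <= #|T|.
  apply: leq_trans (_ : k <= _); first by move: m12 km; clear; lia.
  by rewrite -(wfk wfF true); apply: max_card.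
have [p [p0 p1 p2 pl cl]] := good_relabel latL platP lineP cr cc T14 (expn_lt_fact m12 nm).
pose A a := match a with A0 => Ar | A1 => Ac | A2 => set0 end.
have pA a : perm_on (A a) (p a).
  by case: a => //=; rewrite p2 perm_on1.
have sA a : A a \subset core F by case: a => //=; rewrite sub0set.
have platP' := plat_relabel (p := p) platP.
have lineP' a v : #|line (relabel p @: P) a v| <= m by rewrite line_relabel.
have specialP' q a : q \in relabel p @: P -> co a q \notin core F ->
    co (nxt a) q \in core F /\ co (nxt (nxt a)) q \in core F.
  move=> /imsetP[u uP ->]; rewrite !co_relabel !(perm_stable pA) //; exact: specialP.
have okL' t : t \in L0 -> bad (relabel p @: P) t -> tame F t.
  move=> tL; apply: contraTT => /(okL t tL)[o0 o1]; apply: contra.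
  by apply: (bad_relabel pA) => -[] //=; rewrite inE.
have cP : #|relabel p @: P| <= #|T| * m by apply: leq_trans (leq_imset_card _ _) (card_plat lineP).
have th : 3 * (8 * m).+1 + 1 <= 290 * m by move: m12; clear; lia.
have s0 := start_state latL goneL okL' pl th.
have ni := card_not_isolated latL refL one lineP' pl.
have {}ni := leq_trans ni (leq_add (leq_add cl (leqnn _)) (leqnn _)).
have [b1 b2] := budget m12 nm cP (leqnn _).
have subI : isolated F L0 (relabel p @: P) \subset relabel p @: P by apply/subsetP => q /isolatedP[].
have coreI q a : q \in isolated F L0 (relabel p @: P) -> co a q \in core F by move=> /isolatedP[].
(* Here [defects] is (290 + 36 + 2) * m = 328 * m. The leading coefficients of the three conditions
   are 4 * 328 + 5 * 130 = 1962 against 2500, 9 * 328 + 7 * 130 = 3862 against 5000, and 7 * 328 + 6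
   * 400 = 4696 against 5000. *)
have [|||L latL' sub] := completion wfF platP' lineP' subI coreI one specialP' s0 ni (leqnn _) b1 _ _ b2.
- by rewrite /defects; move: m12 kqm; clear; lia.
- by rewrite /defects; move: m12 km; clear; lia.
- by rewrite /defects; move: m12 km; clear; lia.
exists (relabel (fun a => (p a)^-1%g) @: L); first exact: latin_relabel.
apply/subsetP => q qP; apply/imsetP; exists (relabel p q); last by rewrite relabelK.
by apply: (subsetP sub); apply: imset_f.
Qed.

End Main.

(** * The theorem *)

Section Cases.

Variables (k' m : nat).
Notation k := k'.+1.
Notation dih := (ordinal k * bool)%type.
Hypothesis m12 : 12 <= m.
Hypothesis km : 5000 * m <= k.

Lemma quarter : 2500 * m - 1 <= k./2 - 1.
Proof.
apply: leq_sub2r; rewrite -[2500 * m]half_double; apply: half_leq.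
by apply: leq_trans km; rewrite -mul2n mulnA.
Qed.

Lemma even_case (P : {set dih * dih * dih}) : k.*2 <= 4 * 2709 * m ->
  plat P -> (forall a v, #|line P a v| <= m) -> exists2 L, latin L & P \subset L.
Proof.
move=> nm platP lineP.
pose F := @dihF k' dih id id set0.
have core v : v \in core F by apply: (emb_core (T := dih) id id set0).
have eF : ref F = cayley k'.
  apply/setP => t; rewrite /F /= setU0; apply/imsetP/idP => [[u h ->]|h]; first by case: u h => [[]].
  by exists t => //; case: t h => [[]].
have wfF : wf F k (k./2 - 1).
  apply: wf_dihF => //.
  - by move=> t; rewrite inE.
  - by move=> t a; rewrite inE.
  - by move=> a b t t'; rewrite inE.
  - by move: k (erefl k) => n _; clear; lia.
  by move=> a x b1 b2; rewrite core.
have latL : latin (cayley k').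
  split; last exact: cayley_latin.
  by move=> a t t' h h'; apply: cayley_plat.
apply: (completable_triples (L0 := cayley k') (Ar := setT) (Ac := setT) wfF latL) => //.
- by move=> a v; rewrite /gone eF setDv (_ : [set _ in _ | _] = set0) ?cards0 //; apply/setP => t; rewrite !inE.
- by move=> t h _; rewrite eF.
- by rewrite (_ : ~: _ = set0) ?cards0 //; apply/setP => v; rewrite !inE core.
- by move=> t h /negP; case; rewrite /tame !core /=; move: h; rewrite inE => /eqP <-; rewrite eqxx.
- by apply/subsetP => v _; apply: core.
- by apply/subsetP => v _; apply: core.
- by rewrite setCT cards0.
- by rewrite setCT cards0.
- by rewrite card_dih.
exact: quarter.
Qed.

Lemma perm_two (T : finType) (x y u v : T) : x != y -> u != v ->
  exists p : {perm T}, p x = u /\ p y = v.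
Proof.
move=> xy uv; exists (tperm x u * tperm (tperm x u y) v)%g; rewrite !permM tpermL tpermL; split=> //.
rewrite tpermD // 1?eq_sym //; apply: contraNneq xy => e.
by rewrite -(inj_eq (@perm_inj _ (tperm x u))) tpermL; apply/eqP.
Qed.

Lemma label_avoiding (T : finType) (P : {set T * T * T}) b w (a1 a2 : axis) v1 v2 :
  (forall a v, #|line P a v| <= m) -> 2 * m + 1 < #|T| ->
  exists x, [/\ x != w, forall q, q \in P -> co a1 q = v1 -> co b q <> x &
    forall q, q \in P -> co a2 q = v2 -> co b q <> x].
Proof.
move=> lineP lt.
have c a v : #|[set co b q | q in line P a v]| <= m by apply: leq_trans (leq_imset_card _ _) (lineP _ _).
have [|x _ /and4P[]] := @pick_avoiding T setT
  [:: [set w]; [set co b q | q in line P a1 v1]; [set co b q | q in line P a2 v2]].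
  rewrite /= cards1 cardsT; apply: leq_ltn_trans lt; rewrite addn0 addnC leq_add2r mul2n -addnn.
  exact: leq_add.
rewrite inE => xw n1 n2 _; exists x; split=> // q qP e ex.
  by case/negP: n1; apply/imsetP; exists q; rewrite // inE qP e eqxx.
by case/negP: n2; apply/imsetP; exists q; rewrite // inE qP e eqxx.
Qed.

(** On each axis a label y is sent to None and a label z to the one missed by the near transversal.
    They are chosen so that no triple of P contains two of the y, or a y and a z of different axes.
    Then a triple of P has at most one label outside the core, and the lone triples cover no pair of
    P. The random permutations leave these labels in place. *)
Lemma odd_case (P : {set option dih * option dih * option dih}) : k.*2.+1 <= 4 * 2709 * m ->
  plat P -> (forall a v, #|line P a v| <= m) -> exists2 L, latin L & P \subset L.
Proof.
move=> nm platP lineP; pose T := option dih.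
have cT : #|{: T}| = k.*2.+1 by rewrite card_option card_dih.
have lt : 2 * m + 1 < #|{: T}| by rewrite cT; move: m12 km; clear; lia.
have av b w a1 v1 a2 v2 := label_avoiding b w a1 a2 v1 v2 lineP lt.
pose y0 : T := None.
have [y1 [_ h10 _]] := av A1 None A0 y0 A0 y0.
have [y2 [_ h20 h21]] := av A2 None A0 y0 A1 y1.
have [z0 [n0 g01 g02]] := av A0 y0 A1 y1 A2 y2.
have [z1 [n1 g10 g12]] := av A1 y1 A0 y0 A2 y2.
have [z2 [n2 g20 g21]] := av A2 y2 A0 y0 A1 y1.
have [Tr [miss [Trc Tri Tro Trm Trn]]] := near_transversal k'.
have sm (x : dih) : None != Some x by [].
rewrite eq_sym in n0; rewrite eq_sym in n1; rewrite eq_sym in n2.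
have [p0 [p0y p0z]] := perm_two n0 (sm (miss A0)).
have [p1 [p1y p1z]] := perm_two n1 (sm (miss A1)).
have [p2 [p2y p2z]] := perm_two n2 (sm (miss A2)).
pose p a := match a with A0 => p0 | A1 => p1 | A2 => p2 end.
pose y a := match a with A0 => y0 | A1 => y1 | A2 => y2 end.
pose z a := match a with A0 => z0 | A1 => z1 | A2 => z2 end.
have py a : p a (y a) = None by case: a.
have pz a : p a (z a) = Some (miss a) by case: a.
have yy a b q : q \in P -> a <> b -> co a q = y a -> co b q <> y b.
  move=> qP; case: a; case: b => // _ e e'.
  - exact: h10 qP e e'.
  - exact: h20 qP e e'.
  - exact: h10 qP e' e.
  - exact: h21 qP e e'.
  - exact: h20 qP e' e.
  - exact: h21 qP e' e.
have yz a b q : q \in P -> a <> b -> co a q = y a -> co b q <> z b.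
  move=> qP; case: a; case: b => // _ e e'.
  - exact: g10 qP e e'.
  - exact: g20 qP e e'.
  - exact: g01 qP e e'.
  - exact: g21 qP e e'.
  - exact: g02 qP e e'.
  - exact: g12 qP e e'.
have iy a v : p a v = None -> v = y a by rewrite -(py a) => /perm_inj.
have iz a v : p a v = Some (miss a) -> v = z a by rewrite -(pz a) => /perm_inj.
pose P' := relabel p @: P.
have platP' : plat P' by apply: plat_relabel.
have lineP' a v : #|line P' a v| <= m by rewrite line_relabel.
have kq : k./2 - 1 <= k by move: k (erefl k) => n _; clear; lia.
have wfF := wf_optF Trc Tri kq Trn.
have latL := latin_prolongation Trc Tri Tro Trm.
have coreP' a v : (v \in ~: [set None; Some (miss a)]) = (v != None) && (v != Some (miss a)).
  by rewrite !inE negb_or.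
have [L latL' sub] : exists2 L, latin L & P' \subset L.
  apply: (completable_triples (Ar := ~: [set None; Some (miss A0)]) (Ac := ~: [set None; Some (miss A1)])
     wfF latL _ _ _ platP' lineP') => //.
  - by move=> a v; apply: prolongation_gone.
  - by move=> t; apply: prolongation_ref.
  - rewrite (_ : ~: _ = [set None]) ?cards1 //; apply/setP => v; rewrite in_setC in_set1.
    by rewrite (optcoreP Tr) negbK.
  - move=> q a /imsetP[u uP ->]; rewrite !(optcoreP Tr) negbK !co_relabel => /eqP /iy e.
    by split; apply/eqP => /iy; apply: (yy a); rewrite //; case: (a).
  - move=> t tL /negP no; have [//|[a ->]] := prolongation_ok tL.
    split; [by rewrite coreP'; case: a; rewrite //= eqxx|by rewrite coreP'; case: a; rewrite //= eqxx|].
    apply/badPn => _ b /imsetP[u uP ->]; rewrite /op !co_relabel.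
    case: a b => -[] /= [] e1 e2.
    + by apply: (yy A1 A2 u uP _ (iy A1 _ e1) (iy A2 _ e2)).
    + by apply: (yz A2 A0 u uP _ (iy A2 _ e1) (iz A0 _ e2)).
    + by apply: (yz A1 A0 u uP _ (iy A1 _ e2) (iz A0 _ e1)).
    + by apply: (yz A2 A1 u uP _ (iy A2 _ e2) (iz A1 _ e1)).
    + by apply: (yy A2 A0 u uP _ (iy A2 _ e1) (iy A0 _ e2)).
    + by apply: (yz A0 A1 u uP _ (iy A0 _ e1) (iz A1 _ e2)).
    + by apply: (yz A1 A2 u uP _ (iy A1 _ e1) (iz A2 _ e2)).
    + by apply: (yz A0 A2 u uP _ (iy A0 _ e2) (iz A2 _ e1)).
    + by apply: (yy A0 A1 u uP _ (iy A0 _ e1) (iy A1 _ e2)).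
  - by apply/subsetP => v; rewrite coreP' (optcoreP Tr) => /andP[].
  - by apply/subsetP => v; rewrite coreP' (optcoreP Tr) => /andP[].
  - by rewrite setCK cards2.
  - by rewrite setCK cards2.
  - by rewrite cT.
  exact: quarter.
exists (relabel (fun a => (p a)^-1%g) @: L); first exact: latin_relabel.
apply/subsetP => q qP; apply/imsetP; exists (relabel p q); last by rewrite relabelK.
by apply: (subsetP sub); apply: imset_f.
Qed.

End Cases.

Import Order.TTheory Num.Theory.

Lemma bij_of_card (T1 T2 : finType) : #|T1| = #|T2| ->
  exists (f : T1 -> T2) (g : T2 -> T1), cancel f g /\ cancel g f.
Proof.
move=> e; exists (fun x => enum_val (cast_ord e (enum_rank x))).
exists (fun y => enum_val (cast_ord (esym e) (enum_rank y))).
by split=> x; rewrite enum_valK ?cast_ordK ?cast_ordKV enum_rankK.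
Qed.

Lemma completable_transfer (n m : nat) (T : finType) (P : 'M[option 'I_n]_n) : #|T| = n ->
  (forall Q : {set T * T * T}, plat Q -> (forall a v, #|line Q a v| <= m) ->
     exists2 L, latin L & Q \subset L) ->
  partial_latin_square P ->
  (forall i, #|[set j | P i j != None]| <= m) -> (forall j, #|[set i | P i j != None]| <= m) ->
  (forall s, #|[set c : 'I_n * 'I_n | P c.1 c.2 == Some s]| <= m) -> completable P.
Proof.
move=> cT comp [Prow Pcol] dr dc ds.
have [|f [g [fK gK]]] := @bij_of_card 'I_n T; first by rewrite card_ord.
pose Q := [set t : T * T * T | P (g t.1.1) (g t.1.2) == Some (g t.2)].
have gi := can_inj gK.
have [||L latL sub] := comp Q.
- move=> a [[r c] s] [[r' c'] s']; rewrite !inE /= => /eqP e /eqP e'.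
  case: a; rewrite /op /= => -[h1 h2]; rewrite -h1 -h2 in e' *.
  + by rewrite (gi _ _ (Pcol _ _ _ _ e e')).
  + by rewrite (gi _ _ (Prow _ _ _ _ e e')).
  by move: e'; rewrite e => -[/gi ->].
- case=> v.
  + apply: leq_trans (dr (g v)); rewrite -(@card_in_imset _ _ (fun q => g (co A1 q))).
      apply: subset_leq_card; apply/subsetP => _ /imsetP[q + ->]; rewrite !inE => /andP[/eqP e /eqP <-].
      by rewrite e.
    move=> [[r c] s] [[r' c'] s']; rewrite !inE /= => /andP[/eqP e /eqP h] /andP[/eqP e' /eqP h'] /gi hc.
    by move: e e'; rewrite h h' hc => -> [/gi ->].
  + apply: leq_trans (dc (g v)); rewrite -(@card_in_imset _ _ (fun q => g (co A0 q))).
      apply: subset_leq_card; apply/subsetP => _ /imsetP[q + ->]; rewrite !inE => /andP[/eqP e /eqP <-].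
      by rewrite e.
    move=> [[r c] s] [[r' c'] s']; rewrite !inE /= => /andP[/eqP e /eqP h] /andP[/eqP e' /eqP h'] /gi hc.
    by move: e e'; rewrite h h' hc => -> [/gi ->].
  apply: leq_trans (ds (g v)); rewrite -(@card_in_imset _ _ (fun q => (g (co A0 q), g (co A1 q)))).
    apply: subset_leq_card; apply/subsetP => _ /imsetP[q + ->]; rewrite !inE => /andP[/eqP e /eqP <-].
    by rewrite e.
  move=> [[r c] s] [[r' c'] s']; rewrite !inE /= => /andP[_ /eqP ->] /andP[_ /eqP ->] [h1 h2].
  by rewrite (gi _ _ h1) (gi _ _ h2).
(* The last label is a filler for the symbol. *)
pose S i j := loc L A2 (f i, f j, f i).
have SP i j : exists2 s, (f i, f j, s) \in L & S i j = (f i, f j, s).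
  have := mem_loc latL A2 (f i, f j, f i); rewrite -/(S i j).
  by case: (S i j) => -[r c] s; rewrite /op /= => -[h [e1 e2]]; rewrite e1 e2 in h *; exists s.
exists (\matrix_(i, j) g (co A2 (S i j)))%R; split; [split|].
- move=> i j1 j2; rewrite !mxE; have [s1 h1 ->] := SP i j1; have [s2 h2 ->] := SP i j2 => /gi /= e.
  have := latL.1 A1 _ _ h1 h2; rewrite /op /= e => /(_ erefl) [/(can_inj fK)] //.
- move=> j i1 i2; rewrite !mxE; have [s1 h1 ->] := SP i1 j; have [s2 h2 ->] := SP i2 j => /gi /= e.
  have := latL.1 A0 _ _ h1 h2; rewrite /op /= e => /(_ erefl) [/(can_inj fK)] //.
move=> i j s e; rewrite mxE; have [s1 h1 ->] := SP i j.
have h : (f i, f j, f s) \in L by apply: (subsetP sub); rewrite inE /= !fK e.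
by have := latL.1 A2 _ _ h1 h erefl => -[->]; rewrite fK.
Qed.

(** From [12 <= m] the order is below 10 ^ 4 * (1 + 1 / 12) * m, which is less than 10836 * m = 4 *
    2709 * m. *)
Lemma order_bounds n m : 12 <= m -> m * (10 * 1000) <= n -> n < m.+1 * (10 * 1000) ->
  n <= 4 * 2709 * m /\ 5000 * m <= n./2.
Proof. lia. Qed.

Lemma dense_nat (x n : nat) : (x%:R <= (10 ^- 4 : rat) * n%:R)%R -> x * (10 * 1000) <= n.
Proof.
rewrite mulrC ler_pdivlMr ?exprn_gt0 // -natrX -natrM ler_nat.
by rewrite (_ : 10 ^ 4 = 10 * 1000).
Qed.

Local Open Scope ring_scope.

Theorem corollary2p4p7 (n : nat) (hn : (12 / 10 : rat) * 10 ^+ 5 < n%:R)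
  (P : 'M[option 'I_n]_n) (hP : partial_latin_square P)
  (hdense : eps_dense (10 ^- 4 : rat) P) : completable P.
Proof.
have n12 : (12 * (10 * 1000) <= n)%N.
  have e : (12 / 10 : rat) * 10 ^+ 5 = (12 * (10 * 1000))%N%:R.
    by rewrite !natrM exprS mulrA divfK // (_ : 10 ^+ 4 = 10 * 1000).
  by move: hn; rewrite e ltr_nat => /ltnW.
(* The largest integer allowed by the density for the number of filled cells on a line; the lower
   bound on n becomes [12 <= m]. *)
pose m := (n %/ (10 * 1000))%N.
have m12 : (12 <= m)%N by rewrite leq_divRL.
have [|le km] := order_bounds m12 (leq_divM _ _).
  by rewrite ltn_ceil.
have [dr dc ds] := hdense.
have md x : (x%:R <= (10 ^- 4 : rat) * n%:R)%R -> (x <= m)%N.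
  by move/dense_nat; rewrite leq_divRL.
have k0 : (0 < n./2)%N by apply: leq_trans km; rewrite muln_gt0 /= (leq_trans _ m12).
have [k' ek] : exists k', n./2 = k'.+1 by exists n./2.-1; rewrite prednK.
rewrite ek in km; have en := odd_double_half n; rewrite ek in en.
have dr' i := md _ (dr i); have dc' j := md _ (dc j); have ds' s := md _ (ds s).
clear dr dc ds md hdense hn n12; clearbody m.
case: (odd n) en => /= en; rewrite -en in le.
  apply: (completable_transfer (T := option ('I_k'.+1 * bool)) _ _ hP dr' dc' ds').
    by rewrite card_option card_dih.
  by move=> Q; apply: odd_case m12 km Q le.
apply: (completable_transfer (T := ('I_k'.+1 * bool)%type) _ _ hP dr' dc' ds').
  by rewrite card_dih.
by move=> Q; apply: even_case m12 km Q le.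
Qed.
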